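(* Let $(K,v)$ be a henselian valued field with $v$ non-trivial and let $a\in K^{\mathrm{sep}}\setminus K$. Assume that $(K(a)|K,v)$ is defectless and that it is not a tame extension. Let $a_0=a,a_1,\dots,a_n$ be a complete distinguished chain of $a$ over $K$, and set $$\epsilon:=\min\{i\mid (K(a_i)|K,v)\text{ is a tame extension}\},$$ so that $1\leq\epsilon\leq n$. Then $$K(a_\epsilon,\dots,a_n)=K(a_\epsilon)\subseteq L_i:=K(a_i)\cap K^r\quad\text{for all } i<\epsilon.$$ Moreover, $$\#S_K(a)\leq\sum_{i=0}^{\epsilon-1}v_p(\deg_{L_i}(a_i))+n-\epsilon+1,$$ where $v_p$ is the $p$-adic valuation and $p$ is the characteristic exponent.
   Context: $\overline{K}$ is a fixed algebraic closure of $K$, $K^{\mathrm{sep}}\subseteq\overline K$ the separable-algebraic closure; the unique extension of $v$ to $\overline K$ is again denoted $v$. $vF$ and $Fv$ denote value group and residue field; $\deg_F(b)=[F(b):F]$. The characteristic exponent $p$ is $1$ if $\operatorname{char} Kv=0$ and $p=\operatorname{char}Kv$ otherwise. $S_K(a) := \{ v(a-a^\prime) \mid a^\prime\neq a \text{ is a } K\text{-conjugate of } a\}$. Defect: for a finite extension $(E|K,v)$, $[E:K]=(vE:vK)[Ev:Kv]\,d(E|K,v)$, where $d(E|K,v)$ is a power of $p$; the extension is defectless if $d(E|K,v)=1$. Tame: an algebraic extension $(E|K,v)$ is tame if every finite subextension $(E'|K,v)$ satisfies: $(vE':vK)$ is coprime to $p$, $E'v|Kv$ is separable, and $d(E'|K,v)=1$.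 $K^r$ (absolute ramification field) is the fixed field in $K^{\mathrm{sep}}$ of $G^r=\{\sigma\in\mathrm{Gal}(\overline K|K)\mid v(\sigma x-x)>vx \text{ for all } x\in K^{\mathrm{sep}}\setminus\{0\}\}$. A pair $(b,c)\in\overline K\times\overline K$ is a distinguished pair over $K$ if: $\deg_K(b)>\deg_K(c)$; $\deg_K(z)<\deg_K(b)$ implies $v(b-c)\geq v(b-z)$; and $v(b-c)=v(b-z)$ implies $\deg_K(z)\geq\deg_K(c)$. A complete distinguished chain of $a$ over $K$ is a chain $a_0=a,a_1,\dots,a_n$ in $\overline K$ such that $(a_i,a_{i+1})$ is a distinguished pair over $K$ for all $i$, and $a_n\in K$. Over a henselian field, $a$ admits such a chain if and only if $(K(a)|K,v)$ is defectless. *)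

(* Defs.v *)
From HB Require Import structures.
From mathcomp Require Import all_boot all_order all_algebra generic_quotient ring_quotient separable finmap.
From mathcomp Require Import boolp classical_sets functions cardinality.

Set Implicit Arguments.
Unset Strict Implicit.
Unset Printing Implicit Defensive.

Import Order.TTheory GRing.Theory.
Local Open Scope classical_set_scope.
Local Open Scope ring_scope.
Local Open Scope quotient_scope.

HB.mixin Record Zmodule_isOrdered G of GRing.Zmodule G := {
  gle : rel G;
  gle_anti : antisymmetric gle;
  gle_trans : transitive gle;
  gle_total : total gle;
  gleD2l : forall z x y : G, gle x y -> gle (z + x) (z + y)
}.

#[short(type="orderedZmodType")]
HB.structure Definition OrderedZmodule :=
  {G of GRing.Zmodule G & Zmodule_isOrdered G}.

Lemma gleD (G : orderedZmodType) (a b c d : G) :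
  gle a b -> gle c d -> gle (a + c) (b + d).
Proof.
move=> ab cd; apply: gle_trans (gleD2l b _ _ cd).
by rewrite addrC [b + c]addrC; apply: gleD2l.
Qed.

(** [withoo G] is G with a top element oo adjoined, encoded as [None]. *)

Definition withoo (G : Type) : Type := option G.

Section WithOO.
Variable G : orderedZmodType.

HB.instance Definition _ := Choice.copy (withoo G) (option G).

Definition le_oo (x y : withoo G) : bool :=
  match x, y with
  | _, None => true
  | None, Some _ => false
  | Some g, Some h => gle g h
  end.

Fact le_oo_refl : reflexive le_oo. Proof. by case=> //= g; case/orP: (gle_total g g). Qed.

Fact le_oo_anti : antisymmetric le_oo.
Proof. by case=> [g|] [h|] //= /gle_anti ->. Qed.

Fact le_oo_trans : transitive le_oo.
Proof. by case=> [g|] [h|] [k|] //=; apply: gle_trans. Qed.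

Fact le_oo_total : total le_oo.
Proof. by case=> [g|] [h|] //=; apply: gle_total. Qed.

HB.instance Definition _ := Order.Le_isPOrder.Build ring_display (withoo G)
  le_oo_refl le_oo_anti le_oo_trans.
HB.instance Definition _ :=
  Order.POrder_isTotal.Build ring_display (withoo G) le_oo_total.

Definition add_oo (x y : withoo G) : withoo G :=
  if x is Some g then if y is Some h then Some (g + h) else None else None.

Fact add_ooA : associative add_oo.
Proof. by case=> [g|] [h|] [k|] //=; rewrite addrA. Qed.

Fact add_ooC : commutative add_oo.
Proof. by case=> [g|] [h|] //=; rewrite addrC. Qed.

Fact add_oo0 : left_id (Some 0) add_oo.
Proof. by case=> [g|] //=; rewrite add0r. Qed.

HB.instance Definition _ :=
  GRing.isNmodule.Build (withoo G) add_ooA add_ooC add_oo0.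

Lemma le_ooE (g h : G) : ((Some g : withoo G) <= Some h) = gle g h.
Proof. by []. Qed.

Lemma leadd_oo (x y z t : withoo G) : x <= y -> z <= t -> x + z <= y + t.
Proof.
by case: x y z t => [g|] [h|] [k|] [l|] //; apply: gleD.
Qed.

End WithOO.

Record valuation (L : fieldType) (G : orderedZmodType) := Valuation {
  vval :> L -> withoo G;
  valoo : forall x, vval x = None <-> x = 0;
  valM : forall x y, vval (x * y) = vval x + vval y;
  valD : forall x y, Order.min (vval x) (vval y) <= vval (x + y)
}.

Section ResidueField.
Variables (L : fieldType) (G : orderedZmodType) (v : valuation L G).

Lemma val0 : v 0 = None. Proof. exact/valoo. Qed.

Lemma val1 : v 1 = 0.
Proof.
have: v 1 = v 1 + v 1 by rewrite -valM mulr1.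
case E: (v 1) => [g|].
  by move=> [] /(congr1 (fun h => h - g)); rewrite subrr addrK => <-.
by move/valoo/eqP: E; rewrite oner_eq0.
Qed.

Lemma valN1 : v (- 1) = 0.
Proof.
have: v (-1) + v (-1) = 0 by rewrite -valM mulrNN mulr1 val1.
case E: (v (-1)) => [g|//] [] gg0.
congr Some; apply/gle_anti.
by case/orP: (gle_total 0 g) => g0; rewrite g0 ?andbT /=;
   have := gleD2l g _ _ g0; rewrite addr0 gg0.
Qed.

Lemma valN x : v (- x) = v x.
Proof. by rewrite -mulN1r valM valN1 add0r. Qed.

Lemma valB_ge (c : withoo G) x y : c <= v x -> c <= v y -> c <= v (x - y).
Proof.
by move=> cx cy; apply: le_trans (valD v _ _); rewrite le_min valN cx cy.
Qed.

Lemma valV x : x != 0 -> v x + v x^-1 = 0.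
Proof. by move=> x0; rewrite -valM divff // val1. Qed.

Definition valring_pred : {pred L} := fun x => (0 : withoo G) <= v x.

Fact valring_subring : subring_closed valring_pred.
Proof.
split=> [|x y|x y]; rewrite /valring_pred !unfold_in.
- by rewrite val1.
- exact: valB_ge.
- by move=> x0 y0; rewrite valM -[0 in X in X <= _]add0r leadd_oo.
Qed.

HB.instance Definition _ :=
  GRing.isSubringClosed.Build L valring_pred valring_subring.

Record valring := ValRing { valring_val :> L; _ : valring_val \in valring_pred }.

HB.instance Definition _ := [isSub for valring_val].
HB.instance Definition _ := [Choice of valring by <:].
HB.instance Definition _ := [SubChoice_isSubComNzRing of valring by <:].

Definition maxideal_pred : {pred valring} := fun x => (0 : withoo G) < v (val x).

Fact maxideal_closed : idealr_closed maxideal_pred.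
Proof.
split.
- by rewrite unfold_in rmorph0 val0.
- by rewrite unfold_in rmorph1 val1 ltxx.
move=> a x y; rewrite !unfold_in rmorphD rmorphM => x0 y0.
apply: lt_le_trans (valD v _ _); rewrite lt_min y0 andbT valM.
apply: (lt_le_trans x0); rewrite -[X in X <= _]add0r leadd_oo //.
exact: (valP a).
Qed.

HB.instance Definition _ := isIdealr.Build valring maxideal_pred maxideal_closed.

Definition resfield : Type := {ideal_quot maxideal_pred}.

HB.instance Definition _ := GRing.ComNzRing.on resfield.

(** Junk value 0 outside the valuation ring. *)
Definition residue (x : L) : resfield :=
  \pi_resfield (insubd (0 : valring) x).

Definition resinv (q : resfield) : resfield :=
  if q == 0 then 0 else residue (val (repr q))^-1.

Fact resinv_mul q : q != 0 -> resinv q * q = 1.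
Proof.
move=> q0; rewrite /resinv (negPf q0).
have: val (repr q) != 0 /\ v (val (repr q)) = 0.
  have: ~~ (repr q \in maxideal_pred).
    apply: contra q0 => rm; rewrite -[q]reprK.
    rewrite -(rmorph0 (\pi_resfield)).
    by apply/eqP/eqP; rewrite -Quotient.idealrBE subr0.
  rewrite unfold_in -leNgt => le0.
  have ge0 := valP (repr q); rewrite unfold_in in ge0.
  have v0 : v (val (repr q)) = 0 by apply/le_anti; rewrite le0 ge0.
  split=> //; apply/eqP => r0.
  by move: v0; rewrite r0 val0.
case=> r0 v0.
have vi : (val (repr q))^-1 \in valring_pred.
  by rewrite unfold_in; have := valV r0; rewrite v0 add0r => ->.
rewrite /residue -{2}[q]reprK -rmorphM -(rmorph1 (\pi_resfield)).
congr (\pi_resfield _); apply: val_inj.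
by rewrite rmorphM rmorph1 /= val_insubd vi mulVf.
Qed.

Fact resinv0 : resinv 0 = 0. Proof. by rewrite /resinv eqxx. Qed.

HB.instance Definition _ :=
  GRing.ComNzRing_isField.Build resfield resinv_mul resinv0.

Lemma residueE x (Ox : x \in valring_pred) :
  residue x = \pi_resfield (ValRing Ox).
Proof.
by congr (\pi_resfield _); apply: val_inj; rewrite val_insubd Ox.
Qed.

Lemma residue_surj (q : resfield) :
  exists2 x, (0 : withoo G) <= v x & residue x = q.
Proof.
exists (val (repr q)); first exact: (valP (repr q)).
rewrite (residueE (valP (repr q))) -[RHS]reprK.
by congr (\pi_resfield _); apply: val_inj.
Qed.

Lemma residueD x y : (0 : withoo G) <= v x -> (0 : withoo G) <= v y ->
  residue (x + y) = residue x + residue y.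
Proof.
move=> Ox Oy.
have Oxy : x + y \in valring_pred by apply: rpredD.
rewrite (residueE Oxy) (residueE Ox) (residueE Oy) -rmorphD.
by congr (\pi_resfield _); apply: val_inj.
Qed.

Lemma residueM x y : (0 : withoo G) <= v x -> (0 : withoo G) <= v y ->
  residue (x * y) = residue x * residue y.
Proof.
move=> Ox Oy.
have Oxy : x * y \in valring_pred by apply: rpredM.
rewrite (residueE Oxy) (residueE Ox) (residueE Oy) -rmorphM.
by congr (\pi_resfield _); apply: val_inj.
Qed.

Lemma residue_eq0 x : (0 : withoo G) <= v x ->
  (residue x == 0) = ((0 : withoo G) < v x).
Proof.
move=> Ox; rewrite (residueE Ox) -(rmorph0 (\pi_resfield)).
by rewrite -Quotient.idealrBE subr0.
Qed.

End ResidueField.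

Arguments residue {L G} v x.

Section Subfields.
Variable L : fieldType.
Implicit Types (E F : set L) (x : L).

Definition subfield E : Prop := divring_closed (in_set E).

Definition adjoin F (S : set L) : set L := smallest subfield (F `|` S).

Definition is_basis F E (n : nat) (b : 'I_n -> L) : Prop :=
  [/\ forall i, E (b i),
      forall c : 'I_n -> L, (forall i, F (c i)) ->
        \sum_(i < n) c i * b i = 0 -> forall i, c i = 0
    & forall x, E x -> exists2 c : 'I_n -> L,
        (forall i, F (c i)) & x = \sum_(i < n) c i * b i].

Definition finite_ext F E : Prop :=
  exists n, exists b : 'I_n -> L, is_basis F E b.

(** [degree F E] is [E : F], with the junk value 0 for infinite extensions. *)
Definition degree F E : nat :=
  xget 0%N [set n | exists b : 'I_n -> L, is_basis F E b].

(** [deg F x] is [F(x) : F]. *)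
Definition deg F x : nat := degree F (adjoin F [set x]).

Definition algebraic_over F x : Prop :=
  exists q : {poly L}, [/\ q != 0, q \is a polyOver (in_set F) & root q x].

Definition algebraic_ext F E : Prop := forall x, E x -> algebraic_over F x.

Definition is_minpoly F x (q : {poly L}) : Prop :=
  [/\ q \is monic, q \is a polyOver (in_set F), root q x
    & forall r : {poly L}, r != 0 -> r \is a polyOver (in_set F) -> root r x ->
        (size q <= size r)%N].

Definition separable_over F x : Prop :=
  exists2 q : {poly L}, is_minpoly F x q & separable_poly q.

Definition separable_ext F E : Prop := forall x, E x -> separable_over F x.

Definition sepclosure F : set L := [set x | separable_over F x].

Definition is_gal F (s : {rmorphism L -> L}) : Prop :=
  bijective s /\ forall x, F x -> s x = x.

End Subfields.

(** Index of a subgroup H in G, with the junk value 0 when it is infinite. *)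
Definition group_index (A : zmodType) (H G : set A) : nat :=
  #|` fset_set [set [set g + h | h in H] | g in G]|.

Definition char_exp (k : fieldType) : nat :=
  xget 1%N [set p | p \in [pchar k]].

(** Below, the valued fields are the subfields of [L], carrying the restriction
    of [v]; they are given as sets. *)

Section ValuedFields.
Variables (L : fieldType) (G : orderedZmodType) (v : valuation L G).
Implicit Types (E F K : set L) (a b c x z : L).

Definition value_group F : set G := [set g | exists2 x, F x & v x = Some g].

(** The residue field Fv, identified with its image in Lv. *)
Definition residues F : set (resfield v) :=
  [set residue v x | x in [set x | F x /\ (0 : withoo G) <= v x]].

Definition nontrivial_on K : Prop :=
  exists x, [/\ K x, x != 0 & v x != 0].

(** [v] is the unique extension of its restriction to [K], up to equivalence of
    valuations (i.e. equality of valuation rings). *)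
Definition henselian K : Prop :=
  forall (H : orderedZmodType) (w : valuation L H),
    (forall x, K x -> ((0 : withoo H) <= w x) = ((0 : withoo G) <= v x)) ->
    forall x, ((0 : withoo H) <= w x) = ((0 : withoo G) <= v x).

(** Read off from Lv, which has the same characteristic as its subfield Kv. *)
Definition residue_char_exp : nat := char_exp (resfield v).

(** The relation d(E|K,v) = d: the fundamental equality determines d when E|K is
    finite. *)
Definition is_defect K E (d : nat) : Prop :=
  degree K E = (group_index (value_group K) (value_group E)
                * degree (residues K) (residues E) * d)%N.

Definition defectless K E : Prop := finite_ext K E /\ is_defect K E 1.

Definition tame K E : Prop :=
  algebraic_ext K E /\
  forall E', subfield E' -> K `<=` E' -> E' `<=` E -> finite_ext K E' ->
    [/\ coprime (group_index (value_group K) (value_group E')) residue_char_exp,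
        separable_ext (residues K) (residues E')
      & is_defect K E' 1].

Definition ramif_group K (s : {rmorphism L -> L}) : Prop :=
  is_gal K s /\ forall x, sepclosure K x -> x != 0 -> v x < v (s x - x).

Definition ramif_field K : set L :=
  [set x | sepclosure K x /\
     forall s : {rmorphism L -> L}, ramif_group K s -> s x = x].

(** The set S_K(a). *)
Definition conj_dist K a : set (withoo G) :=
  [set v (a - a') | a' in
     [set a' | a' != a /\ exists2 s : {rmorphism L -> L}, is_gal K s & a' = s a]].

Definition distinguished_pair K b c : Prop :=
  [/\ (deg K c < deg K b)%N,
      forall z, (deg K z < deg K b)%N -> v (b - z) <= v (b - c)
    & forall z, v (b - c) = v (b - z) -> (deg K c <= deg K z)%N].

(** [s 0, ..., s n] is a complete distinguished chain of [a]; the values of [s]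
    beyond [n] are irrelevant. *)
Definition complete_distinguished_chain K a (n : nat) (s : nat -> L) : Prop :=
  [/\ s 0%N = a,
      forall i, (i < n)%N -> distinguished_pair K (s i) (s i.+1)
    & K (s n)].

End ValuedFields.

Definition is_min (A : set nat) (m : nat) : Prop :=
  A m /\ forall i, A i -> (m <= i)%N.

(* Main.v *)
(* Write [s ~ t on E] when [v (s y - t y) > v y] for all nonzero [y] in [E], and
   [G^r] for the ramification group. Dedekind's independence of characters holds
   modulo [~]; applied to the conjugates of an element it shows that any [s ~ id]
   on [E] agrees on [E] with an element of [G^r], and, applied to a finite
   extension inside [K^r], that its degree is [e * f], with [e] prime to [p] and a
   separable residue extension. Conversely, residues and values of a tame
   extension lift to its intersection with [K^r], so that [K(b)] is tame iff
   [b] is in [K^r].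

   If [(b, c)] is a distinguished pair and [v (b - s b) > v (b - c)], then [s ~ id]
   on [K(b)]: an element of [K(b)] is a polynomial in [b] of degree less than
   [deg b], so its roots are no closer to [b] than [c]. If moreover [b] is in
   [K^r], then [s] fixes [b], whence the inclusions between the [K(a_i)]. It
   follows that a value of [S_K(a)] other than the [n] values [v (a_i - a_(i+1))]
   is some [v (a - t a)] with [t] in [G^r]. For each such value [g], the conjugates
   of [a] under [G^r] at distance at least [g] from [a] fall into blocks forming a
   nontrivial finite subgroup of the additive group of the residue field, so that
   the number [m] of these values satisfies [p ^ m | deg_{L_0} a], and
   [#S_K(a) <= n + v_p (deg_{L_0} a)]. The remaining terms of the bound come from
   [p | deg_{L_i} a_i] for [i < eps]. *)

Require Import Defs.
From HB Require Import structures.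
From mathcomp Require Import all_boot all_order all_algebra.
From mathcomp Require Import separable zify ring finmap.
From mathcomp Require Import boolp classical_sets functions cardinality.

Set Implicit Arguments.
Unset Strict Implicit.
Unset Printing Implicit Defensive.

Import Order.TTheory GRing.Theory Defs.
Local Open Scope classical_set_scope.
Local Open Scope ring_scope.

(** * Subfields given as sets, minimal polynomials *)

(** Henselianity enters only through the fact that every [K]-automorphism preserves [v]; this makes
    [~] stable under composition on the left. No structure theory of [K^r] is presupposed: it is
    replaced by the criterion that, for [b] in [K^r], an automorphism [s ~ id] on [K(b)] fixes [b].
    The criterion turns a bound on how far [s] moves an element into an equality, and so distances
    along the chain yield inclusions of fields.

    Dedekind's argument modulo [~] only says that one character is not cancelled by inequivalent
    ones. Multiplicities of equivalent characters must therefore be divided out beforehand, since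
    they may vanish in the residue field.

    In the count, the term at [i = 0] pays for the [m] values coming from [G^r]. The [eps - 1] other
    terms, each at least [1], pay for all but [n - eps + 1] of the [n] values [v (a_i - a_(i+1))];
    this is the origin of the last summand. *)

Record subfld (L : fieldType) := Subfld { scar : set L; subfldP : subfield scar }.

Definition spred (L : fieldType) (E : subfld L) : {pred L} := in_set (scar E).

HB.instance Definition _ (L : fieldType) (E : subfld L) :=
  GRing.isDivringClosed.Build L (spred E) (subfldP E).

(** The subfield as a field type of its own: division and gcd of polynomials and ranks of matrices
    over it are taken there and transported along [val]. *)
Definition subT (L : fieldType) (E : subfld L) := {x : L | x \in spred E}.

HB.instance Definition _ (L : fieldType) (E : subfld L) := SubType.on (subT E).
HB.instance Definition _ (L : fieldType) (E : subfld L) := Choice.on (subT E).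
HB.instance Definition _ (L : fieldType) (E : subfld L) :=
  [SubChoice_isSubIntegralDomain of subT E by <:].
HB.instance Definition _ (L : fieldType) (E : subfld L) :=
  [SubIntegralDomain_isSubField of subT E by <:].

Section SubfieldTheory.
Variable L : fieldType.
Implicit Types (E F : set L) (x y : L) (p q r : {poly L}).

Definition pol F p := forall i, F p`_i.

Lemma spredE F (hF : subfield F) x : (x \in spred (Subfld hF)) <-> F x.
Proof. by split=> [/asboolP|h]; last exact/asboolP. Qed.

Section Closure.
Variables (F : set L) (hF : subfield F).
Local Notation S := (spred (Subfld hF)).

Lemma sf0 : F 0. Proof. by apply/(spredE hF); exact: rpred0. Qed.
Lemma sf1 : F 1. Proof. by apply/(spredE hF); exact: rpred1. Qed.
Lemma sfD x y : F x -> F y -> F (x + y).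
Proof. by move=> /(spredE hF) ? /(spredE hF) ?; apply/(spredE hF); exact: rpredD. Qed.
Lemma sfN x : F x -> F (- x).
Proof. by move=> /(spredE hF) ?; apply/(spredE hF); rewrite rpredN. Qed.
Lemma sfB x y : F x -> F y -> F (x - y).
Proof. by move=> ? ?; apply: sfD => //; exact: sfN. Qed.
Lemma sfM x y : F x -> F y -> F (x * y).
Proof. by move=> /(spredE hF) ? /(spredE hF) ?; apply/(spredE hF); exact: rpredM. Qed.
Lemma sfV x : F x -> F x^-1.
Proof. by move=> /(spredE hF) ?; apply/(spredE hF); rewrite rpredV. Qed.
Lemma sf_div x y : F x -> F y -> F (x / y).
Proof. by move=> ? ?; apply: sfM => //; exact: sfV. Qed.
Lemma sfX x n : F x -> F (x ^+ n).
Proof. by move=> /(spredE hF) ?; apply/(spredE hF); exact: rpredX. Qed.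
Lemma sf_nat n : F n%:R.
Proof. by apply/(spredE hF); exact: rpred_nat. Qed.
Lemma sf_sum I (r : seq I) (P : pred I) (f : I -> L) :
  (forall i, P i -> F (f i)) -> F (\sum_(i <- r | P i) f i).
Proof. by move=> h; apply/(spredE hF); apply: rpred_sum => i /h /(spredE hF). Qed.
Lemma sf_prod I (r : seq I) (P : pred I) (f : I -> L) :
  (forall i, P i -> F (f i)) -> F (\prod_(i <- r | P i) f i).
Proof. by move=> h; apply/(spredE hF); apply: rpred_prod => i /h /(spredE hF). Qed.

Lemma pol_lift p : pol F p ->
  exists p0 : {poly subT (Subfld hF)}, p = map_poly val p0.
Proof.
move=> hp; have hp' i : p`_i \in S by apply/spredE.
exists (\poly_(i < size p) Sub p`_i (hp' i)); apply/polyP => i.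
rewrite coef_map coef_poly /=; case: ltnP => [|le]; first by rewrite SubK.
exact: nth_default.
Qed.

Lemma valF (z : subT (Subfld hF)) : F (val z).
Proof. by apply/(spredE hF); exact: (valP z). Qed.

Lemma pol_map (p0 : {poly subT (Subfld hF)}) : pol F (map_poly val p0).
Proof. by move=> i; rewrite coef_map; exact: valF. Qed.

Lemma pol0 : pol F 0. Proof. by move=> i; rewrite coef0; exact: sf0. Qed.
Lemma polC x : F x -> pol F x%:P.
Proof. by move=> h i; rewrite coefC; case: ifP => // _; exact: sf0. Qed.
Lemma pol1 : pol F 1. Proof. by apply: polC; exact: sf1. Qed.
Lemma polXn n : pol F 'X^n.
Proof. by move=> i; rewrite coefXn; exact: sf_nat. Qed.
Lemma polX : pol F 'X. Proof. exact: (polXn 1). Qed.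
Lemma polD p q : pol F p -> pol F q -> pol F (p + q).
Proof. by move=> hp hq i; rewrite coefD; exact: sfD. Qed.
Lemma polN p : pol F p -> pol F (- p).
Proof. by move=> hp i; rewrite coefN; exact: sfN. Qed.
Lemma polB p q : pol F p -> pol F q -> pol F (p - q).
Proof. by move=> hp hq; apply: polD => //; exact: polN. Qed.
Lemma polM p q : pol F p -> pol F q -> pol F (p * q).
Proof. by move=> hp hq i; rewrite coefM; apply: sf_sum => j _; exact: sfM. Qed.
Lemma pol_mod p q : pol F p -> pol F q -> pol F (p %% q).
Proof.
by move=> /pol_lift[p0 ->] /pol_lift[q0 ->]; rewrite -map_modp; exact: pol_map.
Qed.
Lemma pol_divp p q : pol F p -> pol F q -> pol F (p %/ q).
Proof.
by move=> /pol_lift[p0 ->] /pol_lift[q0 ->]; rewrite -map_divp; exact: pol_map.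
Qed.
Lemma pol_gcd p q : pol F p -> pol F q -> pol F (gcdp p q).
Proof.
by move=> /pol_lift[p0 ->] /pol_lift[q0 ->]; rewrite -gcdp_map; exact: pol_map.
Qed.
Lemma pol_deriv p : pol F p -> pol F p^`().
Proof.
by move=> /pol_lift[p0 ->]; rewrite deriv_map; exact: pol_map.
Qed.
Lemma pol_horner p x : pol F p -> F x -> F p.[x].
Proof.
move=> hp hx; rewrite horner_coef; apply: sf_sum => i _.
by apply: sfM => //; exact: sfX.
Qed.
Lemma pol_XsubC x : F x -> pol F ('X - x%:P).
Proof. by move=> hx; apply: polB; [exact: polX|exact: polC]. Qed.
Lemma pol_prod_XsubC I (r : seq I) (P : pred I) (f : I -> L) :
  (forall i, P i -> F (f i)) -> pol F (\prod_(i <- r | P i) ('X - (f i)%:P)).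
Proof.
move=> h; apply: (big_ind (pol F)); [exact: pol1|exact: polM|].
by move=> i /h; exact: pol_XsubC.
Qed.

End Closure.

Lemma polP F (hF : subfield F) p : pol F p <-> p \is a polyOver (in_set F).
Proof.
have R := @polyOverP L (spred (Subfld hF)) p.
split=> [h|h i]; first by apply/R => i; apply/(spredE hF); exact: h.
by apply/(spredE hF); move/R: h; apply.
Qed.

Lemma pol_sub F E p : F `<=` E -> pol F p -> pol E p.
Proof. by move=> FE h i; exact/FE/h. Qed.

Lemma subfield_bigcap (T : Type) (D : set T) (A : T -> set L) :
  (forall i, D i -> subfield (A i)) -> subfield (\bigcap_(i in D) A i).
Proof.
move=> h; split.
- by rewrite unfold_in; apply/asboolP => i /h; exact: sf1.
- move=> x y; rewrite !unfold_in => /asboolP hx /asboolP hy; apply/asboolP => i Di.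
  by apply: sfB; [exact: h|exact: hx|exact: hy].
- move=> x y; rewrite !unfold_in => /asboolP hx /asboolP hy; apply/asboolP => i Di.
  by apply: sf_div; [exact: h|exact: hx|exact: hy].
Qed.

Lemma subfieldP F : F 1 -> (forall x y, F x -> F y -> F (x - y)) ->
  (forall x y, F x -> F y -> F (x * y)) -> (forall x, F x -> F x^-1) -> subfield F.
Proof.
move=> h1 hB hM hV; split; rewrite ?unfold_in; first exact/asboolP.
- by move=> x y; rewrite !unfold_in => /asboolP hx /asboolP hy; exact/asboolP/hB.
- move=> x y; rewrite !unfold_in => /asboolP hx /asboolP hy; apply/asboolP.
  by apply: hM => //; exact: hV.
Qed.

Lemma subfieldI E F : subfield E -> subfield F -> subfield (E `&` F).
Proof.
move=> hE hF; apply: subfieldP => [|x y|x y|x].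
- by split; exact: sf1.
- by move=> [? ?] [? ?]; split; exact: sfB.
- by move=> [? ?] [? ?]; split; exact: sfM.
- by move=> [? ?]; split; exact: sfV.
Qed.

Lemma subfield_adjoin F S : subfield (adjoin F S).
Proof. by apply: subfield_bigcap => E []. Qed.

Lemma adjoin_base F S : F `<=` adjoin F S.
Proof. by move=> x Fx E [_]; apply; left. Qed.

Lemma adjoin_mem F S x : S x -> adjoin F S x.
Proof. by move=> Sx E [_]; apply; right. Qed.

Lemma adjoin_min F S E : subfield E -> F `<=` E -> S `<=` E -> adjoin F S `<=` E.
Proof. by move=> hE FE SE x; apply; split=> // y [/FE|/SE]. Qed.

Lemma adjoin1_id F x : adjoin F [set x] x. Proof. exact: adjoin_mem. Qed.

Lemma adjoin1_min F x E : subfield E -> F `<=` E -> E x -> adjoin F [set x] `<=` E.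
Proof. by move=> hE FE Ex; apply: adjoin_min => // y ->. Qed.

Section MinPoly.
Variables (F : set L) (hF : subfield F).

Lemma minpoly_ex x : algebraic_over F x -> exists q, is_minpoly F x q.
Proof.
case=> q0 [nz0 /(polP hF) o0 r0].
pose P n := `[< exists q, [/\ q != 0, pol F q, root q x & size q = n] >].
have exP : exists n, P n by exists (size q0); apply/asboolP; exists q0.
case: (ex_minnP exP) => n /asboolP[q [nz oq rq sq]] nmin.
exists ((lead_coef q)^-1 *: q).
have lnz : lead_coef q != 0 by rewrite lead_coef_eq0.
split.
- by rewrite monicE lead_coefZ mulVf.
- apply/(polP hF) => i; rewrite coefZ; apply: sfM => //; apply: sfV => //.
  exact: oq.
- by rewrite rootZ // invr_eq0.
- move=> r rnz /(polP hF) ro rr; rewrite size_scale ?invr_eq0 // sq; apply: nmin.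
  by apply/asboolP; exists r.
Qed.

Definition min_poly x : {poly L} := xget 0 (is_minpoly F x).

Lemma min_polyP x : algebraic_over F x -> is_minpoly F x (min_poly x).
Proof. by move=> /minpoly_ex[q hq]; rewrite /min_poly; case: xgetP => [r _ //|/(_ q)]. Qed.

Section Alg.
Variables (x : L) (ax : algebraic_over F x).

Lemma min_poly_monic : min_poly x \is monic. Proof. by case: (min_polyP ax). Qed.
Lemma min_poly_pol : pol F (min_poly x). Proof. by case: (min_polyP ax) => _ /(polP hF). Qed.
Lemma min_poly_root : root (min_poly x) x. Proof. by case: (min_polyP ax). Qed.
Lemma min_poly_neq0 : min_poly x != 0. Proof. exact: monic_neq0 min_poly_monic. Qed.
Lemma min_poly_min r : r != 0 -> pol F r -> root r x -> (size (min_poly x) <= size r)%N.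
Proof. by move=> ? /(polP hF) ? ?; case: (min_polyP ax) => _ _ _; exact. Qed.

Lemma min_poly_size : (1 < size (min_poly x))%N.
Proof. exact: root_size_gt1 min_poly_neq0 min_poly_root. Qed.

Lemma min_poly_dvd r : pol F r -> (min_poly x %| r) = root r x.
Proof.
move=> hr; apply/idP/idP => [/root_dvdp|]; first by apply; exact: min_poly_root.
move=> rr; rewrite /dvdp; apply/negPn/negP => nz.
have := min_poly_min nz (pol_mod hF hr min_poly_pol).
rewrite leqNgt ltn_modp min_poly_neq0 => /(_ _)/negP; apply; last by [].
rewrite /root; have := rr; rewrite /root {1}(divp_eq r (min_poly x)).
by rewrite hornerD hornerM (rootP min_poly_root) mulr0 add0r.
Qed.

(** [x] is a root of [r] or of its cofactor; the cofactor is too small, so minimality applies to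
    [r]. *)
Lemma min_poly_irr r : pol F r -> r %| min_poly x -> (size r > 1)%N ->
  size r = size (min_poly x).
Proof.
move=> hr /dvdpP[s E] sr.
have nzr : r != 0 by apply: contraTneq sr => ->; rewrite size_poly0.
have nzs : s != 0 by apply: contraTneq min_poly_neq0; rewrite E => ->; rewrite mul0r eqxx.
have hs : pol F s.
  have -> : s = min_poly x %/ r by rewrite E mulpK.
  by apply: pol_divp => //; exact: min_poly_pol.
have := min_poly_root; rewrite {1}E rootM => /orP[] h.
- have := min_poly_min nzs hs h; have := size_poly_gt0 s; rewrite nzs E size_mul //.
  by move: (size s) (size r) sr => m n; lia.
- apply/eqP; rewrite eqn_leq min_poly_min // andbT E size_mul //.
  by have := size_poly_gt0 s; rewrite nzs; move: (size s) (size r) sr => m n; lia.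
Qed.

Lemma min_poly_deriv0 : ~ separable_poly (min_poly x) -> (min_poly x)^`() = 0.
Proof.
move=> nsep; apply/eqP/negPn/negP => nz; apply: nsep.
rewrite unlock /coprimep; apply/negPn/negP => sg.
have gg : (1 < size (gcdp (min_poly x) (min_poly x)^`()))%N.
  have : gcdp (min_poly x) (min_poly x)^`() != 0 by rewrite gcdp_eq0 negb_and nz orbT.
  by rewrite -size_poly_gt0; move: sg; case: size => [|[]].
have sz := min_poly_irr (pol_gcd hF min_poly_pol (pol_deriv hF min_poly_pol)) (dvdp_gcdl _ _) gg.
have := dvdp_leq nz (dvdp_gcdr (min_poly x) (min_poly x)^`()).
by rewrite sz leqNgt lt_size_deriv // min_poly_neq0.
Qed.

(** The top coefficient of the derivative of a monic polynomial is its degree. This is how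
    inseparability forces the characteristic to divide a degree. *)
Lemma min_poly_deriv0_deg : (min_poly x)^`() = 0 -> (size (min_poly x)).-1%:R = 0 :> L.
Proof.
move=> d0; have := congr1 (fun r : {poly L} => r`_(size (min_poly x)).-2) d0.
have := min_poly_monic; rewrite monicE lead_coefE => /eqP l1.
have s1 := min_poly_size; rewrite coef_deriv coef0 prednK; last by move: s1; case: size => [|[]].
by rewrite l1.
Qed.

Lemma adjoin1P y : adjoin F [set x] y <-> exists p, pol F p /\ y = p.[x].
Proof.
split; last first.
  case=> p [hp ->]; apply: (pol_horner (@subfield_adjoin F [set x])).
    exact: pol_sub (@adjoin_base _ _) hp.
  exact: adjoin1_id.
move: y; apply: adjoin1_min.
- apply: subfieldP.
  + by exists 1; split; [exact: pol1|rewrite hornerC].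
  + by move=> _ _ [p [hp ->]] [q [hq ->]]; exists (p - q); split;
      [exact: polB|rewrite !hornerE].
  + by move=> _ _ [p [hp ->]] [q [hq ->]]; exists (p * q); split;
      [exact: polM|rewrite !hornerE].
  + move=> _ [p [hp ->]].
    have [->|nz] := eqVneq p.[x] 0.
      by exists 0; split; [exact: pol0|rewrite invr0 horner0].
    have cop : coprimep p (min_poly x).
      rewrite /coprimep; apply/negPn/negP => sg.
      have gg : (1 < size (gcdp p (min_poly x)))%N.
        have : gcdp p (min_poly x) != 0 by rewrite gcdp_eq0 negb_and min_poly_neq0 orbT.
        by rewrite -size_poly_gt0; move: sg; case: size => [|[]].
      have hg : pol F (gcdp p (min_poly x)) by apply: pol_gcd => //; exact: min_poly_pol.
      have sz := min_poly_irr hg (dvdp_gcdr _ _) gg.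
      have /eqp_dvdl e : gcdp p (min_poly x) %= min_poly x.
        by rewrite -dvdp_size_eqp ?dvdp_gcdr // sz.
      have := dvdp_gcdl p (min_poly x); rewrite e min_poly_dvd // => /rootP h.
      by rewrite h eqxx in nz.
    have [p0 Ep] := pol_lift hF hp; have [q0 Eq] := pol_lift hF min_poly_pol.
    rewrite Ep Eq coprimep_map in cop.
    have /Bezout_eq1_coprimepP[[u w] /= E] := cop.
    exists (map_poly val u); split; first exact: pol_map.
    have := congr1 (fun t => (map_poly (val : subT (Subfld hF) -> L) t).[x]) E.
    rewrite rmorphD !rmorphM rmorph1 /= -Ep -Eq hornerD !hornerM hornerC.
    rewrite (rootP min_poly_root) mulr0 addr0 => h.
    by apply: (mulIf nz); rewrite mulVf.
- by move=> y Fy; exists y%:P; split; [exact: polC|rewrite hornerC].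
- by exists 'X; split; [exact: polX|rewrite hornerX].
Qed.

Lemma adjoin1P_small y : adjoin F [set x] y <->
  exists p, [/\ pol F p, (size p < size (min_poly x))%N & y = p.[x]].
Proof.
split=> [/adjoin1P[p [hp ->]]|[p [hp _ ->]]]; last by apply/adjoin1P; exists p.
exists (p %% min_poly x); split; first by apply: pol_mod => //; exact: min_poly_pol.
  by rewrite ltn_modp min_poly_neq0.
by rewrite {1}(divp_eq p (min_poly x)) hornerD hornerM (rootP min_poly_root) mulr0 add0r.
Qed.

Lemma basis_adjoin1 :
  is_basis F (adjoin F [set x]) (fun i : 'I_(size (min_poly x)).-1 => x ^+ i).
Proof.
split.
- by move=> i; apply: (sfX (@subfield_adjoin F [set x])); exact: adjoin1_id.
- move=> c Fc s0.
  have E : \poly_(i < (size (min_poly x)).-1) (oapp c 0 (insub i)) = 0.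
    set P := (X in X = 0); apply/eqP/negPn/negP => nz.
    have hP : pol F P.
      move=> i; rewrite coef_poly; case: ltnP => [lt|_]; last exact: sf0.
      by rewrite insubT /=.
    have rP : root P x.
      rewrite /root horner_poly -[X in _ == X]s0; apply/eqP/eq_bigr => i _.
      by rewrite valK.
    have := min_poly_min nz hP rP; rewrite leqNgt => /negP; apply.
    by rewrite -[size (min_poly x)]prednK ?ltnS ?size_poly // (ltn_trans _ min_poly_size).
  move=> i; have := congr1 (fun p : {poly L} => p`_i) E.
  by rewrite coef_poly coef0 ltn_ord valK.
- move=> y /adjoin1P_small[p [hp sp ->]].
  exists (fun i => p`_i) => //.
  by apply: horner_coef_wide; rewrite -ltnS prednK // (leq_trans _ sp).
Qed.

End Alg.

End MinPoly.
End SubfieldTheory.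

(** * Linear algebra over a subfield *)

Section LinearAlgebra.
Variables (L : fieldType) (F : set L) (hF : subfield F).
Implicit Types (E : set L) (x y : L) (p q r : {poly L}) (s t : seq L).

(** The coefficient matrix has more rows than columns, so its left kernel contains a nonzero row. *)
Lemma dependent_of_lt n m (b : 'I_n -> L) (c : 'I_m -> L) (a : 'I_n -> 'I_m -> L) :
  (forall i j, F (a i j)) -> (forall i, b i = \sum_j a i j * c j) -> (m < n)%N ->
  exists d : 'I_n -> L,
    [/\ forall i, F (d i), exists i, d i != 0 & \sum_i d i * b i = 0].
Proof.
move=> Fa ba lt.
pose A : 'M[subT (Subfld hF)]_(n, m) :=
  \matrix_(i, j) Sub (a i j) (introT idP (proj2 (spredE hF (a i j)) (Fa i j))).
have nzk : kermx A != 0.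
  by rewrite -mxrank_eq0 mxrank_ker -lt0n subn_gt0 (leq_ltn_trans (rank_leq_col A)).
have [i ri] : exists i, row i (kermx A) != 0.
  apply/existsP; rewrite -negb_forall; apply: contra nzk => /forallP h.
  by apply/eqP/row_matrixP => i; rewrite row0; apply/eqP.
have kA : row i (kermx A) *m A = 0 by rewrite -row_mul mulmx_ker row0.
set d := row i (kermx A) in ri kA.
exists (fun i => val (d 0 i)); split.
- by move=> k; exact: valF.
- have [k dk] : exists k, d 0 k != 0.
    apply/existsP; rewrite -negb_forall; apply: contra ri => /forallP h.
    by apply/eqP/rowP => k; rewrite [RHS]mxE; apply/eqP; exact: h.
  exists k; apply: contra dk => /eqP h; apply/eqP/val_inj; exact: h.
- under eq_bigr => k _ do rewrite ba mulr_sumr.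
  rewrite exchange_big /= big1 // => j _.
  have E0 : \sum_k d 0 k * A k j = 0.
    by have := congr1 (fun B : 'rV_m => B 0 j) kA; rewrite mxE [RHS]mxE.
  have := congr1 val E0; rewrite raddf_sum /= => E.
  under eq_bigr => k _ do rewrite mulrA.
  rewrite -mulr_suml (_ : \sum_i0 _ = 0) ?mul0r //.
  by rewrite -[RHS]E; apply: eq_bigr => k _; rewrite [A k j]mxE.
Qed.

Lemma basis_size E n m (b : 'I_n -> L) (c : 'I_m -> L) :
  is_basis F E b -> is_basis F E c -> (n <= m)%N.
Proof.
move=> [Eb ib _] [_ _ sc]; rewrite leqNgt; apply/negP => lt.
have /choice[a ha] : forall i, exists a : 'I_m -> L,
    (forall j, F (a j)) /\ b i = \sum_j a j * c j.
  by move=> i; have [a ? ?] := sc _ (Eb i); exists a.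
have [|i|d [Fd [i nz] s0]] := dependent_of_lt (a := a) (b := b) (c := c) _ _ lt.
- by move=> i j; case: (ha i).
- by case: (ha i).
by rewrite (ib d Fd s0) eqxx in nz.
Qed.

Lemma degree_basis E n (b : 'I_n -> L) : is_basis F E b -> degree F E = n.
Proof.
move=> hb; rewrite /degree; case: xgetP => [m _ [c hc]|/(_ n) []]; last by exists b.
by apply/eqP; rewrite eqn_leq (basis_size hb hc) (basis_size hc hb).
Qed.

(** Lists, with coefficients indexed by [nat], so that a free family can be extended by [rcons]. *)
Definition lfree s := forall c : nat -> L, (forall i, F (c i)) ->
  \sum_(i < size s) c i * s`_i = 0 -> forall i, (i < size s)%N -> c i = 0.

Definition spanned s x := exists2 c : nat -> L, (forall i, F (c i)) &
  x = \sum_(i < size s) c i * s`_i.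

Lemma lfree_rcons s x : lfree s -> ~ spanned s x -> lfree (rcons s x).
Proof.
move=> fs nx c Fc; rewrite size_rcons big_ord_recr /= nth_rcons ltnn eqxx => s0.
have E : \sum_(i < size s) c i * s`_i = - (c (size s) * x).
  apply/eqP; rewrite -addr_eq0 -[X in _ == X]s0; apply/eqP; congr (_ + _).
  by apply: eq_bigr => i _; rewrite nth_rcons ltn_ord.
have [c0|nz] := eqVneq (c (size s)) 0.
  move=> i; rewrite ltnS leq_eqVlt => /orP[/eqP -> //|].
  by move: i; apply: fs => //; rewrite E c0 mul0r oppr0.
case: nx; exists (fun i => - (c (size s))^-1 * c i).
  by move=> i; apply: sfM => //; apply: sfN => //; exact: sfV.
under eq_bigr => i _ do rewrite -mulrA.
by rewrite -mulr_sumr E mulrN mulNr opprK mulKf.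
Qed.

Lemma basis_of_lfree E s : (forall x, x \in s -> E x) -> lfree s ->
  (forall x, E x -> spanned s x) -> is_basis F E (fun i : 'I_(size s) => s`_i).
Proof.
move=> Es fs ss; split.
- by move=> i; apply: Es; exact: mem_nth.
- move=> c Fc s0 i; pose c' k := oapp c 0 (insub k).
  have Ec (k : 'I_(size s)) : c' k = c k by rewrite /c' valK.
  rewrite -Ec; apply: fs => //.
    by move=> k; rewrite /c'; case: insubP => //= _; exact: sf0.
  by rewrite -[RHS]s0; apply: eq_bigr => k _; rewrite Ec.
- by move=> x /ss[c Fc ->]; exists (fun i => c i).
Qed.

Lemma lfree_size E n (b : 'I_n -> L) s : is_basis F E b ->
  (forall x, x \in s -> E x) -> lfree s -> (size s <= n)%N.
Proof.
move=> [_ _ sb] Es fs; rewrite leqNgt; apply/negP => lt.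
have /choice[a ha] : forall i : 'I_(size s), exists a : 'I_n -> L,
    (forall j, F (a j)) /\ s`_i = \sum_j a j * b j.
  by move=> i; have [a ? ?] := sb _ (Es _ (mem_nth 0 (ltn_ord i))); exists a.
have [|i|d [Fd [i nz] s0]] :=
  dependent_of_lt (a := a) (b := fun i : 'I_(size s) => s`_i) (c := b) _ _ lt.
- by move=> i j; case: (ha i).
- by case: (ha i).
pose c' k := oapp d 0 (insub k).
have Ec (k : 'I_(size s)) : c' k = d k by rewrite /c' valK.
move: nz; rewrite -Ec (fs c') ?eqxx //.
  by move=> k; rewrite /c'; case: insubP => //= _; exact: sf0.
by rewrite -[RHS]s0; apply: eq_bigr => k _; rewrite Ec.
Qed.

(** Finite dimension is not assumed; a bound on the length of free families takes its place. For
    residue fields that bound comes from the fundamental inequality. *)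
Lemma lfree_complete E N s : (forall t, lfree t -> (forall x, x \in t -> E x) ->
    (size t <= N)%N) -> lfree s -> (forall x, x \in s -> E x) ->
  exists t, [/\ lfree (s ++ t), forall x, x \in s ++ t -> E x &
    forall x, E x -> spanned (s ++ t) x].
Proof.
move=> bnd; have [k] := ubnP (N - size s); elim: k s => // k IH s; rewrite ltnS => le fs Es.
have [h|] := pselect (forall x, E x -> spanned s x).
  by exists [::]; rewrite cats0.
move=> /existsNP[x /not_implyP[Ex nx]].
have fr := lfree_rcons fs nx.
have Er y : y \in rcons s x -> E y.
  by rewrite mem_rcons inE => /orP[/eqP -> //|/Es].
have [|t [h1 h2 h3]] := IH _ _ fr Er.
  by have := bnd _ fr Er; rewrite size_rcons; lia.
by exists (x :: t); rewrite -cat_rcons.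
Qed.

Lemma lfree_span E n (b : 'I_n -> L) s : is_basis F E b ->
  (forall x, x \in s -> E x) -> lfree s -> (n <= size s)%N ->
  forall x, E x -> spanned s x.
Proof.
move=> hb Es fs le x Ex; apply: contrapT => nx.
have h y : y \in rcons s x -> E y.
  by rewrite mem_rcons inE => /orP[/eqP -> //|/Es].
by have := lfree_size hb h (lfree_rcons fs nx); rewrite size_rcons ltnNge le.
Qed.

Lemma lfree_powers x : algebraic_over F x ->
  lfree (mkseq (fun i => x ^+ i) (size (min_poly F x)).-1).
Proof.
move=> ax c Fc; rewrite size_mkseq => s0 i lt.
have [_ h _] := basis_adjoin1 hF ax.
apply: (h (fun i : 'I_ _ => c i) _ _ (Ordinal lt)) => //.
by rewrite -[RHS]s0; apply: eq_bigr => j _; rewrite nth_mkseq.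
Qed.

Lemma degE x : algebraic_over F x -> deg F x = (size (min_poly F x)).-1.
Proof. by move=> ax; apply: degree_basis (basis_adjoin1 hF ax). Qed.

Lemma size_min_polyE x : algebraic_over F x -> size (min_poly F x) = (deg F x).+1.
Proof. by move=> ax; rewrite degE // prednK // (ltn_trans _ (min_poly_size hF ax)). Qed.

Lemma deg_gt0 x : algebraic_over F x -> (0 < deg F x)%N.
Proof. by move=> ax; have := min_poly_size hF ax; rewrite size_min_polyE. Qed.

Lemma deg_le_size r x : pol F r -> r != 0 -> root r x -> (deg F x <= (size r).-1)%N.
Proof.
move=> hr nz rr; have ax : algebraic_over F x by exists r; split=> //; exact/(polP hF).
by rewrite degE // -!subn1 leq_sub2r // min_poly_min.
Qed.

Lemma powers_sub E x n y : subfield E -> E x ->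
  y \in mkseq (fun i => x ^+ i) n -> E y.
Proof. by move=> hE Ex /mapP[i _ ->]; exact: sfX. Qed.

Lemma deg_le x y : algebraic_over F x -> algebraic_over F y ->
  adjoin F [set x] y -> (deg F y <= deg F x)%N.
Proof.
move=> ax ay h; rewrite !degE //.
have := lfree_size (basis_adjoin1 hF ax) _ (lfree_powers ay).
rewrite size_mkseq; apply => z; apply: powers_sub => //; exact: subfield_adjoin.
Qed.

(** The powers of [y] below [deg y] are free in [F(x)] and, by the hypothesis on degrees, numerous
    enough to span it. *)
Lemma adjoin_deg_sub x y : algebraic_over F x -> algebraic_over F y ->
  adjoin F [set x] y -> (deg F x <= deg F y)%N -> adjoin F [set y] x.
Proof.
move=> ax ay h le.
have := lfree_span (basis_adjoin1 hF ax) _ (lfree_powers ay).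
rewrite size_mkseq -!degE // => /(_ _ le x (@adjoin1_id _ _ _))[].
  by move=> z; apply: powers_sub => //; exact: subfield_adjoin.
have hA := @subfield_adjoin _ F [set y].
move=> c Fc ->; apply: (sf_sum hA) => i _; apply: (sfM hA).
  exact: adjoin_base.
apply: powers_sub (mem_nth 0 (ltn_ord i)) => //.
exact: adjoin1_id.
Qed.

Lemma finite_ext_algebraic E : subfield E -> finite_ext F E -> algebraic_ext F E.
Proof.
move=> hE [n [b hb]] x Ex; apply: contrapT => nx.
have fr m : lfree (mkseq (fun i => x ^+ i) m).
  move=> c Fc; rewrite size_mkseq => s0 i lt; apply: contrapT => nz; apply: nx.
  exists (\poly_(i < m) c i); split.
  - apply/eqP => /(congr1 (fun p : {poly L} => p`_i)); rewrite coef_poly lt coef0 => h.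
    exact: nz.
  - apply/(polP hF) => k; rewrite coef_poly; case: ifP => // _; exact: sf0.
  - rewrite /root horner_poly -[X in _ == X]s0; apply/eqP/eq_bigr => k _.
    by rewrite nth_mkseq.
have h z : z \in mkseq (fun i => x ^+ i) n.+1 -> E z by exact: powers_sub.
by have := lfree_size hb h (fr n.+1); rewrite size_mkseq ltnn.
Qed.

Lemma nth_family m (t : 'I_m -> L) (i : 'I_m) : [seq t k | k <- enum 'I_m]`_i = t i.
Proof.
by rewrite (nth_map i) ?nth_ord_enum // size_enum_ord.
Qed.

Lemma sum_family m (t : 'I_m -> L) (c : nat -> L) :
  \sum_(i < size [seq t k | k <- enum 'I_m]) c i * [seq t k | k <- enum 'I_m]`_i =
  \sum_(i < m) c i * t i.
Proof.
rewrite size_map size_enum_ord; apply: eq_bigr => i _; by rewrite nth_family.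
Qed.

Lemma family_size E n (b : 'I_n -> L) m (t : 'I_m -> L) : is_basis F E b ->
  (forall i, E (t i)) ->
  (forall c : 'I_m -> L, (forall i, F (c i)) -> \sum_i c i * t i = 0 ->
    forall i, c i = 0) ->
  (m <= n)%N /\ (m = n -> forall x, E x ->
    exists2 c : 'I_m -> L, (forall i, F (c i)) & x = \sum_i c i * t i).
Proof.
move=> hb Et ft; pose s := [seq t k | k <- enum 'I_m].
have sz : size s = m by rewrite size_map size_enum_ord.
have Es x : x \in s -> E x by move=> /mapP[i _ ->].
have fs : lfree s.
  move=> c Fc; rewrite sum_family sz => s0 i lt.
  by have := ft (fun i => c i) (fun i => Fc i) s0 (Ordinal lt).
split; first by rewrite -sz; exact: lfree_size hb Es fs.
move=> mn x Ex; have [|c Fc ->] := lfree_span hb Es fs _ Ex; first by rewrite sz mn.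
by exists (fun i => c i) => //; rewrite sum_family.
Qed.

End LinearAlgebra.

Lemma sum_mxvec_index (V : nmodType) e f (F : 'I_(e * f) -> V) :
  \sum_k F k = \sum_i \sum_j F (mxvec_index i j).
Proof.
rewrite (reindex _ (curry_mxvec_bij _ _)) pair_bigA /=.
by apply: eq_bigr => -[i j].
Qed.

Lemma mxvec_family (T : Type) e f (t : 'I_e -> 'I_f -> T) :
  exists t' : 'I_(e * f) -> T, forall i j, t' (mxvec_index i j) = t i j.
Proof.
have [g gK _] := curry_mxvec_bij e f.
by exists (fun k => t (g k).1 (g k).2) => i j; rewrite (gK (i, j)).
Qed.

(** * Extension of embeddings *)

Lemma rmorphism_of (R S : nzRingType) (f : R -> S) :
  zmod_morphism f -> monoid_morphism f -> exists g : {rmorphism R -> S}, g =1 f.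
Proof.
move=> fB fM.
pose Z := GRing.isZmodMorphism.Build _ _ f fB.
pose M := GRing.isMonoidMorphism.Build _ _ f fM.
pose g : {rmorphism R -> S} := HB.pack f Z M.
by exists g.
Qed.

Section Graph.
Variables (L : closedFieldType) (K : set L).
Hypotheses (hK : subfield K) (algK : algebraic_ext K setT).
Implicit Types (E F : set L) (x y : L) (q : L -> L -> Prop) (R : set (L * L)%type).

(* A partial [K]-embedding of [L] into itself, given as a subring [R] of
   [L * L]; [q] is a closed condition imposed on the pairs [(x, f x)]. *)
Record pembedding q R : Prop := PEmbedding {
  pe_base : forall x, K x -> R (x, x);
  pe_sub : forall a b, R a -> R b -> R (a - b);
  pe_mul : forall a b, R a -> R b -> R (a * b);
  pe_cond : forall a, R a -> q a.1 a.2
}.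

Definition pdom R : set L := [set x | exists y, R (x, y)].

Lemma pembedding_max q R0 : pembedding q R0 -> exists R,
  [/\ pembedding q R, R0 `<=` R &
      forall R', pembedding q R' -> R `<=` R' -> R' `<=` R].
Proof.
move=> h0.
pose P R := R = set0 \/ pembedding q R /\ R0 `<=` R.
have [F FP tot|R [PR Rmax]] := @Zorn_bigcup _ P.
  have [[R1 [F1 nz]]|none] := pselect (exists R, F R /\ R !=set0); last first.
    left; apply/seteqP; split=> // a [R FR Ra]; case: none; exists R; split=> //.
    by exists a.
  have nem R a : F R -> R a -> pembedding q R /\ R0 `<=` R.
    by move=> FR Ra; case: (FP _ FR) => // R_0; rewrite R_0 in Ra.
  right; case: nz => a1 Ra1; have [e1 s1] := nem _ _ F1 Ra1.
  have two a b : (\bigcup_(X in F) X) a -> (\bigcup_(X in F) X) b ->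
      exists R, [/\ F R, R a & R b].
    move=> [R FR Ra] [R' FR' Rb]; case: (tot _ _ FR FR') => sub.
      by exists R'; split=> //; exact: sub.
    by exists R; split=> //; exact: sub.
  split; last by move=> a /s1 Ra; exists R1.
  split.
  - move=> x Kx; exists R1 => //. exact: (pe_base e1 Kx).
  - move=> a b ha hb; have [R [FR Ra Rb]] := two _ _ ha hb.
    by exists R => //; have [e _] := nem _ _ FR Ra; exact: (pe_sub e).
  - move=> a b ha hb; have [R [FR Ra Rb]] := two _ _ ha hb.
    by exists R => //; have [e _] := nem _ _ FR Ra; exact: (pe_mul e).
  - by move=> a [R FR Ra]; case: (nem _ _ FR Ra) => e _; exact: (pe_cond e Ra).
have [eR sR] : pembedding q R /\ R0 `<=` R.
  case: PR => // R_0; exfalso; apply: (Rmax R0); last by right; split.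
  rewrite R_0; split=> [z //|/(_ _ (pe_base h0 (sf1 hK)))]; exact.
exists R; split=> // R' e' sub; apply: contrapT => nsub.
by apply: (Rmax R'); [split|right; split=> //; exact: subset_trans sub].
Qed.

Section OnePE.
Variables (q : L -> L -> Prop) (R : set (L * L)%type).
Hypotheses (q0 : forall y, q 0 y -> y = 0) (hR : pembedding q R).

Lemma pe_add a b : R a -> R b -> R (a + b).
Proof.
move=> Ra Rb; rewrite -[b]opprK; apply: (pe_sub hR) => //.
rewrite -sub0r; apply: (pe_sub hR) => //; apply: (pe_base hR); exact: sf0.
Qed.

Lemma pe_uniq x y y' : R (x, y) -> R (x, y') -> y = y'.
Proof.
move=> h h'; apply/eqP; rewrite -subr_eq0; apply/eqP/q0.
by have := pe_cond hR (pe_sub hR h h'); rewrite /= subrr.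
Qed.

Lemma subfield_pdom : subfield (pdom R).
Proof.
have hX x y n : R (x, y) -> R (x ^+ n, y ^+ n).
  move=> h; elim: n => [|n IH]; first exact: (pe_base hR (sf1 hK)).
  by rewrite !exprS; exact: (pe_mul hR h IH).
apply: subfieldP.
- by exists 1; apply: (pe_base hR (sf1 hK)).
- by move=> x x' [y h] [y' h']; exists (y - y'); exact: (pe_sub hR h h').
- by move=> x x' [y h] [y' h']; exists (y * y'); exact: (pe_mul hR h h').
(* By algebraicity [x^-1] is a polynomial in [x] over [K], so closure under the ring operations
   suffices. *)
- move=> x [y h]; have : adjoin K [set x] x^-1.
    by apply: (sfV (@subfield_adjoin _ K [set x])); exact: adjoin1_id.
  move=> /(adjoin1P hK (algK I)) [p [hp ->]].
  exists p.[y]; rewrite !horner_coef.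
  apply: (big_ind2 (fun u v => R (u, v))) => [|u u' v v' a b|i _].
  + by apply: (pe_base hR (sf0 hK)).
  + exact: (pe_add a b).
  + exact: (pe_mul hR (pe_base hR (hp i)) (hX _ _ i h)).
Qed.

Lemma sub_pdom : K `<=` pdom R.
Proof. by move=> x Kx; exists x; exact: (pe_base hR Kx). Qed.

Lemma pdom_rmorphism : exists f : {rmorphism subT (Subfld subfield_pdom) -> L},
  forall z, R (val z, f z).
Proof.
pose f (z : subT (Subfld subfield_pdom)) : L := xget 0 [set y | R (val z, y)].
have fP z : R (val z, f z).
  rewrite /f; case: xgetP => [y _ //|h].
  by have [y hy] := valF z; case: (h y).
have [||g gf] := @rmorphism_of _ _ f.
- move=> a b; apply: pe_uniq (fP _) _; exact: (pe_sub hR (fP a) (fP b)).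
- split; first by apply: pe_uniq (fP _) _; exact: (pe_base hR (sf1 hK)).
  by move=> a b; apply: pe_uniq (fP _) _; exact: (pe_mul hR (fP a) (fP b)).
by exists g => z; rewrite gf.
Qed.

End OnePE.

(** A relation closed under subtraction is single-valued as soon as only [0] is related to [0]. *)
Definition pe_functional (x y : L) := x = 0 -> y = 0.

Lemma pe_functional0 y : pe_functional 0 y -> y = 0. Proof. exact. Qed.

(** [y] is a root of the image under [f] of the minimal polynomial of [x] over the domain, and [R']
    pairs the value of [p] at [x] with the value of its image at [y]. If [p] vanishes at [x], it is
    a multiple of the minimal polynomial, so its image vanishes at [y]. *)
Lemma pe_extend R x : pembedding pe_functional R -> exists R',
  [/\ pembedding pe_functional R', R `<=` R' & pdom R' x].
Proof.
move=> hR; have hD := subfield_pdom hR.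
have [f hf] := pdom_rmorphism pe_functional0 hR.
rewrite (_ : subfield_pdom hR = hD) in f hf *; last exact: Prop_irrelevance.
set D := pdom R in hD f hf *; set T := subT (Subfld hD) in f hf.
have ax : algebraic_over D x.
  case: (algK (x := x) I) => p [? /(polP hK) hp ?]; exists p; split=> //.
  by apply/(polP hD); apply: pol_sub hp; exact: (sub_pdom hR).
have [p0 Ep] := pol_lift hD (min_poly_pol hD ax).
have [y ry] : exists y, root (map_poly f p0) y.
  apply/closed_rootP; rewrite size_map_poly -(size_map_poly (val : T -> L)) -Ep.
  by rewrite neq_ltn (min_poly_size hD ax) orbT.
pose R' a := exists p : {poly T},
  a = ((map_poly (val : T -> L) p).[x], (map_poly f p).[y]).
have RR' : R `<=` R'.
  case=> u w h; have Du : D u by exists w.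
  pose z : T := Sub u (proj2 (spredE hD u) Du).
  exists z%:P; rewrite !map_polyC !hornerC; congr pair.
  exact: (pe_uniq pe_functional0 hR h (hf z)).
exists R'; split=> //; last first.
  exists y; exists 'X; by rewrite !map_polyX !hornerX.
split.
- by move=> u Ku; apply: RR'; exact: (pe_base hR Ku).
- by move=> _ _ [p ->] [p' ->]; exists (p - p'); rewrite !rmorphB !hornerE.
- by move=> _ _ [p ->] [p' ->]; exists (p * p'); rewrite !rmorphM !hornerE.
- move=> _ [p ->] /= /rootP; rewrite -(min_poly_dvd hD ax); last exact: pol_map.
  rewrite Ep dvdp_map => /dvdpP[g ->].
  by rewrite rmorphM hornerM (rootP ry) mulr0.
Qed.

(** [s] maps the finite set of roots of the minimal polynomial of [y] injectively into itself, hence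
    onto itself. *)
Lemma gal_surj (s : {rmorphism L -> L}) : (forall x, K x -> s x = x) -> bijective s.
Proof.
move=> sK; have inj : injective s by exact: fmorph_inj.
have surj y : exists x, s x = y.
  have ay : algebraic_over K y by exact: algK.
  have [r Er] := closed_field_poly_normal (min_poly K y).
  have mr z : (z \in undup r) = root (min_poly K y) z.
    rewrite mem_undup Er rootZ ?root_prod_XsubC //.
    by rewrite lead_coef_eq0; exact: min_poly_neq0.
  have sub : {subset map s (undup r) <= undup r}.
    move=> _ /mapP[z hz ->]; move: hz; rewrite !mr /root => /eqP hz.
    have -> : min_poly K y = map_poly s (min_poly K y).
      by apply/polyP => i; rewrite coef_map /= sK //; exact: min_poly_pol.
    by rewrite horner_map hz rmorph0.
  have [] := uniq_min_size _ sub _.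
  - by rewrite (map_inj_uniq inj) undup_uniq.
  - by rewrite size_map.
  move=> _ /(_ y); rewrite mr (min_poly_root hK ay) => /mapP[x _ ->]; by exists x.
have [g hg] := choice surj.
by exists g => x //; apply: inj; rewrite hg.
Qed.

Theorem pe_gal R : pembedding pe_functional R ->
  exists2 s : {rmorphism L -> L}, is_gal K s & forall x y, R (x, y) -> s x = y.
Proof.
move=> /pembedding_max[M [hM RM Mmax]].
have tot x : exists y, M (x, y).
  have [R' [hR' MR' [y Ry]]] := pe_extend x hM.
  by exists y; apply: Mmax Ry.
have [f hf] := choice tot.
have fu x y : M (x, y) -> f x = y by apply: (pe_uniq pe_functional0 hM (hf x)).
have [||s sf] := @rmorphism_of _ _ f.
- by move=> a b; apply: fu; exact: (pe_sub hM (hf a) (hf b)).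
- split; first by apply: fu; apply: (pe_base hM (sf1 hK)).
  by move=> a b; apply: fu; exact: (pe_mul hM (hf a) (hf b)).
have sK x : K x -> s x = x by move=> Kx; rewrite sf; apply: fu; exact: (pe_base hM Kx).
exists s; first by split=> //; exact: gal_surj.
by move=> x y h; rewrite sf; apply: fu; exact: RM.
Qed.

End Graph.

(** * Galois theory and separability *)

Section Galois.
Variable L : closedFieldType.
Local Notation aut := {rmorphism L -> L}.
Implicit Types (E F K : set L) (x y z : L) (p q : {poly L}) (s t : aut).

Definition aut_id : aut := idfun.
Definition aut_comp s t : aut := s \o t.

Lemma gal_id F : is_gal F aut_id.
Proof. by split=> //; exists id. Qed.

Lemma gal_comp F s t : is_gal F s -> is_gal F t -> is_gal F (aut_comp s t).
Proof.
move=> [bs sF] [bt tF]; split; first exact: bij_comp.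
by move=> x Fx; rewrite /= tF // sF.
Qed.

Lemma gal_inv F s : is_gal F s ->
  exists t, [/\ is_gal F t, cancel s t & cancel t s].
Proof.
move=> [[g sg gs] sF].
have [||t tg] := @rmorphism_of _ _ g.
- exact: (can2_zmod_morphism sg gs).
- exact: (can2_monoid_morphism sg gs).
have st : cancel s t by move=> x; rewrite tg.
have ts : cancel t s by move=> x; rewrite tg.
exists t; split=> //; split; first by exists s.
by move=> x Fx; rewrite -{1}(sF x Fx) st.
Qed.

Lemma gal_sub F E s : F `<=` E -> is_gal E s -> is_gal F s.
Proof. by move=> FE [bs sE]; split=> // x /FE/sE. Qed.

Lemma gal_pol F s p : is_gal F s -> pol F p -> map_poly s p = p.
Proof. by move=> [_ sF] hp; apply/polyP => i; rewrite coef_map /= sF. Qed.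

Lemma gal_horner F s p x : is_gal F s -> pol F p -> s p.[x] = p.[s x].
Proof. by move=> gs hp; rewrite -horner_map (gal_pol gs hp). Qed.

Lemma gal_adjoin1 F s t x : subfield F -> algebraic_over F x ->
  is_gal F s -> is_gal F t -> s x = t x -> forall y, adjoin F [set x] y -> s y = t y.
Proof.
move=> hF ax gs gt e y /(adjoin1P hF ax)[p [hp ->]].
by rewrite (gal_horner _ gs hp) (gal_horner _ gt hp) e.
Qed.

Lemma algebraic_extS F E : subfield F -> subfield E -> F `<=` E ->
  algebraic_ext F setT -> algebraic_ext E setT.
Proof.
move=> hF hE FE aF x _; have [q [nz /(polP hF) hq rq]] := aF x I.
by exists q; split=> //; apply/(polP hE); exact: pol_sub hq.
Qed.

Section Over.
Variables (K : set L) (hK : subfield K) (algK : algebraic_ext K setT).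

Lemma algx x : algebraic_over K x. Proof. exact: algK. Qed.
Local Hint Resolve algx : core.

Lemma gal_root x y : root (min_poly K x) y <-> exists2 s, is_gal K s & s x = y.
Proof.
split=> [ry|[s gs <-]]; last first.
  rewrite /root -(gal_horner _ gs (min_poly_pol hK (algx x))).
  by rewrite (rootP (min_poly_root hK (algx x))) rmorph0.
pose R (a : (L * L)%type) := exists2 p, pol K p & a = (p.[x], p.[y]).
have hR : pembedding K (@pe_functional L) R.
  split.
  - by move=> u Ku; exists u%:P; [exact: polC|rewrite !hornerC].
  - by move=> _ _ [p hp ->] [q hq ->]; exists (p - q); [exact: polB|rewrite !hornerE].
  - by move=> _ _ [p hp ->] [q hq ->]; exists (p * q); [exact: polM|rewrite !hornerE].
  - move=> _ [p hp ->] /= /rootP; rewrite -(min_poly_dvd hK (algx x)) // => /dvdpP[g ->].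
    by rewrite hornerM (rootP ry) mulr0.
have [s gs hs] := pe_gal hK algK hR.
by exists s => //; apply: hs; exists 'X; [exact: polX|rewrite !hornerX].
Qed.

Lemma orbit_list (H : aut -> Prop) x : (forall s, H s -> is_gal K s) ->
  exists r : seq L, uniq r /\ forall y, y \in r <-> exists2 s, H s & s x = y.
Proof.
move=> Hg; have [r0 E] := closed_field_poly_normal (min_poly K x).
pose r := [seq y <- undup r0 | `[< exists2 s, H s & s x = y >]].
exists r; split; first by rewrite filter_uniq // undup_uniq.
move=> y; rewrite mem_filter; split=> [/andP[/asboolP h _] //|h].
apply/andP; split; first exact/asboolP.
have : root (min_poly K x) y by apply/gal_root; case: h => s /Hg ? ?; exists s.
rewrite E rootZ ?root_prod_XsubC ?mem_undup //.
by rewrite lead_coef_eq0 min_poly_neq0.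
Qed.

Lemma orbit_perm (H : aut -> Prop) x r h : (forall s, H s -> is_gal K s) ->
  (forall s t, H s -> H t -> H (aut_comp s t)) -> H h ->
  uniq r -> (forall y, y \in r <-> exists2 s, H s & s x = y) ->
  perm_eq (map h r) r.
Proof.
move=> Hg Hc Hh ur mr; have inj : injective h by exact: fmorph_inj.
have sub : {subset map h r <= r}.
  move=> _ /mapP[_ /mr [s Hs <-] ->]; apply/mr; exists (aut_comp h s) => //.
  exact: Hc.
apply: uniq_perm => //; first by rewrite (map_inj_uniq inj).
have [||//] := uniq_min_size _ sub; first by rewrite (map_inj_uniq inj).
by rewrite size_map.
Qed.

(** Any separable annihilating polynomial is allowed, not only the minimal one, so that the
    condition passes trivially to larger fields. *)
Definition sep_over x := exists q, [/\ pol K q, separable_poly q & root q x].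

Lemma sep_overE x : sepclosure K x <-> sep_over x.
Proof.
split=> [[q [mq /(polP hK) hq rq _] sq]|[q [hq sq rq]]]; first by exists q.
exists (min_poly K x); first exact: min_polyP.
by apply: dvdp_separable sq; rewrite min_poly_dvd.
Qed.

Lemma sep_min_poly x : sep_over x -> separable_poly (min_poly K x).
Proof. by move=> [q [hq sq rq]]; apply: dvdp_separable sq; rewrite min_poly_dvd. Qed.

Lemma sep_min_poly_prod x r : sep_over x -> uniq r ->
  (forall y, y \in r <-> exists2 s, is_gal K s & s x = y) ->
  min_poly K x = \prod_(y <- r) ('X - y%:P).
Proof.
move=> /sep_min_poly sx ur mr.
have [r0 E] := closed_field_poly_normal (min_poly K x).
rewrite (eqP (min_poly_monic hK (algx x))) scale1r in E.
have ur0 : uniq r0 by rewrite -separable_prod_XsubC -E.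
rewrite E; apply: perm_big; apply: uniq_perm => // y.
apply/idP/idP; rewrite -[y \in r0]root_prod_XsubC -E.
  by move=> /gal_root; exact: (proj2 (mr y)).
by move=> /mr /gal_root.
Qed.

Lemma sep_deg x r : sep_over x -> uniq r ->
  (forall y, y \in r <-> exists2 s, is_gal K s & s x = y) -> deg K x = size r.
Proof.
by move=> sx ur mr; rewrite (degE hK (algx x)) (sep_min_poly_prod sx ur mr) size_prod_XsubC.
Qed.

Lemma sep_of_prod x r : uniq r -> x \in r -> pol K (\prod_(y <- r) ('X - y%:P)) ->
  sep_over x.
Proof.
move=> ur xr hp; exists (\prod_(y <- r) ('X - y%:P)); split=> //.
  by rewrite separable_prod_XsubC.
by rewrite root_prod_XsubC.
Qed.

(** Write [w] as the value at [y] of a polynomial [f] of degree less than [deg y]. Then [f - w]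
    vanishes at all [deg y] conjugates of [y], so it is zero. *)
Lemma sep_fixed y w : sep_over y -> adjoin K [set y] w ->
  (forall s, is_gal K s -> s w = w) -> K w.
Proof.
move=> sy /(adjoin1P_small hK (algx y))[f [hf sf Ew]] fw.
have [r [ur mr]] := @orbit_list (is_gal K) y (fun s h => h).
have sz := sep_deg sy ur mr.
have E : f = w%:P.
  apply/eqP; rewrite -subr_eq0; apply/negPn/negP => nz.
  have /(max_poly_roots nz) : all (root (f - w%:P)) r.
    apply/allP => _ /mr[s gs <-].
    by rewrite /root hornerD hornerN hornerC -(gal_horner _ gs hf) -Ew fw ?subrr.
  move=> /(_ ur); rewrite ltnNge -sz; apply/negP/negPn.
  rewrite (leq_trans (size_polyD _ _)) // geq_max size_polyN -ltnS.
  rewrite -(size_min_polyE hK (algx y)) sf (leq_trans (size_polyC_leq1 _)) //.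
  exact: deg_gt0.
by have := hf 0%N; rewrite E coefC eqxx.
Qed.

End Over.
Arguments algx {K} algK x.
Arguments sep_over K x : clear implicits.

Lemma sep_over_sub F E x : F `<=` E -> sep_over F x -> sep_over E x.
Proof. by move=> FE [q [hq sq rq]]; exists q; split=> //; exact: pol_sub hq. Qed.

Section Over.
Variables (K : set L) (hK : subfield K) (algK : algebraic_ext K setT).
Let ax x : algebraic_over K x := algx algK x.
Local Hint Resolve ax : core.

Lemma fixed_sep_mem E z : subfield E -> K `<=` E -> sep_over E z ->
  (forall s, is_gal E s -> s z = z) -> E z.
Proof.
move=> hE KE sz fz; have algE := algebraic_extS hK hE KE algK.
by apply: (sep_fixed hE algE sz _ fz); exact: adjoin1_id.
Qed.

(** Along such a tower, fixed elements descend to the base one floor at a time. This avoids a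
    primitive element, and it is available before separable elements are known to form a field. *)
Inductive stower F : set L -> Prop :=
| stower0 : stower F F
| stowerS N y : stower F N -> sep_over N y -> stower F (adjoin N [set y]).

Lemma stower_subfield F N : subfield F -> stower F N -> subfield N.
Proof. by move=> hF; case=> // *; exact: subfield_adjoin. Qed.

Lemma stower_sub F N : stower F N -> F `<=` N.
Proof. by elim=> // {}N y _ IH _ x /IH; exact: adjoin_base. Qed.

Lemma stower_fixed N w : stower K N -> N w ->
  (forall s, is_gal K s -> s w = w) -> K w.
Proof.
move=> tN Nw fw; elim: tN Nw => // {}N y tN IH sy Nw; apply: IH.
have hN := stower_subfield hK tN; have KN := stower_sub tN.
apply: (sep_fixed hN (algebraic_extS hK hN KN algK) sy) => // s gs.
by apply: fw; exact: gal_sub gs.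
Qed.

Lemma stower_add N (r : seq L) : stower K N -> (forall y, y \in r -> sep_over N y) ->
  exists N', [/\ stower K N', N `<=` N' & forall y, y \in r -> N' y].
Proof.
elim: r N => [|y r IH] N tN hr; first by exists N; split.
have ty := stowerS tN (hr _ (mem_head _ _)).
have [z zr|N' [tN' sN' mN']] := IH _ ty.
  apply: (@sep_over_sub N); first exact: adjoin_base.
  by apply: hr; rewrite inE zr orbT.
exists N'; split=> //; first by move=> x /(@adjoin_base _ _ [set y]) /sN'.
by move=> z; rewrite inE => /orP[/eqP ->|/mN' //]; apply: sN'; exact: adjoin1_id.
Qed.

Lemma sep_over_gal s x : is_gal K s -> sep_over K x -> sep_over K (s x).
Proof.
move=> gs [q [hq sq rq]]; exists q; split=> //.
by rewrite /root -(gal_horner _ gs hq) (rootP rq) rmorph0.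
Qed.

(* The conjugates of [g.[y]] lie in a finite tower of simple separable
   extensions of [K] containing the conjugates of the coefficients and of [y];
   the coefficients of the polynomial they are the roots of are fixed, hence in
   [K]. *)
Lemma sep_over_horner q (g : {poly L}) y : separable_poly q -> (forall i, sep_over K q`_i) ->
  (forall i, sep_over K g`_i) -> root q y -> sep_over K g.[y].
Proof.
move=> sq hq hg ry.
pose cs : seq L := q ++ g.
have csP i : q`_i \in 0 :: cs /\ g`_i \in 0 :: cs.
  split; rewrite inE mem_cat.
  - have [lt|ge] := ltnP i (size q); first by rewrite mem_nth // orbT.
    by rewrite nth_default // eqxx.
  - have [lt|ge] := ltnP i (size g); first by rewrite (mem_nth 0 lt) !orbT.
    by rewrite nth_default // eqxx.
have scs c : c \in cs -> sep_over K c.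
  by rewrite mem_cat => /orP[] /(nthP 0)[i _ <-].
have orb x := orbit_list hK algK (H := is_gal K) x (fun s h => h).
have /choice[rr hrr] := orb.
have [N0 [t0 _ m0]] : exists N', [/\ stower K N', K `<=` N' &
    forall z, z \in flatten (map rr cs) -> N' z].
  apply: stower_add; first exact: stower0.
  move=> z /flatten_mapP[c /scs sc]; have [_ mc] := hrr c.
  by move=> /mc[s gs <-]; exact: sep_over_gal.
have N0c s c : is_gal K s -> c \in 0 :: cs -> N0 (s c).
  move=> gs; rewrite inE => /orP[/eqP ->|hc].
    by rewrite rmorph0; apply: sf0; exact: stower_subfield t0.
  apply: m0; apply/flatten_mapP; exists c => //.
  by have [_ mc] := hrr c; apply/mc; exists s.
have [N1 [t1 s1 m1]] : exists N', [/\ stower K N', N0 `<=` N' &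
    forall z, z \in rr y -> N' z].
  apply: stower_add => // z; have [_ my] := hrr y.
  move=> /my[s gs <-]; exists (map_poly s q); split.
  - by move=> i; rewrite coef_map /=; apply: N0c => //; case: (csP i).
  - by rewrite separable_map.
  - by rewrite /root horner_map (rootP ry) rmorph0.
have hN1 := stower_subfield hK t1.
have [uz mz] := hrr g.[y].
apply: (@sep_of_prod K _ (rr g.[y])) => //.
  by apply/mz; exists aut_id => //; exact: gal_id.
move=> i; apply: (stower_fixed t1).
- have : pol N1 (\prod_(z <- rr g.[y]) ('X - z%:P)); last exact.
  rewrite big_seq; apply: (big_ind (pol N1)); [exact: pol1|exact: polM|].
  move=> z /mz[s gs <-]; apply: pol_XsubC => //.
  rewrite -horner_map; apply: pol_horner => //.
    by move=> j; rewrite coef_map /=; apply: s1; apply: N0c => //; case: (csP j).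
  by apply: m1; have [_ my] := hrr y; apply/my; exists s.
- move=> s gs; rewrite -coef_map rmorph_prod /=; congr (_`_i).
  under eq_bigr => z _ do rewrite rmorphB /= map_polyX map_polyC /=.
  rewrite -(big_map s xpredT (fun z => 'X - z%:P)).
  have gc u v : is_gal K u -> is_gal K v -> is_gal K (aut_comp u v) by exact: gal_comp.
  by rewrite (perm_big _ (orbit_perm (fun _ h => h) gc gs uz mz)).
Qed.

Lemma sep_over_mem x : K x -> sep_over K x.
Proof.
move=> Kx; exists ('X - x%:P); split; first exact: pol_XsubC.
- by have := separable_prod_XsubC [:: x]; rewrite big_seq1.
- by rewrite root_XsubC.
Qed.

Lemma sep_over_adjoin x y : sep_over K x -> adjoin K [set x] y -> sep_over K y.
Proof.
move=> [q [hq sq rq]] /(adjoin1P hK (ax x))[p [hp ->]].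
by apply: (sep_over_horner sq) => // i; apply: sep_over_mem.
Qed.

Lemma subfield_sep_over : subfield (sep_over K).
Proof.
have hC (c : L) i : sep_over K c -> sep_over K (c%:P)`_i.
  by rewrite coefC; case: ifP => // _ _; apply: sep_over_mem; exact: sf0.
have hX i : sep_over K ('X : {poly L})`_i by apply: sep_over_mem; exact: polX.
apply: subfieldP.
- by apply: sep_over_mem; exact: sf1.
- move=> x y sx [q [hq sq rq]].
  have -> : x - y = (x%:P - 'X).[y] by rewrite !hornerE.
  apply: (sep_over_horner sq) => // i; first exact: sep_over_mem.
  rewrite coefB coefC coefX; case: i => [|i] /=.
    by rewrite subr0.
  by rewrite sub0r; apply: sep_over_mem; apply: sfN => //; exact: sf_nat.
- move=> x y sx [q [hq sq rq]].
  have -> : x * y = (x *: 'X).[y] by rewrite !hornerE.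
  apply: (sep_over_horner sq) => // i; first exact: sep_over_mem.
  rewrite coefZ coefX; case: (i == 1)%N; first by rewrite mulr1.
  by rewrite mulr0; apply: sep_over_mem; exact: sf0.
- move=> x sx; apply: (sep_over_adjoin sx).
  by apply: (sfV (@subfield_adjoin _ K [set x])); exact: adjoin1_id.
Qed.

Lemma sep_over_trans E x : E `<=` sep_over K -> sep_over E x -> sep_over K x.
Proof.
move=> Es [q [hq sq rq]]; rewrite -[x]hornerX; apply: (sep_over_horner sq) => // i.
  exact: Es.
by apply: sep_over_mem; exact: polX.
Qed.

Lemma sepclosureE : sepclosure K = sep_over K.
Proof. by apply/seteqP; split=> x /(sep_overE hK algK). Qed.

End Over.
End Galois.

(** * Valuations, residues and henselian fields *)

Section Valuation.
Variables (L : fieldType) (G : orderedZmodType) (v : valuation L G).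
Implicit Types (x y z : L).
Local Notation Z0 := (0 : withoo G).

Lemma v_neq0 x : x != 0 -> v x != v 0.
Proof. by move=> nz; apply: contra nz; rewrite (val0 v) => /eqP/valoo ->. Qed.

Lemma v_le0 x : v x <= v 0.
Proof. by rewrite (val0 v); case: (v x). Qed.

Lemma v_lt0 x : x != 0 -> v x < v 0.
Proof. by move=> nz; rewrite lt_neqAle v_neq0 // v_le0. Qed.

Lemma v_ltP x y : v x < v y -> x != 0.
Proof.
by move=> h; apply: contraTneq h => ->; rewrite -leNgt v_le0.
Qed.

Lemma vle_mul2l z x y : z != 0 -> (v (z * x) <= v (z * y)) = (v x <= v y).
Proof.
move=> nz; apply/idP/idP => h; last by rewrite !valM leadd_oo.
by rewrite -[x](mulKf nz) -[y](mulKf nz) valM [v (_ * (_ * y))]valM leadd_oo.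
Qed.

Lemma vlt_mul2l z x y : z != 0 -> (v (z * x) < v (z * y)) = (v x < v y).
Proof. by move=> nz; rewrite !ltNge vle_mul2l. Qed.

Lemma vle_div x y : y != 0 -> (v y <= v x) = (Z0 <= v (x / y)).
Proof.
by move=> nz; rewrite -(val1 v) -(vle_mul2l 1 _ nz) mulr1 mulrC divfK.
Qed.

Lemma vlt_div x y : y != 0 -> (v y < v x) = (Z0 < v (x / y)).
Proof.
by move=> nz; rewrite -(val1 v) -(vlt_mul2l 1 _ nz) mulr1 mulrC divfK.
Qed.

Lemma veq_div x y : y != 0 -> (v x = v y) <-> (v (x / y) = 0).
Proof.
move=> nz; split=> [e|e]; last by rewrite -[x](divfK nz) valM e add0r.
by rewrite valM e valV.
Qed.

Lemma vM_le x x' y y' : v x <= v x' -> v y <= v y' -> v (x * y) <= v (x' * y').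
Proof. by move=> h h'; rewrite !valM leadd_oo. Qed.

Lemma vM_lt x x' y y' : y != 0 -> v x < v x' -> v y <= v y' -> v (x * y) < v (x' * y').
Proof.
move=> nz h h'; apply: (@lt_le_trans _ _ (v (x' * y))); last exact: vM_le.
by rewrite ![_ * y]mulrC vlt_mul2l.
Qed.

Lemma vM_ge0 x y : Z0 <= v x -> Z0 <= v y -> Z0 <= v (x * y).
Proof. by rewrite -{1 2 3}(val1 v) => h h'; rewrite -[1]mulr1; exact: vM_le. Qed.

Lemma vX_ge0 x n : Z0 <= v x -> Z0 <= v (x ^+ n).
Proof. by move=> h; elim: n => [|n IH]; rewrite ?val1 // exprS vM_ge0. Qed.

Lemma v0_neq0 x : v x = 0 -> x != 0.
Proof. by move=> e; apply/eqP => x0; move: e; rewrite x0 val0. Qed.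

Lemma vV0 x : v x = 0 -> v x^-1 = 0.
Proof. by move=> e; have := valV v (v0_neq0 e); rewrite e add0r. Qed.

Lemma vsum_lt I (r : seq I) (P : pred I) (f : I -> L) z : z != 0 ->
  (forall i, P i -> v z < v (f i)) -> v z < v (\sum_(i <- r | P i) f i).
Proof.
move=> nz h; apply: (big_ind (fun t => v z < v t)) => //; first exact: v_lt0.
by move=> x y hx hy; apply: lt_le_trans (valD v x y); rewrite lt_min hx hy.
Qed.

Lemma vsum_le I (r : seq I) (P : pred I) (f : I -> L) z :
  (forall i, P i -> v z <= v (f i)) -> v z <= v (\sum_(i <- r | P i) f i).
Proof.
move=> h; apply: (big_ind (fun t => v z <= v t)) => //; first exact: v_le0.
by move=> x y hx hy; apply: le_trans (valD v x y); rewrite le_min hx hy.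
Qed.

Lemma vsum_ge0 I (r : seq I) (P : pred I) (f : I -> L) :
  (forall i, P i -> Z0 <= v (f i)) -> Z0 <= v (\sum_(i <- r | P i) f i).
Proof. by rewrite -(val1 v); exact: vsum_le. Qed.

Lemma vD_lt x y z : v z < v x -> v z < v y -> v z < v (x + y).
Proof. by move=> hx hy; apply: lt_le_trans (valD v x y); rewrite lt_min hx hy. Qed.

Lemma vB_lt x y z : v z < v x -> v z < v y -> v z < v (x - y).
Proof. by move=> hx hy; apply: vD_lt => //; rewrite valN. Qed.

Lemma vD_le x y (c : withoo G) : c <= v x -> c <= v y -> c <= v (x + y).
Proof. by move=> hx hy; apply: le_trans (valD v x y); rewrite le_min hx hy. Qed.

Lemma vBC x y : v (x - y) = v (y - x).
Proof. by rewrite -valN opprB. Qed.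

Lemma vD_eq x y : v x < v y -> v (x + y) = v x.
Proof.
move=> h; apply/le_anti/andP; split; last by apply: vD_le => //; exact: ltW.
rewrite leNgt; apply/negP => h'.
by have := vB_lt h' h; rewrite addrK ltxx.
Qed.

Lemma v_eq_lt x y : v x < v (y - x) -> v y = v x.
Proof. by move=> h; rewrite -[y](addrNK x) addrC vD_eq. Qed.

Lemma vprod_eq I (r : seq I) (f g : I -> L) :
  (forall i, v (f i) = v (g i)) -> v (\prod_(i <- r) f i) = v (\prod_(i <- r) g i).
Proof.
by move=> h; apply: (big_ind2 (fun x y => v x = v y)) => // x y z t e e'; rewrite !valM e e'.
Qed.

Lemma vX_gt0 x n : (0 < n)%N -> Z0 < v x -> Z0 < v (x ^+ n).
Proof.
case: n => // n _ h; rewrite exprS -(val1 v) -[1]mulr1.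
apply: vM_lt; [exact: oner_neq0|by rewrite val1|].
by rewrite val1 vX_ge0 // ltW.
Qed.

Lemma vX_lt0 x n : (0 < n)%N -> v x < 0 -> v (x ^+ n) < 0.
Proof.
move=> n0 h; have nz : x != 0 by apply: contraTneq h => ->; rewrite val0.
rewrite -(val1 v) vlt_div ?expf_neq0 // mul1r -exprVn vX_gt0 //.
by rewrite -[x^-1]mul1r -vlt_div // val1.
Qed.

Lemma vX_eq0 x n : (0 < n)%N -> v (x ^+ n) = 0 -> v x = 0.
Proof.
move=> n0 e; have [h|h|//] := ltgtP (v x) 0.
- by have := vX_lt0 n0 h; rewrite e ltxx.
- by have := vX_gt0 n0 h; rewrite e ltxx.
Qed.

Lemma vX_ge0P x n : (0 < n)%N -> (Z0 <= v (x ^+ n)) -> (Z0 <= v x).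
Proof. by move=> n0; apply: contraTT; rewrite -!ltNge; exact: vX_lt0. Qed.

Local Notation res := (residue v).

Lemma res_eq x y : Z0 <= v x -> Z0 <= v y -> (res x = res y) <-> (Z0 < v (x - y)).
Proof.
move=> hx hy; have hB : Z0 <= v (x - y) by exact: valB_ge.
have e : res x = res (x - y) + res y by rewrite -residueD // subrK.
rewrite -(residue_eq0 hB); split=> [h|/eqP h].
  by apply/eqP; apply: (addIr (res y)); rewrite -e h add0r.
by rewrite e h add0r.
Qed.

Lemma res0 : res 0 = 0.
Proof. by apply/eqP; rewrite residue_eq0 ?val0. Qed.

Lemma res1 : res 1 = 1.
Proof.
have h : Z0 <= v 1 by rewrite val1.
have nz : res 1 != 0 by rewrite residue_eq0 // val1 ltxx.
by apply: (mulfI nz); rewrite -residueM // !mulr1.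
Qed.

Lemma resN x : Z0 <= v x -> res (- x) = - res x.
Proof.
move=> h; apply: (addrI (res x)); rewrite subrr -residueD ?valN //.
by rewrite subrr res0.
Qed.

Lemma resB x y : Z0 <= v x -> Z0 <= v y -> res (x - y) = res x - res y.
Proof. by move=> hx hy; rewrite residueD ?valN // resN. Qed.

Lemma res_sum I (r : seq I) (P : pred I) (f : I -> L) :
  (forall i, P i -> Z0 <= v (f i)) ->
  res (\sum_(i <- r | P i) f i) = \sum_(i <- r | P i) res (f i).
Proof.
move=> h; elim: r => [|i r IH]; first by rewrite !big_nil res0.
rewrite !big_cons; case: ifP => // Pi.
by rewrite residueD ?IH // ?h // vsum_ge0.
Qed.

Lemma resX x n : Z0 <= v x -> res (x ^+ n) = res x ^+ n.
Proof.
move=> h; elim: n => [|n IH]; first by rewrite res1.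
by rewrite !exprS residueM ?IH // vX_ge0.
Qed.

Lemma resV x : v x = 0 -> res x^-1 = (res x)^-1.
Proof.
move=> e; have nz := v0_neq0 e.
have nr : res x != 0 by rewrite residue_eq0 ?e // ltxx.
by apply: (mulfI nr); rewrite -residueM ?e ?(vV0 e) // !divff // res1.
Qed.

Lemma res_nat n : res n%:R = n%:R.
Proof.
have h : Z0 <= v n%:R.
  by elim: n => [|n IH]; rewrite ?val0 // -addn1 natrD vD_le // val1.
elim: n h => [|n IH] _; first by rewrite res0.
rewrite -addn1 !natrD residueD ?val1 // ?IH ?res1 //.
all: by elim: {IH} n => [|n IH]; rewrite ?val0 // -addn1 natrD vD_le // val1.
Qed.

Lemma v_nat_ge0 n : Z0 <= v n%:R.
Proof. by elim: n => [|n IH]; rewrite ?val0 // -addn1 natrD vD_le // val1. Qed.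

End Valuation.

Lemma seq_max (d : Order.disp_t) (T : orderType d) (A : eqType) (f : A -> T) (s : seq A) :
  s != [::] -> exists2 x, x \in s & forall y, y \in s -> (f y <= f x)%O.
Proof.
elim: s => // a [|b s] IH _.
  by exists a; rewrite ?mem_head // => y; rewrite inE => /eqP ->.
have [//|x xs mx] := IH; have [le|lt] := leP (f a) (f x).
  by exists x; [rewrite inE xs orbT|move=> y; rewrite inE => /orP[/eqP ->|/mx]].
exists a; first exact: mem_head.
by move=> y; rewrite inE => /orP[/eqP -> //|/mx h]; apply: le_trans h (ltW lt).
Qed.

Section Henselian.
Variables (L : closedFieldType) (G : orderedZmodType) (v : valuation L G).
Variables (K : set L) (hK : subfield K) (algK : algebraic_ext K setT).
Hypothesis hens : henselian v K.
Local Notation aut := {rmorphism L -> L}.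
Local Notation Z0 := (0 : withoo G).
Implicit Types (E F : set L) (x y z : L) (s t g : aut).

(** [v] composed with [s] is a valuation agreeing with [v] on [K], so henselianity identifies the
    two valuation rings. *)
Lemma v_gal_ge0 s x : is_gal K s -> (Z0 <= v (s x)) = (Z0 <= v x).
Proof.
move=> [bs sK].
have woo y : v (s y) = None <-> y = 0.
  rewrite valoo; split=> [/eqP|->]; last by rewrite rmorph0.
  by rewrite fmorph_eq0 => /eqP.
pose w := Valuation woo (fun y z => etrans (congr1 v (rmorphM s y z)) (valM v _ _))
  (fun y z => eq_ind_r (fun u => Order.min (v (s y)) (v (s z)) <= v u)
     (valD v (s y) (s z)) (rmorphD s y z)).
by apply: (hens (w := w)) => y Ky /=; rewrite sK.
Qed.

Lemma v_gal_le s x y : is_gal K s -> (v (s x) <= v (s y)) = (v x <= v y).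
Proof.
move=> gs; have [->|nz] := eqVneq x 0.
  rewrite rmorph0; have [->|nzy] := eqVneq y 0; first by rewrite rmorph0.
  by rewrite !leNgt !v_lt0 ?fmorph_eq0.
by rewrite !vle_div ?fmorph_eq0 // -fmorph_div v_gal_ge0.
Qed.

(** Equality of valuation rings only shows that [s] preserves comparisons of values. Among the
    finitely many conjugates [z] of [x] with [v z < v (s z)], one of largest value gives a
    contradiction, since [s z] is again one of them. *)
Lemma v_gal_not_lt s x : is_gal K s -> (v x < v (s x)) = false.
Proof.
move=> gs; apply/negP => lt.
have [r [ur mr]] := @orbit_list L K hK algK (is_gal K) x (fun s h => h).
pose r' := [seq z <- r | v z < v (s z)].
have mr' z : z \in r -> s z \in r.
  by move=> /mr[t gt <-]; apply/mr; exists (aut_comp s t) => //; exact: gal_comp.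
have nr : r' != [::].
  suff : x \in r' by apply: contraTneq => ->.
  by rewrite mem_filter lt; apply/mr; exists (aut_id L) => //; exact: gal_id.
have [z] := seq_max v nr; rewrite mem_filter => /andP[ltz zr] mz.
have /mz : s z \in r'.
  by rewrite mem_filter mr' // andbT ltNge v_gal_le // -ltNge.
by rewrite leNgt ltz.
Qed.

Lemma v_gal s x : is_gal K s -> v (s x) = v x.
Proof.
move=> gs; have [h|h|//] := ltgtP (v x) (v (s x)).
  by rewrite v_gal_not_lt in h.
have [t [gt st ts]] := gal_inv gs.
by move: h; rewrite -{2}[x]st v_gal_not_lt.
Qed.

(* [s] and [t] induce the same map on the graded ring of [E]. *)
Definition eq_lead E s t := forall y, E y -> y != 0 -> v y < v (s y - t y).

Lemma eq_lead_refl E s : eq_lead E s s.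
Proof. by move=> y _ nz; rewrite subrr v_lt0. Qed.

Lemma eq_lead_sym E s t : eq_lead E s t -> eq_lead E t s.
Proof. by move=> h y Ey nz; rewrite vBC; exact: h. Qed.

Lemma eq_lead_trans E s t u : eq_lead E s t -> eq_lead E t u -> eq_lead E s u.
Proof.
move=> h h' y Ey nz; rewrite -[s y](subrK (t y)) -addrA.
by apply: vD_lt; [exact: h|exact: h'].
Qed.

Lemma eq_lead_mull E g s t : is_gal K g -> eq_lead E s t ->
  eq_lead E (aut_comp g s) (aut_comp g t).
Proof. by move=> gg h y Ey nz; rewrite /= -rmorphB v_gal //; exact: h. Qed.

Lemma eq_lead_mullV E g s t : is_gal K g ->
  eq_lead E (aut_comp g s) (aut_comp g t) -> eq_lead E s t.
Proof. by move=> gg h y Ey nz; have := h y Ey nz; rewrite /= -rmorphB v_gal. Qed.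

(* Dedekind's independence of characters, for leading terms: the [c i] are
   eliminated one at a time. *)
Lemma dedekind E s0 n (c : 'I_n -> L) (s : 'I_n -> aut) : subfield E ->
  is_gal K s0 -> (forall i, is_gal K (s i)) -> (forall i, Z0 <= v (c i)) ->
  (forall i, ~ eq_lead E s0 (s i)) ->
  exists y, [/\ E y, y != 0 & v (s0 y + \sum_i c i * s i y) <= v y].
Proof.
move=> hE g0; elim: n c s => [|n IH] c s gs hc ns.
  exists 1; rewrite oner_neq0 big_ord0 addr0 rmorph1; split=> //; exact: sf1.
have /existsNP[u /not_implyP[Eu /not_implyP[nzu /negP]]] := ns ord_max.
rewrite -leNgt; set d := s0 u - _ => le.
have vd : v d = v u.
  apply/le_anti; rewrite le //= valB_ge // v_gal //; exact: gs.
have nzd : d != 0.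
  by apply: contraTneq le => ->; rewrite -ltNge v_lt0.
pose sn := s ord_max; pose w := widen_ord (leqnSn n).
(* The coefficients of [A (u * y) - sn u * A y] divided by [d], the coefficient of [s0 y]; the last
   character cancels. They stay integral because [v d = v u]. *)
pose c' i := c (w i) * ((s (w i) u - sn u) / d).
have [|i||y [Ey nzy ley]] := IH c' (fun i => s (w i)).
- by move=> i; exact: gs.
- apply: vM_ge0; first exact: hc.
  rewrite -vle_div // vd valB_ge // v_gal //; exact: gs.
- by move=> i; exact: ns.
pose A y := s0 y + \sum_i c i * s i y.
have key : A (u * y) - sn u * A y = d * (s0 y + \sum_i c' i * s (w i) y).
  rewrite /A !big_ord_recr /= -/sn !rmorphM !mulrDr.
  rewrite mulr_sumr [in RHS]mulr_sumr.
  under [in RHS]eq_bigr => i _.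
    have -> : d * (c' i * s (w i) y) =
      c (w i) * s (w i) (u * y) - sn u * (c (w i) * s (w i) y).
      by rewrite rmorphM /c'; field.
    over.
  rewrite sumrB /=.
  set S1 := \sum_(i < n) _; set S2 := \sum_(i < n) _; rewrite /d -/sn; ring.
have [h|h] := leP (v (A (u * y))) (v (u * y)).
  by exists (u * y); split=> //; [exact: sfM|rewrite mulf_neq0].
exists y; split=> //; rewrite leNgt; apply/negP => h'.
have : v (u * y) < v (A (u * y) - sn u * A y).
  by apply: vB_lt => //; rewrite !valM v_gal -?valM ?vlt_mul2l //; exact: gs.
rewrite key ltNge valM vd -valM => /negP; apply.
by rewrite vle_mul2l.
Qed.

End Henselian.

(** * Extension of automorphisms fixing leading terms *)

Lemma count_enum (T : finType) (A : {pred T}) (P : pred T) :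
  count P (enum A) = #|[pred i | (i \in A) && P i]|.
Proof.
rewrite cardE /enum_mem size_filter count_filter.
by apply: eq_count => i; rewrite /= andbC.
Qed.

Section Classes.
Variables (m : nat) (e : rel 'I_m).
Hypotheses (er : reflexive e) (es : symmetric e) (et : transitive e).

Definition class_rep j := odflt j [pick k | e j k].

Lemma class_repP j : e j (class_rep j).
Proof. by rewrite /class_rep; case: pickP => //= _; exact: er. Qed.

Lemma class_rep_eq i j : e i j -> class_rep i = class_rep j.
Proof.
move=> h; have E : e i =1 e j.
  by move=> k; apply/idP/idP; apply: et => //; rewrite es.
rewrite /class_rep (eq_pick E); case: pickP => // /(_ j).
by rewrite er.
Qed.

Definition class_reps := [set j | class_rep j == j]%SET.

Lemma class_rep_in j : class_rep j \in class_reps.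
Proof. by rewrite inE; apply/eqP/esym/class_rep_eq/class_repP. Qed.

Lemma class_reps_inj i j : i \in class_reps -> j \in class_reps -> e i j -> i = j.
Proof. by rewrite !inE => /eqP hi /eqP hj /class_rep_eq; rewrite hi hj. Qed.

(** As all classes have [mu] elements, the values over all indices are those over the
    representatives, each repeated [mu] times. An equality of multisets can thus be divided by [mu],
    whereas an equality of sums in the residue field could not when [p] divides [mu]. *)
Lemma class_count (T : eqType) (mu : nat) (a : 'I_m -> T) c :
  (forall j, #|[pred k | e j k]| = mu) -> (forall i j, e i j -> a i = a j) ->
  count_mem c (map a (enum 'I_m)) = (mu * count_mem c (map a (enum class_reps)))%N.
Proof.
move=> hmu ha; rewrite count_map [in RHS]count_map !count_enum.
rewrite -sum1_card (partition_big (class_rep) [pred i in class_reps | a i == c]) /=.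
  rewrite -sum1_card big_distrr /=; apply: eq_bigr => i /andP[ir /eqP ai].
  rewrite muln1 -(hmu i) -sum1_card; apply: eq_bigl => j; rewrite !inE.
  apply/andP/idP => [[_ /eqP <-]|eij]; first by rewrite es class_repP.
  split; first by rewrite -ai; apply/eqP/ha; rewrite es.
  by rewrite -(class_rep_eq eij); rewrite inE in ir.
move=> j; rewrite !inE => /eqP <-; rewrite -(ha _ _ (class_repP j)) eqxx andbT.
by have := class_rep_in j; rewrite inE.
Qed.

End Classes.

(** * Reduction of integral polynomials to the residue field *)

Section ResiduePoly.
Variables (L : fieldType) (G : orderedZmodType) (v : valuation L G).
Local Notation res := (residue v).
Local Notation Z0 := (0 : withoo G).
Implicit Types p q : {poly L}.

Definition pint p := forall i, Z0 <= v p`_i.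
Definition rpol p : {poly resfield v} := map_poly res p.

Lemma rpolE p i : (rpol p)`_i = res p`_i.
Proof. by rewrite coef_map_id0 // res0. Qed.

Lemma pintM p q : pint p -> pint q -> pint (p * q).
Proof. by move=> hp hq i; rewrite coefM; apply: vsum_ge0 => j _; exact: vM_ge0. Qed.

Lemma rpolM p q : pint p -> pint q -> rpol (p * q) = rpol p * rpol q.
Proof.
move=> hp hq; apply/polyP => i; rewrite rpolE !coefM res_sum.
  by apply: eq_bigr => j _; rewrite residueM // !rpolE.
by move=> j _; exact: vM_ge0.
Qed.

Lemma pintXsubC a : Z0 <= v a -> pint ('X - a%:P).
Proof.
move=> ha i; rewrite coefB coefX coefC; apply: valB_ge; first exact: v_nat_ge0.
by case: ifP => // _; rewrite val0.
Qed.

Lemma rpolXsubC a : Z0 <= v a -> rpol ('X - a%:P) = 'X - (res a)%:P.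
Proof.
move=> ha; apply/polyP => i; rewrite rpolE !coefB !coefX !coefC.
by case: (i == 0)%N; rewrite resB ?v_nat_ge0 ?val0 // ?res_nat ?res0.
Qed.

Lemma pint_prod (r : seq L) : (forall a, a \in r -> Z0 <= v a) ->
  pint (\prod_(a <- r) ('X - a%:P)) /\
  rpol (\prod_(a <- r) ('X - a%:P)) = \prod_(a <- map res r) ('X - a%:P).
Proof.
elim: r => [|a r IH] h.
  rewrite !big_nil; split=> [i|]; first by rewrite coef1 v_nat_ge0.
  by apply/polyP => i; rewrite rpolE !coef1 res_nat.
have [i1 e1] : pint (\prod_(a <- r) ('X - a%:P)) /\
    rpol (\prod_(a <- r) ('X - a%:P)) = \prod_(a <- map res r) ('X - a%:P).
  by apply: IH => b hb; apply: h; rewrite inE hb orbT.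
have ha := h a (mem_head _ _).
rewrite big_cons /= big_cons; split; first by apply: pintM => //; exact: pintXsubC.
by rewrite rpolM ?rpolXsubC ?e1 //; exact: pintXsubC.
Qed.

End ResiduePoly.

Section Ramification.
Variables (L : closedFieldType) (G : orderedZmodType) (v : valuation L G).
Variables (K : set L) (hK : subfield K) (algK : algebraic_ext K setT).
Hypothesis hens : henselian v K.
Local Notation aut := {rmorphism L -> L}.
Local Notation Z0 := (0 : withoo G).
Local Notation res := (residue v).
Local Notation vgal := (v_gal hK algK hens).
Local Notation aid := (aut_id L).
Implicit Types (D E F : set L) (x y z : L) (s t g : aut).

Lemma dedekind_fin E s0 (I : finType) (A : {pred I}) (c : I -> L) (s : I -> aut) :
  subfield E -> is_gal K s0 ->
  (forall i, i \in A -> [/\ is_gal K (s i), Z0 <= v (c i) & ~ eq_lead v E s0 (s i)]) ->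
  exists y, [/\ E y, y != 0 & v (s0 y + \sum_(i in A) c i * s i y) <= v y].
Proof.
move=> hE g0 h.
have h' (i : 'I_#|A|) := h _ (enum_valP i).
have [|i|i|y hy] := @dedekind _ _ _ _ hK algK hens E s0 _
  (fun i : 'I_#|A| => c (enum_val i)) (fun i => s (enum_val i)) hE g0.
- by move=> i; case: (h' i).
- by case: (h' i).
- by case: (h' i).
by exists y; rewrite big_enum_val.
Qed.

Lemma conj_family (H : aut -> Prop) x : (forall s, H s -> is_gal K s) ->
  exists m (tau : 'I_m -> aut), [/\ forall j, H (tau j),
    forall i j, tau i x = tau j x -> i = j &
    forall t, H t -> exists j, t x = tau j x].
Proof.
move=> Hg; have [r [ur mr]] := orbit_list hK algK x Hg.
have /choice[tau htau] : forall j : 'I_(size r), exists t, H t /\ t x = r`_j.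
  by move=> j; have /mr[t Ht e] := mem_nth 0 (ltn_ord j); exists t.
exists (size r), tau; split.
- by move=> j; case: (htau j).
- move=> i j; rewrite (htau i).2 (htau j).2 => /eqP.
  by rewrite nth_uniq // => /eqP /val_inj.
- move=> t Ht; have xr : t x \in r by apply/mr; exists t.
  have lt : (index (t x) r < size r)%N by rewrite index_mem.
  by exists (Ordinal lt); rewrite (htau _).2 nth_index.
Qed.

Lemma conj_family_perm (H : aut -> Prop) x m (tau : 'I_m -> aut) g :
  (forall s t, H s -> H t -> H (aut_comp s t)) -> (forall j, H (tau j)) ->
  (forall i j, tau i x = tau j x -> i = j) ->
  (forall t, H t -> exists j, t x = tau j x) -> H g ->
  exists2 f : 'I_m -> 'I_m, injective f & forall j, g (tau j x) = tau (f j) x.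
Proof.
move=> Hc Ht tinj tsurj Hg.
have /choice[f hf] : forall j, exists k, g (tau j x) = tau k x.
  by move=> j; exact: (tsurj (aut_comp g (tau j)) (Hc _ _ Hg (Ht j))).
exists f => // i j e; apply: tinj; apply: (fmorph_inj g).
by rewrite !hf e.
Qed.

(** Homogeneity of the elementary symmetric functions when the roots are scaled by [t], written
    without division. *)
Lemma coef_scaled_prod (r : seq L) (t : L) i :
  (\prod_(a <- [seq a * t | a <- r]) ('X - a%:P))`_i * t ^+ i =
  t ^+ size r * (\prod_(a <- r) ('X - a%:P))`_i.
Proof.
elim: r i => [|a r IH] i.
  by rewrite !big_nil mul1r coef1; case: i => [|i]; rewrite ?mul1r ?mul0r ?expr0.
rewrite /= !big_cons !mulrBl !coefB !coefXM !coefCM /= mulrBl mulrBr.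
have h j : t ^+ size r * (\prod_(a <- r) ('X - a%:P))`_j =
   (\prod_(a <- [seq a * t | a <- r]) ('X - a%:P))`_j * t ^+ j by rewrite IH.
congr (_ - _); last first.
  rewrite exprS mulrCA [t * _ * _]mulrC; move: (h i).
  set A := _ * t ^+ i; set B := t ^+ _ * _ => hh.
  by rewrite -!mulrA -/A -hh /B; ring.
case: i => [|i] /=; first by rewrite mul0r mulr0.
by rewrite exprS [t ^+ (size r).+1]exprS -mulrA h; ring.
Qed.

Lemma eq_lead_ext E s s' t t' : (forall y, E y -> s y = s' y) ->
  (forall y, E y -> t y = t' y) -> eq_lead v E s t -> eq_lead v E s' t'.
Proof. by move=> hs ht h y Ey nz; rewrite -hs // -ht //; exact: h. Qed.

Section OneStep.
Variables (D : set L) (hD : subfield D) (KD : K `<=` D) (s : aut) (x : L).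
Hypotheses (gs : is_gal K s) (rs : eq_lead v D s aid) (sx : sep_over D x).

Let algD : algebraic_ext D setT := algebraic_extS hK hD KD algK.
Let ax y : algebraic_over D y := algx algD y.
Let E := adjoin D [set x].
Let hE : subfield E := @subfield_adjoin _ D [set x].
Let DK t (gt : is_gal D t) : is_gal K t := gal_sub KD gt.

Variables (m : nat) (tau : 'I_m -> aut).
Hypotheses (gtau : forall j, is_gal D (tau j))
  (tinj : forall i j, tau i x = tau j x -> i = j)
  (tsurj : forall t, is_gal D t -> exists j, t x = tau j x).

Lemma tau_perm g : is_gal D g -> exists2 f : 'I_m -> 'I_m, injective f &
  forall j y, E y -> g (tau j y) = tau (f j) y.
Proof.
move=> gg; have [f fi hf] := conj_family_perm (@gal_comp L D) gtau tinj tsurj gg.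
exists f => // j y Ey.
exact: (gal_adjoin1 (s := aut_comp g (tau j)) hD (ax x)
  (gal_comp gg (gtau j)) (gtau _) (hf j) Ey).
Qed.

Definition charpol y := \prod_j ('X - (tau j y)%:P).

Lemma charpol_base y : E y -> pol D (charpol y).
Proof.
move=> Ey i; apply: (fixed_sep_mem hK algK hD KD).
- have hS := subfield_sep_over hD algD; move: i; apply: (pol_prod_XsubC hS).
  move=> j _; apply: sep_over_gal => //; exact: (sep_over_adjoin hD algD sx).
- move=> g gg; have [f fi hf] := tau_perm gg.
  suff e : map_poly g (charpol y) = charpol y by rewrite -coef_map e.
  rewrite /charpol rmorph_prod [RHS](reindex_inj fi) /=; apply: eq_bigr => j _.
  by rewrite rmorphB /= map_polyX map_polyC /= hf.
Qed.

(* Scaled by [y], the polynomial with roots [tau j y] and its image under [s]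
   have the same residues, since [s] fixes the leading terms of [D]. *)
Lemma residue_roots y : E y -> y != 0 ->
  perm_eq [seq res (tau j y / y) | j <- enum 'I_m]
          [seq res (s (tau j y) / y) | j <- enum 'I_m].
Proof.
move=> Ey nz.
have vt j : v (tau j y) = v y by apply: vgal; exact: DK.
have i1 j : Z0 <= v (tau j y / y) by rewrite -vle_div // vt.
have i2 j : Z0 <= v (s (tau j y) / y) by rewrite -vle_div // vgal // vt.
pose r1 := [seq tau j y / y | j <- enum 'I_m].
pose r2 := [seq s (tau j y) / y | j <- enum 'I_m].
have [p1 e1] := @pint_prod _ _ v r1 (fun a h => let: ex_intro2 j _ e := mapP h in
   eq_ind_r (fun u => Z0 <= v u) (i1 j) e).
have [p2 e2] := @pint_prod _ _ v r2 (fun a h => let: ex_intro2 j _ e := mapP h in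
   eq_ind_r (fun u => Z0 <= v u) (i2 j) e).
apply: prod_XsubC_eq.
have -> : [seq res (tau j y / y) | j <- enum 'I_m] = map res r1.
  exact: (map_comp res (fun j => tau j y / y)).
have -> : [seq res (s (tau j y) / y) | j <- enum 'I_m] = map res r2.
  exact: (map_comp res (fun j => s (tau j y) / y)).
rewrite -e1 -e2; apply/polyP => i; rewrite !rpolE; apply/res_eq; [exact: p1|exact: p2|].
pose c := (charpol y)`_i; have Dc : D c by exact: charpol_base.
have nzi n : y^-1 ^+ n != 0 by rewrite expf_neq0 // invr_eq0.
pose P r := \prod_(a <- r) ('X - (a : L)%:P).
have E1 : (P r1)`_i * y^-1 ^+ i = y^-1 ^+ m * c.
  have := coef_scaled_prod [seq tau j y | j <- enum 'I_m] y^-1 i.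
  rewrite size_map size_enum_ord -map_comp => ->; congr (_ * _).
  by rewrite /c /charpol big_map big_enum.
have E2 : (P r2)`_i * y^-1 ^+ i = y^-1 ^+ m * s c.
  have := coef_scaled_prod [seq s (tau j y) | j <- enum 'I_m] y^-1 i.
  rewrite size_map size_enum_ord -map_comp => ->; congr (_ * _).
  rewrite /c -coef_map /charpol rmorph_prod big_map big_enum /=.
  suff -> : \prod_j map_poly s ('X - (tau j y)%:P) = \prod_j ('X - (s (tau j y))%:P) by [].
  by apply: eq_bigr => j _; rewrite rmorphB /= map_polyX map_polyC.
rewrite -/(P r1) -/(P r2); have [c0|nzc] := eqVneq c 0.
  have -> : (P r1)`_i = (P r2)`_i.
    by apply: (mulIf (nzi i)); rewrite E1 E2 c0 rmorph0.
  by rewrite subrr -(val1 v) v_lt0 // oner_neq0.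
apply: (le_lt_trans (p1 i)); rewrite -/(P r1) -(vlt_mul2l _ _ _ (nzi i)).
rewrite mulrBr ![_ ^+ i * _]mulrC E1 E2 -mulrBr vlt_mul2l // vBC.
exact: (rs Dc nzc).
Qed.

(** Otherwise the class of the identity would differ from the classes of all [s (tau i)] and of the
    other representatives [tau i]. Dedekind's argument would then give [y] in [E] at which the sum
    of the [tau i y] minus that of the [s (tau i y)], over class representatives, has value at most
    [v y]. By [residue_roots] this difference always has value greater than [v y]. *)
Lemma onestep : exists j, eq_lead v E (aut_comp s (tau j)) aid.
Proof.
apply: contrapT => /forallNP none.
pose e i j := `[< eq_lead v E (tau i) (tau j) >].
have er : reflexive e by move=> i; apply/asboolP; exact: eq_lead_refl.
have es : symmetric e.
  by move=> i j; apply/asboolP/asboolP; exact: eq_lead_sym.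
have et : transitive e.
  by move=> j i k /asboolP h /asboolP h'; apply/asboolP; exact: eq_lead_trans h h'.
have [j0 ej0] := tsurj (gal_id D).
have tau0 y : E y -> tau j0 y = y.
  move=> Ey; exact: (gal_adjoin1 (t := aid) hD (ax x) (gtau j0) (gal_id D) (esym ej0) Ey).
(* Left translation by [tau j] carries the class of the identity, indexed by [j0], onto the class of
   [tau j]. *)
have ecard j : #|[pred k | e j k]| = #|[pred k | e j0 k]|.
  have [f fi hf] := tau_perm (gtau j).
  rewrite -!sum1_card (reindex_inj fi); apply: eq_bigl => k; rewrite !inE.
  have ht k' y : E y -> aut_comp (tau j) (tau k') y = tau (f k') y by exact: hf.
  have h0 y : E y -> aut_comp (tau j) (tau j0) y = tau j y by move=> Ey /=; rewrite tau0.
  apply/asboolP/asboolP => h.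
    apply: (eq_lead_mullV hK algK hens (DK (gtau j))).
    by apply: eq_lead_ext h => y Ey; [rewrite h0|rewrite ht].
  by apply: eq_lead_ext (eq_lead_mull hK algK hens (DK (gtau j)) h); [exact: h0|exact: ht].
set mu := #|_| in ecard.
have mu0 : (0 < mu)%N by apply/card_gt0P; exists j0; exact: er.
pose Rep := class_reps e; pose i0 := class_rep e j0.
have Ri0 : i0 \in Rep by exact: class_rep_in.
have vt i y : v (tau i y) = v y by apply: vgal; exact: DK.
have sums y : E y -> y != 0 ->
    v y < v (\sum_(i in Rep) tau i y - \sum_(i in Rep) s (tau i y)).
  move=> Ey nz.
  pose a i := res (tau i y / y); pose b i := res (s (tau i y) / y).
  have i1 j : Z0 <= v (tau j y / y) by rewrite -vle_div // vt.
  have i2 j : Z0 <= v (s (tau j y) / y) by rewrite -vle_div // vgal // vt.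
  have ha i j : e i j -> a i = a j.
    move=> /asboolP h; apply/res_eq => //; rewrite -mulrBl -vlt_div //; exact: h.
  have hb i j : e i j -> b i = b j.
    move=> /asboolP h; apply/res_eq => //; rewrite -mulrBl -vlt_div //.
    by rewrite -rmorphB vgal //; exact: h.
  have pe : perm_eq (map a (enum Rep)) (map b (enum Rep)).
    apply/allP => c _ /=; apply/eqP/eqP; rewrite -(eqn_pmul2l mu0).
    rewrite -!(class_count er es et) //; apply/eqP.
    by move/permP: (residue_roots Ey nz); apply.
  have Eab : \sum_(i in Rep) a i = \sum_(i in Rep) b i.
    by have := perm_big _ pe (op := +%R) (x := 0) (P := xpredT) (F := id);
      rewrite !big_map !big_enum.
  rewrite vlt_div // mulrBl !mulr_suml; apply/res_eq.
  - exact: vsum_ge0.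
  - exact: vsum_ge0.
  - by rewrite !res_sum.
pose A : pred ('I_m + 'I_m) := fun u =>
  match u with inl i => (i \in Rep) && (i != i0) | inr i => i \in Rep end.
pose c (u : 'I_m + 'I_m) : L := match u with inl _ => 1 | inr _ => -1 end.
pose t (u : 'I_m + 'I_m) : aut :=
  match u with inl i => tau i | inr i => aut_comp s (tau i) end.
have [|y [Ey nz]] := @dedekind_fin E (tau i0) _ A c t hE (DK (gtau i0)).
  case=> i; rewrite unfold_in /=.
    move=> /andP[iR ni]; split; [exact: DK|by rewrite val1|].
    move=> h; case/eqP: ni; apply/esym/(class_reps_inj er es et Ri0 iR).
    exact/asboolP.
  move=> iR; split; [exact: gal_comp gs (DK (gtau i))|by rewrite valN1|].
  move=> h; apply: (none i); apply: eq_lead_sym; apply: eq_lead_trans h.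
  apply: (@eq_lead_ext _ (tau j0) aid (tau i0) (tau i0)) => //.
  by have /asboolP := class_repP er j0.
rewrite big_sumType /= leNgt => /negP; apply.
have -> : \sum_(i | inl i \in A) c (inl i) * tau i y =
    \sum_(i in Rep | i != i0) tau i y.
  by apply: eq_big => // i _; rewrite mul1r.
have -> : \sum_(i | inr i \in A) c (inr i) * s (tau i y) =
    - \sum_(i in Rep) s (tau i y).
  by rewrite -sumrN; apply: eq_big => // i _; rewrite mulN1r.
rewrite addrA -(bigD1 i0) //; exact: sums.
Qed.

End OneStep.
End Ramification.

(** * The ramification group and the orbits under it *)

Section RamificationGroup.
Variables (L : closedFieldType) (G : orderedZmodType) (v : valuation L G).
Variables (K : set L) (hK : subfield K) (algK : algebraic_ext K setT).
Hypothesis hens : henselian v K.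
Local Notation aut := {rmorphism L -> L}.
Local Notation vgal := (v_gal hK algK hens).
Local Notation aid := (aut_id L).
Local Notation Gr := (ramif_group v K).
Local Notation Kr := (ramif_field v K).
Implicit Types (D E F : set L) (x y z : L) (s t g : aut).

Lemma onestep_ex D s x : subfield D -> K `<=` D -> is_gal K s -> eq_lead v D s aid ->
  sep_over D x -> exists r : aut, [/\ is_gal K r, forall y, D y -> r y = s y &
    eq_lead v (adjoin D [set x]) r aid].
Proof.
move=> hD KD gs rs sx; have algD := algebraic_extS hK hD KD algK.
have [m [tau [gtau tinj tsurj]]] := conj_family hD algD x (H := is_gal D) (fun s h => h).
have [j hj] := onestep hK algK hens hD KD gs rs sx gtau tinj tsurj.
exists (aut_comp s (tau j)); split=> //.
  apply: gal_comp => //; exact: gal_sub KD (gtau j).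
by move=> y Dy /=; case: (gtau j) => _ ->.
Qed.

(** Zorn's lemma is applied to the partial embeddings that extend [s] on [D] and fix leading terms.
    By [onestep_ex] the domain of a maximal one contains every separable element; beyond it any
    extension will do, because [Gr] only tests separable elements. *)
Lemma ramif_extend D s : subfield D -> K `<=` D -> is_gal K s -> eq_lead v D s aid ->
  exists2 t, Gr t & forall y, D y -> t y = s y.
Proof.
move=> hD KD gs rs.
pose q x y := pe_functional x y /\ (x != 0 -> v x < v (y - x)).
have graphP E r : subfield E -> K `<=` E -> is_gal K r -> eq_lead v E r aid ->
    pembedding K q [set a | E a.1 /\ a.2 = r a.1].
  move=> hE KE gr rr; split=> /=.
  - by move=> x Kx; split; [exact: KE|case: gr => _ ->].
  - by move=> [x y] [x' y'] /= [Ex ->] [Ex' ->]; split; [exact: sfB|rewrite rmorphB].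
  - by move=> [x y] [x' y'] /= [Ex ->] [Ex' ->]; split; [exact: sfM|rewrite rmorphM].
  - by move=> [x y] /= [Ex ->]; split; [move=> ->; rewrite /pe_functional rmorph0|exact: rr].
have q0 y : q 0 y -> y = 0 by move=> [h _]; exact: h.
have [M [hM sM Mmax]] := pembedding_max hK (graphP D s hD KD gs rs).
have fM : pembedding K (@pe_functional L) M.
  split; [exact: (pe_base hM)|exact: (pe_sub hM)|exact: (pe_mul hM)|].
  by move=> a /(pe_cond hM) [].
have [t gt ht] := pe_gal hK algK fM.
have hE := subfield_pdom hK algK hM; have KE := sub_pdom hM; set E := pdom M in hE KE.
have rt : eq_lead v E t aid.
  move=> x [y Mxy] nz; rewrite (ht _ _ Mxy) /=.
  by have [_] := pe_cond hM Mxy; exact.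
exists t; last by move=> y Dy; apply: ht; apply: sM.
split=> // x /(sep_overE hK algK) sx nz; apply: (rt) => //.
have [r [gr er rr]] := onestep_ex hE KE gt rt (sep_over_sub KE sx).
have hEx := @subfield_adjoin _ E [set x].
have KEx : K `<=` adjoin E [set x] by move=> y /KE; exact: adjoin_base.
exists (r x); apply: (Mmax _ (graphP _ r hEx KEx gr rr)).
  move=> [a b] Mab; have Ea : E a by exists b.
  by split=> /=; [exact: adjoin_base|rewrite er // (ht _ _ Mab)].
by split=> //=; exact: adjoin1_id.
Qed.

Lemma ramif_fixed b s : Kr b -> is_gal K s -> eq_lead v (adjoin K [set b]) s aid -> s b = b.
Proof.
move=> [_ fb] gs rs.
have [t /fb tb e] := ramif_extend (@subfield_adjoin _ K [set b]) (@adjoin_base _ _ _) gs rs.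
by rewrite -e //; exact: adjoin1_id.
Qed.

Lemma gr_gal s : Gr s -> is_gal K s. Proof. by case. Qed.

Lemma gr_id : Gr aid.
Proof. by split; [exact: gal_id|move=> x _ nz; rewrite subrr v_lt0]. Qed.

Lemma gr_eq_lead s : is_gal K s -> Gr s <-> eq_lead v (sep_over K) s aid.
Proof.
move=> gs; rewrite -(sepclosureE hK algK); split=> [[_ h] x sx nz|h]; first exact: h.
by split=> // x sx nz; exact: h.
Qed.

Lemma gr_comp s t : Gr s -> Gr t -> Gr (aut_comp s t).
Proof.
move=> hs ht; have gs := gr_gal hs; have gt := gr_gal ht.
apply/gr_eq_lead; first exact: gal_comp.
apply: eq_lead_trans (_ : eq_lead v _ s aid); last exact/gr_eq_lead.
by apply: (eq_lead_mull hK algK hens gs (t := aid)); exact/gr_eq_lead.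
Qed.

(** Normality of the ramification group. *)
Lemma gr_conj s t : is_gal K s -> Gr t ->
  exists2 t', Gr t' & forall x, s (t x) = t' (s x).
Proof.
move=> gs ht; have [s' [gs' ss' s's]] := gal_inv gs.
exists (aut_comp s (aut_comp t s')); last by move=> x /=; rewrite ss'.
have gt := gr_gal ht; apply/gr_eq_lead; first by apply: gal_comp => //; exact: gal_comp.
move=> x sx nz; rewrite -[v x](vgal x gs') /= -{3}[x]s's -rmorphB (vgal _ gs).
have h := proj1 (gr_eq_lead gt) ht; apply: h => //; last by rewrite fmorph_eq0.
exact: sep_over_gal.
Qed.

Lemma subfield_Kr : subfield Kr.
Proof.
have hS := subfield_sep_over hK algK; rewrite -(sepclosureE hK algK) in hS.
apply: subfieldP.
- by split=> [|s _]; [exact: sf1|rewrite rmorph1].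
- by move=> x y [sx fx] [sy fy]; split=> [|s hs]; [exact: sfB|rewrite rmorphB fx // fy].
- by move=> x y [sx fx] [sy fy]; split=> [|s hs]; [exact: sfM|rewrite rmorphM fx // fy].
- by move=> x [sx fx]; split=> [|s hs]; [exact: sfV|rewrite fmorphV fx].
Qed.

Lemma sub_Kr : K `<=` Kr.
Proof.
move=> x Kx; split; last by move=> s [[_ h] _]; exact: h.
by rewrite (sepclosureE hK algK); exact: sep_over_mem.
Qed.

Lemma Kr_sep_over : Kr `<=` sep_over K.
Proof. by move=> x [/(sep_overE hK algK)]. Qed.

Lemma KrP x : sep_over K x -> (forall s, Gr s -> s x = x) -> Kr x.
Proof. by move=> sx fx; split=> //; exact/(sep_overE hK algK). Qed.

End RamificationGroup.

Lemma char_exp_dvd (k : fieldType) n : (0 < n)%N -> n%:R = 0 :> k ->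
  prime (char_exp k) /\ (char_exp k %| n)%N.
Proof.
move=> n0 e; have [p pc] : exists p, p \in [pchar k] by apply: (natf0_pchar n0); exact/eqP.
have hc : char_exp k \in [pchar k].
  by rewrite /char_exp; case: xgetP => [x _ //|/(_ p)]; case.
by split; [exact: pcharf_prime hc|rewrite (dvdn_pcharf hc) e].
Qed.

Section Orbit.
Variables (L : closedFieldType) (G : orderedZmodType) (v : valuation L G).
Variables (K : set L) (hK : subfield K) (algK : algebraic_ext K setT).
Hypothesis hens : henselian v K.
Local Notation aut := {rmorphism L -> L}.
Local Notation Z0 := (0 : withoo G).
Local Notation res := (residue v).
Local Notation vgal := (v_gal hK algK hens).
Local Notation Gr := (ramif_group v K).
Local Notation Kr := (ramif_field v K).
Local Notation p := (residue_char_exp v).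
Local Notation tameL b := (adjoin K [set b] `&` Kr).

Lemma subfield_tameL b : subfield (tameL b).
Proof. by apply: subfieldI; [exact: subfield_adjoin|exact: subfield_Kr]. Qed.

Lemma sub_tameL b : K `<=` tameL b.
Proof. by move=> x Kx; split; [exact: adjoin_base|exact: sub_Kr]. Qed.

Let axL b x : algebraic_over (tameL b) x :=
  algx (algebraic_extS hK (subfield_tameL b) (@sub_tameL b) algK) x.

Section Separable.
Variables (b : L) (sb : sep_over K b) (m : nat) (tau : 'I_m -> aut).
Hypotheses (gtau : forall j, Gr (tau j))
  (tinj : forall i j, tau i b = tau j b -> i = j)
  (tsurj : forall t, Gr t -> exists j, t b = tau j b).

Lemma orbit_poly_perm (s : aut) (f : 'I_m -> 'I_m) : (forall j, s (tau j b) = tau (f j) b) ->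
  map_poly s (\prod_j ('X - (tau j b)%:P)) = \prod_j ('X - (tau j b)%:P).
Proof.
move=> hf; have fi : injective f.
  by move=> i j e; apply: tinj; apply: (fmorph_inj s); rewrite !hf e.
rewrite rmorph_prod [RHS](reindex_inj fi) /=; apply: eq_bigr => j _.
by rewrite rmorphB /= map_polyX map_polyC /= hf.
Qed.

(** The [Gr]-orbit of [b] is stable under [Gr] and, [Gr] being normal, under every automorphism
    fixing [b]. The coefficients are separable and fixed by both groups. *)
Lemma orbit_poly_tameL : pol (tameL b) (\prod_j ('X - (tau j b)%:P)).
Proof.
have hS := subfield_sep_over hK algK.
have sepP : pol (sep_over K) (\prod_j ('X - (tau j b)%:P)).
  by apply: (pol_prod_XsubC hS) => j _; apply: sep_over_gal => //; exact: gr_gal (gtau j).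
move=> i; split.
- have hE := @subfield_adjoin _ K [set b].
  apply: (fixed_sep_mem hK algK hE (@adjoin_base _ _ _)).
    by apply: sep_over_sub (sepP i); exact: adjoin_base.
  move=> s gs; rewrite -coef_map.
  have /choice[f hf] : forall j, exists k, s (tau j b) = tau k b.
    move=> j; have gsK := gal_sub (@adjoin_base _ K [set b]) gs.
    have [t ht ->] := gr_conj hK algK hens gsK (gtau j).
    by case: gs => _ ->; [exact: tsurj|exact: adjoin1_id].
  by rewrite (orbit_poly_perm hf).
- apply: KrP => // s hs; rewrite -coef_map.
  have /choice[f hf] : forall j, exists k, s (tau j b) = tau k b.
    by move=> j; apply: (tsurj (t := aut_comp s (tau j))); exact: gr_comp.
  by rewrite (orbit_poly_perm hf).
Qed.

(** The orbit polynomial bounds the degree from above. Conversely, [Gr] fixes the base field, so the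
    whole orbit consists of roots of the minimal polynomial. *)
Lemma deg_tameL : deg (tameL b) b = m.
Proof.
have hL := subfield_tameL b.
have [j0 ej0] := tsurj (gr_id v K).
apply/eqP; rewrite eqn_leq; apply/andP; split.
  have := deg_le_size hL orbit_poly_tameL (x := b).
  have sm : size (index_enum 'I_m) = m by rewrite [index_enum _]unlock -enumT size_enum_ord.
  rewrite size_prod_XsubC sm; apply.
    exact/monic_neq0/monic_prod_XsubC.
  rewrite /root horner_prod (bigD1 j0) //= !hornerE -ej0 subrr mul0r //.
rewrite -ltnS -size_min_polyE //.
have /(max_poly_roots (min_poly_neq0 hL (axL b b))) :
    all (root (min_poly (tameL b) b)) [seq tau j b | j <- enum 'I_m].
  apply/allP => _ /mapP[j _ ->].
  have gj : is_gal (tameL b) (tau j).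
    split; first by case: (gr_gal (gtau j)).
    by move=> x [_ [_ h]]; exact: h.
  rewrite /root -(gal_horner _ gj (min_poly_pol hL (axL b b))).
  by rewrite (rootP (min_poly_root hL (axL b b))) rmorph0.
rewrite size_map size_enum_ord; apply.
by rewrite map_inj_uniq ?enum_uniq // => i j /tinj.
Qed.

Let d j := v (b - tau j b).

(* For [tau] in [Gr] with [v (tau b - b) >= v c], [tau |-> res ((tau b - b) / c)]
   is a homomorphism to the additive group of the residue field. *)
Lemma orbit_block j1 : tau j1 b != b ->
  exists q, [/\ (0 < q)%N, q%:R = 0 :> resfield v &
    #|[pred j | d j1 <= d j]| = (q * #|[pred j | (d j1 < d j)%R]|)%N].
Proof.
move=> nj1; set c := tau j1 b - b.
have nzc : c != 0 by rewrite subr_eq0.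
have vc : v c = d j1 by rewrite /c /d vBC.
pose phi j := res ((tau j b - b) / c).
pose B := [pred j | d j1 <= d j].
have dE j : d j = v (tau j b - b) by rewrite /d vBC.
have Bge j : j \in B -> Z0 <= v ((tau j b - b) / c).
  by rewrite inE -vc dE vle_div.
have tr j : j \in B -> exists2 f : 'I_m -> 'I_m, injective f &
    (forall k, (f k \in B) = (k \in B)) /\
    (forall k, k \in B -> phi (f k) = phi k + phi j).
  move=> Bj.
  have [f fi hf] := conj_family_perm (gr_comp hK algK hens) gtau tinj tsurj (gtau j).
  exists f => //.
  have E k : tau (f k) b - b = tau j (tau k b - b) + (tau j b - b).
    by rewrite -hf rmorphB addrA subrK.
  have vt k : v (tau j (tau k b - b)) = d k by rewrite vgal ?dE //; exact: gr_gal.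
  split=> k; first rewrite !inE.
    apply/idP/idP => h; last first.
      by rewrite (dE (f k)) E; apply: vD_le; [rewrite vt|rewrite -dE; exact: Bj].
    rewrite -(vt k) -[tau j _](addrK (tau j b - b)) -E.
    by apply: valB_ge; rewrite -dE.
  move=> Bk; rewrite /phi E mulrDl residueD ?Bge //; last first.
    by rewrite -vle_div // vt vc; exact: Bk.
  congr (_ + _); apply/res_eq; rewrite ?Bge //.
    by rewrite -vle_div // vt vc; exact: Bk.
  rewrite -mulrBl -vlt_div //.
  have sk : sep_over K (tau k b - b).
    apply: (sfB (subfield_sep_over hK algK)) => //.
    by apply: sep_over_gal => //; exact: gr_gal.
  have [e|nz] := eqVneq (tau k b - b) 0; first by rewrite e rmorph0 subrr v_lt0.
  rewrite vc; apply: (le_lt_trans (Bk : d j1 <= d k)).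
  by rewrite dE; have := proj1 (gr_eq_lead v hK algK (gr_gal (gtau j))) (gtau j) _ sk nz.
have Bj1 : j1 \in B by rewrite inE.
have phi1 : phi j1 = 1 by rewrite /phi divff // res1.
pose Phi := undup [seq phi j | j <- enum B].
have mPhi j : j \in B -> phi j \in Phi.
  by move=> Bj; rewrite mem_undup; apply/map_f; rewrite mem_enum.
have PhiP x : x \in Phi -> exists2 j, j \in B & x = phi j.
  by rewrite mem_undup => /mapP[j]; rewrite mem_enum; exists j.
exists (size Phi); split.
- by have := mPhi _ Bj1; case: (Phi).
- have [f fi [fB hf]] := tr _ Bj1.
  (* Since [phi j1 = 1], the finite set [Phi] is stable under translation by [1]. Comparing the sums
     over [Phi] and over its translate shows that [size Phi] vanishes in the residue field. *)
  have pe : perm_eq [seq x + 1 | x <- Phi] Phi.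
    have inj : injective (fun x : resfield v => x + 1) by exact: addIr.
    have sub : {subset [seq x + 1 | x <- Phi] <= Phi}.
      move=> _ /mapP[x /PhiP[k Bk ->] ->].
      by rewrite -phi1 -hf //; apply: mPhi; rewrite fB.
    have uP : uniq [seq x + 1 | x <- Phi] by rewrite map_inj_uniq ?undup_uniq.
    apply: uniq_perm => //; first exact: undup_uniq.
    by have [|_ h] := uniq_min_size uP sub; rewrite ?size_map.
  have := perm_big _ pe (op := +%R) (x := 0) (P := xpredT) (F := id).
  rewrite big_map big_split /= -[RHS]addr0 => /addrI.
  by rewrite big_const_seq count_predT iter_addr_0.
(* The fibres of [phi] are translates of its kernel, which consists of the [k] with [d j1 < d k]. *)
- have fib x : x \in Phi ->
      #|[pred k in B | phi k == x]| = #|[pred k | d j1 < d k]|.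
    move=> /PhiP[j Bj ->]; have [f fi [fB hf]] := tr _ Bj.
    rewrite -!sum1_card (reindex_inj fi); apply: eq_bigl => k.
    change ((f k \in B) && (phi (f k) == phi j) = (d j1 < d k)).
    rewrite fB; have [Bk|nBk] := boolP (k \in B); last first.
      by apply/esym/negbTE; apply: contra nBk => h; rewrite inE ltW.
    rewrite /= hf // -{2}[phi j]add0r (inj_eq (addIr _)).
    by rewrite residue_eq0 ?Bge // -vlt_div // vc -dE.
  rewrite -sum1_card.
  under eq_bigr => j Bj.
    rewrite (_ : 1%N = (\sum_(x <- Phi | phi j == x) 1)%N); last first.
      rewrite sum1_count; transitivity (count_mem (phi j) Phi).
        by rewrite count_uniq_mem ?undup_uniq // mPhi.
      by apply: eq_count => x; exact: eq_sym.
    over.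
  rewrite (exchange_big_dep xpredT) //=.
  rewrite big_seq; under eq_bigr => x xPhi.
    rewrite sum1_card (fib x xPhi). over.
  by rewrite -big_seq big_const_seq count_predT iter_addn_0 mulnC.
Qed.

(** The third clause covers residue characteristic [0], where [p] is [1] and the divisibility says
    nothing: no value occurs there. *)
Lemma orbit_values : exists vals : seq (withoo G),
  [/\ forall t, Gr t -> t b != b -> v (b - t b) \in vals,
      (p ^ size vals %| m)%N & (0 < size vals)%N -> prime p].
Proof.
pose J := [seq j <- enum 'I_m | tau j b != b].
pose vals := undup [seq d j | j <- J].
have mvals j : tau j b != b -> d j \in vals.
  by move=> h; rewrite mem_undup; apply: map_f; rewrite mem_filter h mem_enum.
have valsP x : x \in vals -> exists2 j, tau j b != b & x = d j.
  by rewrite mem_undup => /mapP[j]; rewrite mem_filter => /andP[? _]; exists j.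
have blk j1 : tau j1 b != b -> prime p /\
    (p * #|[pred j | (d j1 < d j)%R]| %| #|[pred j | (d j1 <= d j)%R]|)%N.
  move=> /orbit_block[q [q0 qe ->]].
  by have [pp pq] := char_exp_dvd q0 qe; rewrite dvdn_mul.
exists vals; split.
- move=> t ht; have [j e] := tsurj ht; rewrite e => h; exact: mvals.
(* Induction on the number of elements of [vals] in an upward closed [U]. By [blk], removing the
   least of them leaves a count of conjugates whose product with [p] divides the original count. *)
- suff H n (U : pred (withoo G)) : (forall x y, U x -> x <= y -> U y) ->
      size [seq x <- vals | U x] = n -> (p ^ n %| #|[pred j | U (d j)]|)%N.
    have := H (size vals) xpredT (fun _ _ _ _ => isT).
    by rewrite filter_predT card_ord; apply.
  elim: n U => [|n IH] U upU sz; first by rewrite expn0 dvd1n.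
  have nz : [seq x <- vals | U x] != [::] by rewrite -size_eq0 sz.
  have [g gU gmin] : exists2 g, g \in [seq x <- vals | U x] &
      forall y, y \in [seq x <- vals | U x] -> g <= y.
    exact: (@seq_max _ (withoo G)^d _ id _ nz).
  move: gU; rewrite mem_filter => /andP[Ug /valsP[j1 nj1 eg]].
  have -> : #|[pred j | U (d j)]| = #|[pred j | (d j1 <= d j)]|.
    apply: eq_card => j; rewrite !inE; apply/idP/idP => h; last first.
      by apply: upU h; rewrite -eg.
    have [e|ne] := eqVneq (tau j b) b.
      by rewrite /d e subrr v_le0.
    by rewrite -eg; apply: gmin; rewrite mem_filter h mvals.
  have [_] := blk _ nj1; apply: dvdn_trans; rewrite expnS dvdn_mul //.
  apply: (IH (fun x => d j1 < x)); first by move=> x y; exact: lt_le_trans.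
  have uv : uniq vals by exact: undup_uniq.
  have pe : perm_eq [seq x <- vals | U x] (d j1 :: [seq x <- vals | d j1 < x]).
    apply: uniq_perm; rewrite ?filter_uniq //=.
      by rewrite filter_uniq // mem_filter ltxx.
    move=> x; rewrite !inE !mem_filter; apply/andP/orP.
      move=> [Ux xv]; have : g <= x by apply: gmin; rewrite mem_filter Ux.
      rewrite eg le_eqVlt => /orP[/eqP <-|->]; [by left|by rewrite xv; right].
    case=> [/eqP ->|/andP[lt xv]]; first by split; [rewrite -eg|exact: mvals].
    by split=> //; apply: upU (ltW lt); rewrite -eg.
  by have := perm_size pe; rewrite sz /= => -[].
- by rewrite -has_predT => /hasP[x /valsP[j /blk[]]].
Qed.

End Separable.

Lemma ramif_values b : sep_over K b -> exists vals : seq (withoo G),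
  (forall t, Gr t -> t b != b -> v (b - t b) \in vals) /\
  (size vals <= logn p (deg (tameL b) b))%N.
Proof.
move=> sb; have [m [tau [gtau tinj tsurj]]] := conj_family hK algK b (@gr_gal _ _ v K).
have [vals [hv dv pv]] := orbit_values sb gtau tinj tsurj.
exists vals; split=> //; rewrite (deg_tameL sb gtau tinj tsurj).
have [->//|s0] := posnP (size vals).
rewrite -pfactor_dvdn //; first exact: pv.
by have [j _] := tsurj _ (gr_id v K); case: m j {tau gtau tinj tsurj dv} => [[]|].
Qed.

(** Later members of a distinguished chain need not be separable over [K]. Then [b] is also
    inseparable over the intersection of [K(b)] with [Kr], whose elements are separable over [K],
    and its minimal polynomial there has derivative zero. *)
Lemma logn_deg_insep b : ~ sep_over K b -> (0 < logn p (deg (tameL b) b))%N.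
Proof.
move=> nsb; have hL := subfield_tameL b; have ab := axL b b.
have nsL : ~ sep_over (tameL b) b.
  by apply: contra_not nsb; apply: sep_over_trans => // x [_] /(Kr_sep_over hK algK).
have hq := min_poly_pol hL ab; set q := min_poly _ b in hq.
have q'0 : q^`() = 0.
  by apply: (min_poly_deriv0 hL ab) => sq; apply: nsL; exists q; split=> //; exact: min_poly_root.
have dgt := deg_gt0 hL ab; set n := deg _ b in dgt *.
have n0 : n%:R = 0 :> L by have := min_poly_deriv0_deg hL ab q'0; rewrite size_min_polyE.
have [pp pn] : prime p /\ (p %| n)%N.
  by apply: char_exp_dvd => //; rewrite -(res_nat v) n0 res0.
by rewrite logn_gt0 mem_primes pp dgt pn.
Qed.

Lemma logn_deg_gt0 b : ~ Kr b -> (0 < logn p (deg (tameL b) b))%N.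
Proof.
move=> nb; have [sb|] := pselect (sep_over K b); last exact: logn_deg_insep.
have [t [ht nt]] : exists t : aut, Gr t /\ t b != b.
  apply: contrapT => /forallNP h; apply: nb; apply: KrP => // s hs.
  by apply: contrapT => /eqP ns; apply: (h s).
have [vals [hv sv]] := ramif_values sb.
by apply: leq_trans sv; have := hv _ ht nt; case: (vals).
Qed.

End Orbit.

(** * Distinguished pairs *)

Section Distinguished.
Variables (L : closedFieldType) (G : orderedZmodType) (v : valuation L G).
Variables (K : set L) (hK : subfield K) (algK : algebraic_ext K setT).
Hypothesis hens : henselian v K.
Local Notation aut := {rmorphism L -> L}.
Local Notation vgal := (v_gal hK algK hens).
Local Notation aid := (aut_id L).
Local Notation Kr := (ramif_field v K).
Local Notation dpair := (distinguished_pair v K).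
Let ax x : algebraic_over K x := algx algK x.

(** [x - z] and [y - z] have the same leading term, because [v (x - y)] exceeds [v (x - z)], and
    leading terms are multiplicative. *)
Lemma vprod_close (r : seq L) (x y : L) : (forall z, z \in r -> v (x - z) < v (x - y)) ->
  v (\prod_(z <- r) (x - z)) < v (\prod_(z <- r) (y - z) - \prod_(z <- r) (x - z)).
Proof.
elim: r => [|z r IH] h; first by rewrite !big_nil subrr v_lt0 ?oner_neq0.
have hz := h z (mem_head _ _); have nz := v_ltP hz.
have {}IH : v (\prod_(z <- r) (x - z)) < v (\prod_(z <- r) (y - z) - \prod_(z <- r) (x - z)).
  by apply: IH => t tr; apply: h; rewrite inE tr orbT.
rewrite !big_cons; set A := \prod_(z <- r) (x - z) in IH *; set B := \prod_(z <- r) _ in IH *.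
have nzA := v_ltP IH.
have dz : v (x - z) < v ((y - z) - (x - z)).
  by rewrite (_ : y - z - (x - z) = y - x) ?[v (y - x)]vBC //; ring.
have -> : (y - z) * B - (x - z) * A = (y - z) * (B - A) + (y - z - (x - z)) * A by ring.
apply: vD_lt.
  by rewrite !valM (v_eq_lt dz) -!valM vlt_mul2l.
by rewrite ![_ * A]mulrC vlt_mul2l.
Qed.

Lemma dist_eq_lead b c (s : aut) : dpair b c -> is_gal K s -> v (b - c) < v (b - s b) ->
  eq_lead v (adjoin K [set b]) s aid.
Proof.
move=> [dcb dmax _] gs lt y /(adjoin1P_small hK (ax b))[f [hf sf ->]] nzy.
rewrite (gal_horner _ gs hf) /=.
have nzf : f != 0 by apply: contraNneq nzy => ->; rewrite horner0.
have [r Er] := closed_field_poly_normal f.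
have nl : lead_coef f != 0 by rewrite lead_coef_eq0.
have Ev x : f.[x] = lead_coef f * \prod_(z <- r) (x - z).
  by rewrite {1}Er hornerZ horner_prod; congr (_ * _); apply: eq_bigr => z _; rewrite !hornerE.
rewrite !Ev -mulrBr vlt_mul2l //; apply: vprod_close => z zr.
apply: le_lt_trans lt; apply: dmax.
have := deg_le_size hK hf nzf (x := z).
rewrite {1}Er rootZ // root_prod_XsubC zr => /(_ isT) h.
apply: leq_ltn_trans h _; move: sf; rewrite (size_min_polyE hK (ax b)) ltnS.
have : (0 < size f)%N by rewrite size_poly_gt0.
by case: (size f).
Qed.

Lemma dist_fixed b c (s : aut) : Kr b -> dpair b c -> is_gal K s ->
  v (b - c) < v (b - s b) -> s b = b.
Proof.
move=> bK dp gs lt; apply: (ramif_fixed hK algK hens bK gs).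
exact: dist_eq_lead dp gs lt.
Qed.

(** A form of Krasner's lemma. An automorphism fixing [x] moves [d] by an element of value at least
    [v (x - d)], so it fixes [d] by [dist_fixed]. *)
Lemma dist_mem x d d' : Kr d -> dpair d d' -> v (d - d') < v (x - d) ->
  adjoin K [set x] d.
Proof.
move=> dK dp lt; have hE := @subfield_adjoin _ K [set x].
apply: (fixed_sep_mem hK algK hE (@adjoin_base _ _ _)).
  by apply: sep_over_sub (Kr_sep_over hK algK dK); exact: adjoin_base.
move=> s gs; have gsK := gal_sub (@adjoin_base _ K [set x]) gs.
apply: (dist_fixed dK dp gsK); apply: (lt_le_trans lt).
have sx : s x = x by case: gs => _; apply; exact: adjoin1_id.
have -> : d - s d = s (x - d) - (x - d) by rewrite rmorphB sx; ring.
by apply: valB_ge; rewrite ?vgal //.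
Qed.

(* An average over the automorphisms moving [b] by at least [v (b - c)], weighted
   by [y] so that the trace of [y] does not vanish to higher order, approximates
   [b] as well as [c] does, and lies both in [K(b)] and in [K(c)]. *)
Lemma dist_adjoin b c : Kr b -> dpair b c -> adjoin K [set b] c.
Proof.
move=> bK dp; have [dcb dmax dmin] := dp.
have sb := Kr_sep_over hK algK bK.
(* The stabilizer of the ball around [b] of radius [v (b - c)]. It contains the automorphisms fixing
   [b] and those fixing [c], which is why an [H]-invariant element [c'] lies in both fields. *)
pose H (s : aut) := is_gal K s /\ v (b - c) <= v (b - s b).
have Hid : H aid by split; [exact: gal_id|rewrite /= subrr v_le0].
have Hc s t : H s -> H t -> H (aut_comp s t).
  move=> [gs hs] [gt ht]; split; first exact: gal_comp.
  have -> : b - aut_comp s t b = (b - s b) + s (b - t b) by rewrite rmorphB /=; ring.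
  by apply: vD_le => //; rewrite vgal.
have [m [tau [Htau tinj tsurj]]] := conj_family hK algK b (H := H) (fun s h => proj1 h).
have gtau j := proj1 (Htau j).
have [j0 ej0] := tsurj _ Hid.
set E := adjoin K [set b]; have hE : subfield E := @subfield_adjoin _ K [set b].
have tau0 y : E y -> tau j0 y = y.
  move=> Ey; exact: (gal_adjoin1 (t := aid) hK (ax b) (gtau j0) (gal_id K) (esym ej0) Ey).
have [|y [Ey nzy ley]] :=
    @dedekind_fin _ _ _ _ hK algK hens E aid _ (predC1 j0) (fun=> 1) tau hE (gal_id K).
  move=> j; rewrite inE => nj; split=> //; first by rewrite val1.
  move=> /eq_lead_sym /(ramif_fixed hK algK hens bK (gtau j)) e.
  by case/eqP: nj; apply: tinj; rewrite e -ej0.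
pose T := \sum_j tau j y; pose U := \sum_j tau j (y * b); pose c' := U / T.
have vT : v T <= v y.
  apply: le_trans ley; rewrite /T (bigD1 j0) //= tau0 //.
  by under [X in _ <= v (_ + X)]eq_bigr => j _ do rewrite mul1r.
have nzT : T != 0.
  by apply: contraTneq vT => ->; rewrite -ltNge v_lt0.
have Eyb : E (y * b) by apply: (sfM hE) => //; exact: adjoin1_id.
have close : v (b - c) <= v (b - c').
  rewrite -(vle_mul2l _ _ _ nzT).
  have -> : T * (b - c') = \sum_j tau j y * (b - tau j b).
    rewrite mulrBr /c' mulrC [T * _]mulrC divfK // mulr_sumr -sumrB.
    by apply: eq_bigr => j _; rewrite rmorphM; ring.
  apply: (@le_trans _ _ (v (y * (b - c)))); first by rewrite !valM leadd_oo.
  apply: vsum_le => j _; rewrite !valM vgal //; apply: leadd_oo => //.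
  by case: (Htau j).
have fixT g z : H g -> E z -> g (\sum_j tau j z) = \sum_j tau j z.
  move=> Hg Ez; have [f fi hf] := conj_family_perm Hc Htau tinj tsurj Hg.
  rewrite rmorph_sum [RHS](reindex_inj fi) /=; apply: eq_bigr => j _.
  exact: (gal_adjoin1 (s := aut_comp g (tau j)) hK (ax b)
    (gal_comp (proj1 Hg) (gtau j)) (gtau _) (hf j) Ez).
have fc' g : H g -> g c' = c' by move=> Hg; rewrite fmorph_div !fixT.
have hS := subfield_sep_over hK algK.
have septT z : E z -> sep_over K (\sum_j tau j z).
  move=> Ez; apply: (sf_sum hS) => j _; apply: sep_over_gal => //.
  exact: (sep_over_adjoin hK algK sb).
have sc' : sep_over K c' by apply: (sf_div hS); exact: septT.
have memc' x : (forall s, is_gal (adjoin K [set x]) s -> v (b - c) <= v (b - s b)) ->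
    adjoin K [set x] c'.
  move=> hx; apply: (fixed_sep_mem hK algK (@subfield_adjoin _ K [set x]) (@adjoin_base _ _ _)).
    by apply: sep_over_sub sc'; exact: adjoin_base.
  by move=> s gs; apply: fc'; split; [exact: gal_sub (@adjoin_base _ _ _) gs|exact: hx].
have bc' : E c'.
  by apply: memc' => s [_ ->]; [rewrite subrr v_le0|exact: adjoin1_id].
have cc' : adjoin K [set c] c'.
  apply: memc' => s gs; have gsK := gal_sub (@adjoin_base _ K [set c]) gs.
  have scc : s c = c by case: gs => _; apply; exact: adjoin1_id.
  have -> : b - s b = (b - c) - s (b - c) by rewrite rmorphB scc; ring.
  by apply: valB_ge => //; rewrite vgal.
(* By its degree [c'] competes with [c] in the definition of the pair: it is no closer to [b], so
   [v (b - c') = v (b - c)]. Minimality of [deg c] then gives [K(c') = K(c)]. *)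
have dc' := deg_le hK (ax c) (ax c') cc'.
have e : v (b - c) = v (b - c').
  by apply/le_anti; rewrite close dmax // (leq_ltn_trans dc').
have := adjoin_deg_sub hK (ax c) (ax c') cc' (dmin _ e).
by apply: adjoin1_min => //; exact: adjoin_base.
Qed.

Lemma dist_Kr b c : Kr b -> dpair b c -> Kr c.
Proof.
move=> bK dp; apply: (adjoin1_min _ _ bK (dist_adjoin bK dp)).
- exact: subfield_Kr.
- exact: sub_Kr.
Qed.

End Distinguished.

(** * Ramification index, residue degree and tameness *)

Lemma enum_fset_set (T : choiceType) (C : set T) : finite_set C -> exists s : seq T,
  [/\ uniq s, forall x, x \in s <-> C x & #|` fset_set C| = size s].
Proof.
move=> finC; exists (fset_set C).
have ms : forall x, x \in (fset_set C : seq T) <-> C x.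
  move=> x; have e : (x \in (fset_set C : seq T)) = (x \in C) := in_fset_set finC x.
  by rewrite e; split=> [/set_mem|/mem_set].
by split.
Qed.

Section StandardGenerators.
Variables (L : fieldType) (G : orderedZmodType) (v : valuation L G).
Variables (K : set L) (hK : subfield K).
Local Notation Z0 := (0 : withoo G).
Local Notation res := (residue v).
Local Notation residues F := (@residues L G v F).
Implicit Types (E F : set L) (x y z k : L).

Lemma subfield_residues F : subfield F -> subfield (residues F).
Proof.
move=> hF; apply: subfieldP.
- by exists 1; [split; [exact: sf1|rewrite val1]|rewrite res1].
- move=> _ _ [x [Fx hx] <-] [y [Fy hy] <-]; exists (x - y); last by rewrite resB.
  by split; [exact: sfB|exact: valB_ge].
- move=> _ _ [x [Fx hx] <-] [y [Fy hy] <-]; exists (x * y); last by rewrite residueM.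
  by split; [exact: sfM|exact: vM_ge0].
- move=> _ [x [Fx hx] <-]; have [e|ne] := eqVneq (v x) 0.
    by exists x^-1; [split; [exact: sfV|rewrite vV0]|rewrite resV].
  have -> : res x = 0 by apply/eqP; rewrite residue_eq0 // lt_neqAle eq_sym ne.
  by exists 0; [split; [exact: sf0|rewrite val0]|rewrite res0 invr0].
Qed.

Lemma v_mulI z x y : z != 0 -> v (z * x) = v (z * y) -> v x = v y.
Proof.
by move=> nz e; apply/le_anti; rewrite -(vle_mul2l v x y nz) -(vle_mul2l v y x nz) e lexx.
Qed.

Lemma seq_vmin (A : eqType) (f : A -> L) (s : seq A) : s != [::] ->
  exists2 a0, a0 \in s & forall a1, a1 \in s -> v (f a0) <= v (f a1).
Proof.
move=> nz; have [a0 sa0 h] := @seq_max _ (withoo G)^d A (fun a => v (f a)) s nz.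
by exists a0 => // a1 /h.
Qed.

Definition rfree f (w : 'I_f -> L) := forall c : 'I_f -> resfield v,
  (forall j, residues K (c j)) -> \sum_j c j * res (w j) = 0 -> forall j, c j = 0.

(** After division by a coefficient of least value, the residue of the sum is a nontrivial
    combination of the residues of the [w j], hence nonzero. *)
Lemma rfree_value f (w c : 'I_f -> L) : (forall j, Z0 <= v (w j)) -> rfree w ->
  (forall j, K (c j)) -> (exists j, c j != 0) ->
  exists k, [/\ K k, k != 0 & v (\sum_j c j * w j) = v k].
Proof.
move=> hw fw Kc [j1 nj1].
pose s := [seq j <- enum 'I_f | c j != 0].
have [|j0] := @seq_vmin _ c s.
  have : j1 \in s by rewrite mem_filter nj1 mem_enum.
  by case: (s).
rewrite mem_filter => /andP[nz _] hmin.
have le j : v (c j0) <= v (c j).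
  have [->|nzj] := eqVneq (c j) 0; first exact: v_le0.
  by apply: hmin; rewrite mem_filter nzj mem_enum.
exists (c j0); split=> //; apply/(veq_div _ _ nz).
have i1 j : Z0 <= v (c j / c j0) by rewrite -vle_div.
have E : (\sum_j c j * w j) / c j0 = \sum_j (c j / c j0) * w j.
  by rewrite mulr_suml; apply: eq_bigr => j _; rewrite mulrAC.
have I : Z0 <= v ((\sum_j c j * w j) / c j0).
  by rewrite E; apply: vsum_ge0 => j _; exact: vM_ge0.
apply/eqP; rewrite eq_sym; have := I; rewrite le_eqVlt => /orP[//|].
rewrite -residue_eq0 // E res_sum; last by move=> j _; exact: vM_ge0.
under eq_bigr => j _ do rewrite residueM //.
have hc j : residues K (res (c j / c j0)).
  by exists (c j / c j0) => //; split=> //; exact: sf_div.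
move=> /eqP /(fw _ hc) /(_ j0) /eqP.
by rewrite divff // res1 oner_eq0.
Qed.

(** The source of the fundamental inequality. By [rfree_value] each nonzero inner sum has its value
    in [vK], so the outer terms have values in distinct cosets of [vK] and cannot cancel. *)
Lemma lindep e f (u : 'I_e -> L) (w : 'I_f -> L) (c : 'I_e -> 'I_f -> L) :
  (forall i, u i != 0) ->
  (forall i j k, K k -> k != 0 -> v (u i) = v (k * u j) -> i = j) ->
  (forall j, Z0 <= v (w j)) -> rfree w -> (forall i j, K (c i j)) ->
  \sum_i \sum_j c i j * (u i * w j) = 0 -> forall i j, c i j = 0.
Proof.
move=> nu hu hw fw Kc s0 i j; apply/eqP/negPn/negP => ncij.
pose t i := \sum_j c i j * w j.
have {}s0 : \sum_i t i * u i = 0.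
  rewrite -[RHS]s0; apply: eq_bigr => i' _; rewrite mulr_suml.
  by apply: eq_bigr => j' _; ring.
have ht i' : (exists j', c i' j' != 0) -> exists k, [/\ K k, k != 0 & v (t i') = v k].
  exact: rfree_value.
have t0 i' : t i' != 0 -> exists j', c i' j' != 0.
  move=> nz; apply: contrapT => /forallNP h; case/eqP: nz.
  by rewrite /t big1 // => j' _; have /negP/negPn/eqP -> := h j'; rewrite mul0r.
have nti : t i != 0.
  have [|k [_ nk e1]] := ht i; first by exists j.
  by apply/eqP => e2; have := v_neq0 v nk; rewrite -e1 e2 eqxx.
pose s := [seq i' <- enum 'I_e | t i' != 0].
have [|i0] := @seq_vmin _ (fun i' => t i' * u i') s.
  have : i \in s by rewrite mem_filter nti mem_enum.
  by case: (s).
rewrite mem_filter => /andP[nt0 _] hmin.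
have : v (t i0 * u i0) < v (\sum_(i' | i' != i0) t i' * u i').
  apply: vsum_lt; first by rewrite mulf_neq0.
  move=> i' ni; have [->|nt'] := eqVneq (t i') 0.
    by rewrite mul0r v_lt0 // mulf_neq0.
  rewrite lt_neqAle andbC; apply/andP; split.
    by apply: hmin; rewrite mem_filter nt' mem_enum.
  apply: contra ni => /eqP E.
  have [k [Kk nk ek]] := ht _ (t0 _ nt0); have [k' [Kk' nk' ek']] := ht _ (t0 _ nt').
  apply/eqP/esym; apply: (hu i0 i' (k' / k)); first exact: sf_div.
    by rewrite mulf_neq0 ?invr_eq0.
  have : v (k^-1 * (k * u i0)) = v (k^-1 * (k' * u i')).
    by rewrite !valM in E *; rewrite -ek -ek' E.
  by rewrite mulKf // mulrA [k^-1 * k']mulrC.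
rewrite (bigD1 i0) //= in s0; move=> /vD_eq; rewrite s0 => /esym e0.
by have := v_neq0 v (mulf_neq0 nt0 (nu i0)); rewrite e0 eqxx.
Qed.

(* The [u i] represent the classes of [vE / vK] and the residues of the [w j]
   form a basis of [Ev] over [Kv]. *)
Record std_gens E e f (u : 'I_e -> L) (w : 'I_f -> L) : Prop := StdGens {
  su_mem : forall i, E (u i);
  su_nz : forall i, u i != 0;
  su_inj : forall i j k, K k -> k != 0 -> v (u i) = v (k * u j) -> i = j;
  su_all : forall y, E y -> y != 0 -> exists i k, [/\ K k, k != 0 & v y = v (k * u i)];
  sw_mem : forall j, E (w j);
  sw_int : forall j, Z0 <= v (w j);
  sw_basis : is_basis (residues K) (residues E) (fun j => res (w j))
}.

Lemma std_gens_rfree E e f u w : @std_gens E e f u w -> rfree w.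
Proof. by case=> _ _ _ _ _ _ [_ h _]. Qed.

Lemma std_gens_lfree E e f u w : @std_gens E e f u w ->
  forall c : 'I_e -> 'I_f -> L, (forall i j, K (c i j)) ->
  \sum_i \sum_j c i j * (u i * w j) = 0 -> forall i j, c i j = 0.
Proof.
move=> h c; apply: lindep; [exact: su_nz h|exact: su_inj h|exact: sw_int h|].
exact: std_gens_rfree h.
Qed.

Lemma lindep_size E n (b : 'I_n -> L) e f (t : 'I_e -> 'I_f -> L) :
  is_basis K E b -> (forall i j, E (t i j)) ->
  (forall c : 'I_e -> 'I_f -> L, (forall i j, K (c i j)) ->
    \sum_i \sum_j c i j * t i j = 0 -> forall i j, c i j = 0) ->
  (e * f <= n)%N /\ (e * f = n -> forall x, E x ->
    exists2 c : 'I_e -> 'I_f -> L, (forall i j, K (c i j)) &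
      x = \sum_i \sum_j c i j * t i j).
Proof.
move=> hb Et ft.
have [t' ht] := mxvec_family t.
have [|c Kc|h1 h2] := family_size hK hb (t := t').
- by move=> k; case/mxvec_indexP: k => i j; rewrite ht.
- rewrite sum_mxvec_index => s0 k; case/mxvec_indexP: k => i j.
  apply: (ft (fun i j => c (mxvec_index i j))) => //; rewrite -[RHS]s0.
  by apply: eq_bigr => i' _; apply: eq_bigr => j' _; rewrite ht.
split=> // efn x Ex; have [c Kc ->] := h2 efn x Ex.
exists (fun i j => c (mxvec_index i j)) => //; rewrite sum_mxvec_index.
by apply: eq_bigr => i' _; apply: eq_bigr => j' _; rewrite ht.
Qed.

Local Notation vg F := (value_group v F).
Definition coset E (x : G) : set G := [set x + h | h in vg E].

Lemma v_Some x : x != 0 -> exists g, v x = Some g.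
Proof.
move=> nz; case E: (v x) => [g|]; first by exists g.
by move/valoo: E => E; rewrite E eqxx in nz.
Qed.

Lemma v_Some_neq0 x g : v x = Some g -> x != 0.
Proof. by move=> e; apply/eqP => x0; move: e; rewrite x0 val0. Qed.

Lemma coset_eq x y g h : v x = Some g -> v y = Some h ->
  coset K g = coset K h <-> exists k, [/\ K k, k != 0 & v x = v (k * y)].
Proof.
move=> ex ey; split=> [e|[k [Kk nk e]]].
  have : coset K g g by exists 0; [exists 1; [exact: sf1|rewrite val1]|rewrite addr0].
  rewrite e => -[l [k Kk ek] el]; exists k; split=> //; first exact: v_Some_neq0 ek.
  by rewrite ex valM ek ey -el [in RHS]addrC.
have [l el] := v_Some nk.
have gE : g = l + h by apply: Some_inj; rewrite -ex e valM el ey.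
apply/seteqP; split=> z [t [k' Kk' ek'] <-].
  exists (l + t); last by rewrite gE addrCA addrA.
  by exists (k * k'); [exact: sfM|rewrite valM el ek'].
exists (t - l); last by rewrite gE addrC addrA subrK addrC.
exists (k' / k); first exact: sf_div.
rewrite valM ek'; have := valV v nk; rewrite el; case E: (v k^-1) => [r|] //= [] rl.
by congr Some; congr (_ + _); apply: (addrI l); rewrite rl subrr.
Qed.

(** [s0] prescribes the first residues of the basis. It is empty except in the proof that residue
    extensions are separable, where it consists of the powers of one residue. *)
Lemma std_gens_ex E n (b : 'I_n -> L) (s0 : seq (resfield v)) : subfield E -> K `<=` E ->
  is_basis K E b -> lfree (residues K) s0 -> (forall r, r \in s0 -> residues E r) ->
  exists e f (u : 'I_e -> L) (w : 'I_f -> L),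
  [/\ std_gens E u w, group_index (vg K) (vg E) = e,
      degree (residues K) (residues E) = f, (e * f <= n)%N &
      (size s0 <= f)%N /\ forall j : 'I_f, (j < size s0)%N -> res (w j) = s0`_j].
Proof.
move=> hE KE hb fs0 Es0.
have hrK := subfield_residues hK.
have lift (t : seq (resfield v)) : (forall r, r \in t -> residues E r) ->
    exists w : 'I_(size t) -> L, forall j, [/\ E (w j), Z0 <= v (w j) & res (w j) = t`_j].
  move=> Et; have /choice[w hw] : forall j : 'I_(size t), exists x,
      [/\ E x, Z0 <= v x & res x = t`_j].
    by move=> j; have [x [? ?] ?] := Et _ (mem_nth 0 (ltn_ord j)); exists x.
  by exists w.
have bnd (t : seq (resfield v)) : lfree (residues K) t ->
    (forall r, r \in t -> residues E r) -> (size t <= n)%N.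
  move=> ft Et; have [w hw] := lift t Et.
  have [|c Kc s1|h _] := @lindep_size E n b 1 (size t) (fun _ j => 1 * w j) hb.
  - by move=> _ j; rewrite mul1r; case: (hw j).
  - apply: (lindep (u := fun=> 1)) Kc s1.
    + by move=> _; exact: oner_neq0.
    + by move=> i j *; rewrite !ord1.
    + by move=> j; case: (hw j).
    + move=> d hd sd j; pose d' l := oapp d 0 (insub l).
      have Ed (l : 'I_(size t)) : d' l = d l by rewrite /d' valK.
      rewrite -Ed; apply: ft => //.
        by move=> l; rewrite /d'; case: insubP => //= _; exact: sf0.
      rewrite -[RHS]sd; apply: eq_bigr => l _; rewrite Ed.
      by case: (hw l) => _ _ ->.
  by rewrite mul1n in h.
have [t [ft Et st]] := lfree_complete hrK bnd fs0 Es0.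
set s1 := s0 ++ t in ft Et st.
have [w hw] := lift s1 Et.
have bw : is_basis (residues K) (residues E) (fun j => res (w j)).
  have -> : (fun j => res (w j)) = (fun j => s1`_j) by apply: funext => j; case: (hw j).
  exact: basis_of_lfree.
pose C := [set coset K g | g in vg E].
have fw : rfree w by case: bw.
have uP (s : seq (set G)) : uniq s -> (forall X, X \in s -> C X) ->
    exists u : 'I_(size s) -> L,
    [/\ forall i, E (u i), forall i, u i != 0,
        forall i j k, K k -> k != 0 -> v (u i) = v (k * u j) -> i = j &
        forall i, exists2 g, v (u i) = Some g & nth set0 s i = coset K g].
  move=> us Cs; have /choice[u hu] : forall i : 'I_(size s), exists x,
      E x /\ exists2 g, v x = Some g & nth set0 s i = coset K g.
    move=> i; have [g [x Ex ex] e] := Cs _ (mem_nth set0 (ltn_ord i)).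
    exists x; split=> //; by exists g.
  exists u; split.
  - by move=> i; case: (hu i).
  - by move=> i; have [_ [g e _]] := hu i; exact: v_Some_neq0 e.
  - move=> i j k Kk nk e; have [_ [g eg sg]] := hu i; have [_ [h eh sh]] := hu j.
    have : coset K g = coset K h by apply/(coset_eq eg eh); exists k.
    by rewrite -sg -sh => /eqP; rewrite nth_uniq // => /eqP/val_inj.
  - by move=> i; case: (hu i).
have bndC (s : seq (set G)) : uniq s -> (forall X, X \in s -> C X) ->
    (size s * size s1 <= n)%N.
  move=> us Cs; have [u [Eu nu iu _]] := uP s us Cs.
  have [|c Kc s2|h _] := lindep_size hb (t := fun i j => u i * w j); last exact: h.
    by move=> i j; apply: sfM => //; case: (hw j).
  by apply: (lindep nu iu _ fw Kc s2) => j; case: (hw j).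
have f0 : (0 < size s1)%N.
  rewrite lt0n; apply/negP => /eqP e0.
  have [] := st 1; first by apply: sf1; exact: subfield_residues.
  move=> c _; rewrite big1 => [/eqP|i]; first by rewrite oner_eq0.
  by exfalso; have := leq_ltn_trans (leq0n i) (ltn_ord i); rewrite e0.
(* [group_index] is [0] when the quotient is infinite. More than [n] cosets would give more than [n]
   independent elements, the residue basis being nonempty by [f0]. *)
have finC : finite_set C.
  apply: contrapT => /(infinite_set_fset n.+1)[B BC sB].
  have := bndC (enum_fset B) (fset_uniq B) BC.
  rewrite leqNgt; apply/negP/negPn/(leq_trans sB).
  by rewrite -[X in (X <= _)%N]muln1 leq_mul2l f0 orbT.
have [s [us ms es]] := enum_fset_set finC.
have [u [Eu nu iu gu]] := uP s us (fun X => proj1 (ms X)).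
exists (size s), (size s1), u, w; split.
- split=> //; [|by move=> j; case: (hw j)|by move=> j; case: (hw j)].
  move=> y Ey nzy; have [g ey] := v_Some nzy.
  have : C (coset K g) by exists g => //; exists y.
  move=> /ms/(nthP set0)[i lt e]; have [h eh sh] := gu (Ordinal lt).
  have [k [Kk nk ek]] : exists k, [/\ K k, k != 0 & v y = v (k * u (Ordinal lt))].
    by apply/(coset_eq ey eh); rewrite -sh -e.
  by exists (Ordinal lt), k.
- by [].
- by apply: degree_basis bw.
- by apply: bndC => // X /ms.
- split; first by rewrite size_cat leq_addr.
  by move=> j lt; case: (hw j) => _ _ ->; rewrite nth_cat lt.
Qed.

Section Gens.
Variables (E : set L) (hE : subfield E) (e f : nat) (u : 'I_e -> L) (w : 'I_f -> L).
Hypotheses (KE : K `<=` E) (h : std_gens E u w).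

(* Multiplication by [x] permutes the classes of [vE / vK]. *)
Lemma std_gens_index x : E x -> x != 0 ->
  exists k, [/\ K k, k != 0 & v (x ^+ e) = v k].
Proof.
move=> Ex nx; have /choice[fk hfk] : forall i, exists jk : 'I_e * L,
    [/\ K jk.2, jk.2 != 0 & v (x * u i) = v (jk.2 * u jk.1)].
  move=> i; have [|j [k [? ? ?]]] := su_all h (sfM hE Ex (su_mem h i)).
    by rewrite mulf_neq0 // (su_nz h).
  by exists (j, k).
have fi : injective (fun i => (fk i).1).
  move=> i j ij; have [Ki ni ei] := hfk i; have [Kj nj ej] := hfk j.
  apply: (su_inj h (k := (fk i).2 / (fk j).2)); first exact: sf_div.
    by rewrite mulf_neq0 ?invr_eq0.
  apply: (v_mulI nx); rewrite ei.
  have -> : v (x * ((fk i).2 / (fk j).2 * u j)) = v ((fk i).2 * u (fk i).1).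
    have -> : x * ((fk i).2 / (fk j).2 * u j) = (fk i).2 / (fk j).2 * (x * u j) by ring.
    by rewrite valM ej -ij -valM mulrA divfK.
  by [].
exists (\prod_i (fk i).2); split.
- by apply: (sf_prod hK) => i _; case: (hfk i).
- by apply/prodf_neq0 => i _; case: (hfk i).
have nU : \prod_i u i != 0 by apply/prodf_neq0 => i _; exact: (su_nz h).
have E1 : v (\prod_i u i * x ^+ e) = v (\prod_i u i * \prod_i (fk i).2).
  have -> : \prod_i u i * x ^+ e = \prod_i (x * u i).
    by rewrite big_split /= prodr_const card_ord mulrC.
  rewrite (@vprod_eq _ _ v _ _ _ (fun i => (fk i).2 * u (fk i).1)); last first.
    by move=> i; case: (hfk i).
  by rewrite big_split /= [in RHS](reindex_inj fi) /= mulrC.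
exact: (v_mulI nU).
Qed.

(** [k * u i] has the value of [y], and the residue of the quotient is expanded in the basis given
    by the [w j]. The leading term of [y] is thus described by elements of [K]. *)
Lemma std_gens_lead y : E y -> y != 0 -> exists i k (c : 'I_f -> L),
  [/\ K k, k != 0, forall j, K (c j) /\ Z0 <= v (c j), v y = v (k * u i) &
      v y < v (y - k * u i * \sum_j c j * w j)].
Proof.
move=> Ey nzy; have [i [k [Kk nk ey]]] := su_all h Ey nzy.
have nku : k * u i != 0 by rewrite mulf_neq0 // (su_nz h).
have vt : v (y / (k * u i)) = 0 by apply/(veq_div _ _ nku).
have Et : residues E (res (y / (k * u i))).
  exists (y / (k * u i)) => //; split; last by rewrite vt.
  by apply: (sf_div hE) => //; apply: (sfM hE); [exact: KE|exact: (su_mem h)].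
have [_ _ sp] := sw_basis h; have [c0 hc0 e0] := sp _ Et.
have /choice[c hc] : forall j, exists x, [/\ K x, Z0 <= v x & res x = c0 j].
  by move=> j; have [x [? ?] ?] := hc0 j; exists x.
have ic j : Z0 <= v (c j * w j).
  by apply: vM_ge0; [case: (hc j)|exact: sw_int h j].
exists i, k, c; split=> //; first by move=> j; case: (hc j).
have : Z0 < v (y / (k * u i) - \sum_j c j * w j).
  apply/res_eq; [by rewrite vt|exact: vsum_ge0|].
  rewrite e0 res_sum //; apply: eq_bigr => j _; have [_ ij <-] := hc j.
  by rewrite residueM // (sw_int h).
rewrite -(val1 v) -(vlt_mul2l v _ _ nku) mulr1 -ey mulrBr mulrA.
by rewrite [k * u i * y]mulrC mulfK.
Qed.

End Gens.
End StandardGenerators.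

Lemma mxvec_index_inj e f (i i' : 'I_e) (j j' : 'I_f) :
  (mxvec_index i j == mxvec_index i' j') = (i == i') && (j == j').
Proof.
have [g gK _] := curry_mxvec_bij e f.
apply/eqP/andP => [h|[/eqP -> /eqP -> //]].
have e1 : g (mxvec_index i j) = (i, j) by exact: (gK (i, j)).
have e2 : g (mxvec_index i' j') = (i', j') by exact: (gK (i', j')).
by move: e1; rewrite h e2 => -[-> ->].
Qed.

(** * The character matrix of an extension inside [K^r] *)

Section TameOfRamification.
Variables (L : closedFieldType) (G : orderedZmodType) (v : valuation L G).
Variables (K : set L) (hK : subfield K) (algK : algebraic_ext K setT).
Hypothesis hens : henselian v K.
Local Notation aut := {rmorphism L -> L}.
Local Notation Z0 := (0 : withoo G).
Local Notation res := (residue v).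
Local Notation vgal := (v_gal hK algK hens).
Local Notation aid := (aut_id L).
Local Notation Kr := (ramif_field v K).
Let ax x : algebraic_over K x := algx algK x.

Lemma res_root n (r : resfield v) : (0 < n)%N -> exists t, t ^+ n = r.
Proof.
move=> n0; have [x hx <-] := residue_surj r.
have [y hy] := @solve_monicpoly L n (fun i => if i == 0%N then x else 0) n0.
have e : y ^+ n = x.
  case: n n0 hy => // n _ ->; rewrite big_ord_recl /= expr0 mulr1 big1 ?addr0 // => i _.
  by rewrite mul0r.
exists (res y); rewrite -resX ?e //; apply: (vX_ge0P n0); by rewrite e.
Qed.

Lemma v_gal_int s x : is_gal K s -> Z0 <= v x -> Z0 <= v (s x).
Proof. by move=> gs; rewrite vgal. Qed.

Lemma res_gal s x y : is_gal K s -> Z0 <= v x -> Z0 <= v y -> res x = res y ->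
  res (s x) = res (s y).
Proof.
move=> gs hx hy /(res_eq hx hy) h; apply/res_eq; rewrite ?vgal //.
by rewrite -rmorphB vgal.
Qed.

Section Simple.
Variables (b : L) (bK : Kr b) (d : nat) (tau : 'I_d -> aut).
Hypotheses (gtau : forall j, is_gal K (tau j))
  (tinj : forall i j, tau i b = tau j b -> i = j)
  (tsurj : forall t, is_gal K t -> exists j, t b = tau j b).
Let E := adjoin K [set b].
Let hE : subfield E := @subfield_adjoin _ K [set b].
Let KE : K `<=` E := @adjoin_base _ K [set b].

Lemma conj_family_deg : deg K b = d.
Proof.
have sb := Kr_sep_over hK algK bK.
rewrite (@sep_deg L K hK algK b [seq tau j b | j <- enum 'I_d] sb).
- by rewrite size_map size_enum_ord.
- by rewrite map_inj_uniq ?enum_uniq // => i j /tinj.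
- move=> y; split=> [/mapP[j _ ->]|[s /tsurj[j e] <-]]; first by exists (tau j).
  by rewrite e; apply: map_f; rewrite mem_enum.
Qed.

(** Otherwise the inverse of [tau i] composed with [tau j] would be [~ id] on [E], and so would fix
    the element [b] of [Kr]. *)
Lemma tau_neq_lead i j : i != j -> ~ eq_lead v E (tau i) (tau j).
Proof.
move=> nij h; case/eqP: nij; apply: tinj.
have [t [gt ts st]] := gal_inv (gtau i).
have {}h : eq_lead v E aid (aut_comp t (tau j)).
  apply: (@eq_lead_ext _ _ v _ (aut_comp t (tau i)) _ (aut_comp t (tau j))) => [y _|//|].
    exact: ts.
  exact: (eq_lead_mull hK algK hens gt).
have /= e := ramif_fixed hK algK hens bK (gal_comp gt (gtau j)) (eq_lead_sym h).
by rewrite -[in LHS]e st.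
Qed.

Variables (e f : nat) (u : 'I_e -> L) (w : 'I_f -> L).
Hypothesis std : std_gens v K E u w.

(* The matrix of the characters [tau k] on leading terms, each [u i * w j] being
   divided by [u i] to land in the residue field. *)
Definition char_entry k i j : resfield v := res (tau k (u i * w j) / u i).

Lemma char_entry_int k i j : Z0 <= v (tau k (u i * w j) / u i).
Proof.
have nu := su_nz std i; rewrite -vle_div // vgal //.
by rewrite -[X in v X <= _]mulr1 vle_mul2l // val1 (sw_int std).
Qed.

Lemma char_entryE k i j : char_entry k i j = res (tau k (u i) / u i) * res (tau k (w j)).
Proof.
have nu := su_nz std i; rewrite -residueM; first by rewrite /char_entry rmorphM mulrAC.
  by rewrite -vle_div // vgal.
by rewrite vgal // (sw_int std).
Qed.

(** By [std_gens_lead] the leading term of any [y] in [E] is a [K]-combination of the [u i * w j]. A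
    relation between the rows therefore lifts to a combination of the [tau k] that raises the value
    of every nonzero [y], against Dedekind's argument for the pairwise inequivalent [tau k]. *)
Lemma char_rows_free (z : 'I_d -> resfield v) :
  (forall i j, \sum_k z k * char_entry k i j = 0) -> forall k, z k = 0.
Proof.
move=> hz k0; apply/eqP/negPn/negP => nz0.
(* The relation is normalised at [k0], where the lift must be exactly [1]: Dedekind's argument puts
   coefficient [1] on the distinguished character. *)
have /choice[Z hZ] : forall k, exists x, [/\ Z0 <= v x, res x = z k / z k0 & k = k0 -> x = 1].
  move=> k; have [->|nk] := eqVneq k k0.
    by exists 1; rewrite val1 res1 divff.
  have [x ? ?] := residue_surj (z k / z k0); exists x; split=> // kk.
  by rewrite kk eqxx in nk.
have iZ k : Z0 <= v (Z k) by case: (hZ k).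
have Z1 : Z k0 = 1 by have [_ _ ->] := hZ k0.
have [|y [Ey nzy ley]] :=
    @dedekind_fin _ _ _ _ hK algK hens E (tau k0) _ (predC1 k0) Z tau hE (gtau k0).
  move=> k; rewrite inE => nk; split=> //; apply: tau_neq_lead; by rewrite eq_sym.
have {}ley : v (\sum_k Z k * tau k y) <= v y by rewrite (bigD1 k0) //= Z1 mul1r.
move: ley; rewrite leNgt => /negP; apply.
have [i [a [c [Ka na hc ey ly]]]] := std_gens_lead hE KE std Ey nzy.
set r := y - _ in ly.
have -> : \sum_k Z k * tau k y = \sum_k Z k * tau k r +
    a * u i * \sum_j c j * \sum_k Z k * (tau k (u i * w j) / u i).
  transitivity (\sum_k (Z k * tau k r +
      \sum_j a * u i * (c j * (Z k * (tau k (u i * w j) / u i))))).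
    apply: eq_bigr => k _.
    have -> : y = r + a * u i * \sum_j c j * w j by rewrite subrK.
    rewrite rmorphD mulrDr; congr (_ + _).
    rewrite -mulrA rmorphM (proj2 (gtau k) _ Ka) rmorphM rmorph_sum.
    rewrite !mulr_sumr; apply: eq_bigr => j _.
    rewrite !rmorphM (proj2 (gtau k) _ (proj1 (hc j))).
    by have nu := su_nz std i; field.
  rewrite big_split /=; congr (_ + _); rewrite exchange_big mulr_sumr /=.
  by apply: eq_bigr => j _; rewrite !mulr_sumr.
apply: vD_lt.
  apply: vsum_lt => // k _; apply: lt_le_trans ly _.
  rewrite -[in X in X <= _](vgal r (gtau k)) -[X in v X <= _]mul1r.
  by apply: vM_le; rewrite ?val1.
rewrite ey -[a * u i in X in X < _]mulr1 vlt_mul2l; last first.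
  by rewrite mulf_neq0 // (su_nz std).
apply: vsum_lt => [|j _]; first exact: oner_neq0.
set S := \sum_k _; have S0 : v 1 < v S.
  rewrite val1 -residue_eq0; last first.
    by apply: vsum_ge0 => k _; apply: vM_ge0 => //; exact: char_entry_int.
  rewrite res_sum; last by move=> k _; apply: vM_ge0 => //; exact: char_entry_int.
  apply/eqP; transitivity ((z k0)^-1 * \sum_k z k * char_entry k i j); last first.
    by rewrite hz mulr0.
  rewrite mulr_sumr; apply: eq_bigr => k _; rewrite residueM ?char_entry_int //.
  by have [_ -> _] := hZ k; rewrite mulrA [_ * z k]mulrC.
rewrite mulrC -[X in v X < _]mulr1; apply: vM_lt => //; first exact: oner_neq0.
by rewrite val1; case: (hc j).
Qed.

Lemma char_matrix : exists B : 'M[resfield v]_(d, e * f),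
  row_free B /\ forall k i j, B k (mxvec_index i j) = char_entry k i j.
Proof.
have /choice[t ht] : forall k, exists t' : 'I_(e * f) -> resfield v,
    forall i j, t' (mxvec_index i j) = char_entry k i j.
  by move=> k; exact: mxvec_family.
exists (\matrix_(k, l) t k l); split; last by move=> k i j; rewrite mxE.
apply: inj_row_free => z hz; apply/rowP => k; rewrite [RHS]mxE.
apply: (char_rows_free (z := fun k => z 0 k)) => i j.
have E0 := congr1 (fun M : 'rV_(e * f) => M 0 (mxvec_index i j)) hz.
rewrite mxE [RHS]mxE in E0; apply: etrans E0; apply: eq_bigr => k' _.
by rewrite [X in _ = _ * X]mxE ht.
Qed.

Lemma degree_le_ef : (d <= e * f)%N.
Proof.
by have [B [/eqP fB _]] := char_matrix; have := rank_leq_col B; rewrite fB.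
Qed.

(** Independence of the rows of the character matrix gives one inequality, the fundamental
    inequality the other. The matrix is therefore square and invertible. *)
Lemma degree_ef : d = (e * f)%N.
Proof.
apply/eqP; rewrite eqn_leq degree_le_ef /=.
have [] := lindep_size hK (basis_adjoin1 hK (ax b)) (t := fun i j => u i * w j).
- by move=> i j; apply: (sfM hE); [exact: (su_mem std)|exact: (sw_mem std)].
- exact: (std_gens_lfree hK std).
by move=> + _; rewrite -degE // conj_family_deg.
Qed.

Lemma char_cols_inv : exists (B : 'M[resfield v]_(d, e * f)) (C : 'M_(e * f, d)),
  [/\ B *m C = 1%:M, C *m B = 1%:M & forall k i j, B k (mxvec_index i j) = char_entry k i j].
Proof.
have [B [fB hB]] := char_matrix.
have [C hC] := row_freeP fB.
have : row_full B by rewrite /row_full (eqP fB) degree_ef.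
move=> /row_fullP[C' hC'].
exists B, C; split=> //.
by rewrite -[C]mul1mx -hC' -mulmxA hC mulmx1.
Qed.

Lemma char_cols_free (c : 'I_e -> 'I_f -> resfield v) :
  (forall k, \sum_i \sum_j char_entry k i j * c i j = 0) -> forall i j, c i j = 0.
Proof.
move=> hc i j; have [B [C [_ CB hB]]] := char_cols_inv.
have [c' hc'] := mxvec_family c.
have h0 : B *m (\col_l c' l) = 0.
  apply/colP => k; rewrite [RHS]mxE -[RHS](hc k) mxE sum_mxvec_index.
  by apply: eq_bigr => i' _; apply: eq_bigr => j' _; rewrite hB mxE hc'.
have := congr1 (mulmx C) h0; rewrite mulmxA CB mul1mx mulmx0.
by move=> /(congr1 (fun M : 'cV_(e * f) => M (mxvec_index i j) 0)); rewrite !mxE hc'.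
Qed.

(** The character matrix [B] conjugates the diagonal matrix of the [res (tau k y)] into [e] equal
    blocks, each given by the matrix [al] of multiplication by the residue of [y] on [Ev]. The trace
    is thus [e] times that of [al]. *)
Lemma char_trace y : E y -> Z0 <= v y -> e%:R = 0 :> resfield v ->
  \sum_k res (tau k y) = 0.
Proof.
move=> Ey iy e0; have [B [C [BC CB hB]]] := char_cols_inv.
have [_ _ sp] := sw_basis std.
have /choice[al hal] : forall j, exists c : 'I_f -> L,
    (forall l, K (c l) /\ Z0 <= v (c l)) /\ res (y * w j) = \sum_l res (c l) * res (w l).
  move=> j; have [|c hc ec] := sp (res (y * w j)).
    exists (y * w j) => //; split; first by apply: (sfM hE) => //; exact: (sw_mem std).
    by apply: vM_ge0 => //; exact: (sw_int std).
  have /choice[c0 hc0] : forall l, exists x, [/\ K x, Z0 <= v x & res x = c l].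
    by move=> l; have [x [? ?] ?] := hc l; exists x.
  exists c0; split; first by move=> l; case: (hc0 l).
  by rewrite ec; apply: eq_bigr => l _; have [_ _ ->] := hc0 l.
have iw j := sw_int std j.
have rel k i j : res (tau k y) * char_entry k i j =
    \sum_l res (al j l) * char_entry k i l.
  rewrite char_entryE mulrCA -residueM ?v_gal_int // -(rmorphM (tau k)).
  have [ha ea] := hal j.
  rewrite (@res_gal _ _ (\sum_l al j l * w l) (gtau k)).
  - rewrite rmorph_sum res_sum; last first.
      by move=> l _; apply: v_gal_int => //; apply: vM_ge0 => //; case: (ha l).
    rewrite mulr_sumr; apply: eq_bigr => l _.
    rewrite rmorphM (proj2 (gtau k) _ (proj1 (ha l))) residueM ?v_gal_int //.
      by rewrite char_entryE mulrCA.
    by case: (ha l).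
  - exact: vM_ge0.
  - by apply: vsum_ge0 => l _; apply: vM_ge0 => //; case: (ha l).
  - rewrite ea res_sum; last by move=> l _; apply: vM_ge0 => //; case: (ha l).
    by apply: eq_bigr => l _; rewrite residueM //; case: (ha l).
have one k : \sum_i \sum_j char_entry k i j * C (mxvec_index i j) k = 1.
  have E0 := congr1 (fun M : 'M_d => M k k) BC; rewrite !mxE eqxx in E0.
  apply: etrans E0; rewrite [RHS]sum_mxvec_index; apply: eq_bigr => i _; apply: eq_bigr => j _.
  by rewrite hB.
have kron i j l : \sum_k char_entry k i l * C (mxvec_index i j) k = (j == l)%:R.
  have E0 := congr1 (fun M : 'M_(e * f) => M (mxvec_index i j) (mxvec_index i l)) CB.
  rewrite !mxE mxvec_index_inj eqxx /= in E0; apply: etrans E0.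
  by apply: eq_bigr => k _; rewrite hB mulrC.
transitivity (\sum_(i < e) \sum_j res (al j j)); last first.
  by rewrite sumr_const card_ord -mulr_natl e0 mul0r.
transitivity (\sum_k \sum_i \sum_j (res (tau k y) * char_entry k i j) * C (mxvec_index i j) k).
  apply: eq_bigr => k _; rewrite -[LHS]mulr1 -(one k) mulr_sumr; apply: eq_bigr => i _.
  by rewrite mulr_sumr; apply: eq_bigr => j _; rewrite mulrA.
rewrite exchange_big /=; apply: eq_bigr => i _.
rewrite exchange_big /=; apply: eq_bigr => j _.
transitivity (\sum_l res (al j l) * \sum_k char_entry k i l * C (mxvec_index i j) k).
  under eq_bigr => k _ do rewrite rel mulr_suml.
  rewrite exchange_big /=; apply: eq_bigr => l _; rewrite mulr_sumr.
  by apply: eq_bigr => k _; rewrite mulrA.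
under eq_bigr => l _ do rewrite kron.
rewrite (bigD1 j) //= eqxx mulr1 big1 ?addr0 // => l nl.
by rewrite eq_sym (negPf nl) mulr0.
Qed.

End Simple.
End TameOfRamification.

(** * Simple extensions inside [K^r] are tame *)

Section KrTame.
Variables (L : closedFieldType) (G : orderedZmodType) (v : valuation L G).
Variables (K : set L) (hK : subfield K) (algK : algebraic_ext K setT).
Hypothesis hens : henselian v K.
Local Notation Z0 := (0 : withoo G).
Local Notation res := (residue v).
Local Notation residues F := (@residues L G v F).
Local Notation vg F := (value_group v F).
Local Notation vgal := (v_gal hK algK hens).
Local Notation Kr := (ramif_field v K).
Local Notation p := (residue_char_exp v).
Let ax x : algebraic_over K x := algx algK x.
Let hrK : subfield (residues K) := subfield_residues v hK.

(** If [p] were a prime dividing [e], the trace of every integral element of [E] would have residue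
    [0] by [char_trace]. Dedekind's argument, however, gives [y] whose trace [T] has value [v y],
    and then [y / T] has trace [1]. *)
Lemma Kr_defect_coprime b : Kr b ->
  coprime (group_index (vg K) (vg (adjoin K [set b]))) p /\
  is_defect v K (adjoin K [set b]) 1.
Proof.
move=> bK; set E := adjoin K [set b].
have hE : subfield E := @subfield_adjoin _ K [set b].
have KE : K `<=` E := @adjoin_base _ K [set b].
have [d [tau [gtau tinj tsurj]]] := conj_family hK algK b (H := is_gal K) (fun s h => h).
have f0 : lfree (residues K) [::] by move=> c _ _ [].
have [e [f [u [w [std Ee Ef _ _]]]]] :=
  std_gens_ex hK hE KE (basis_adjoin1 hK (ax b)) f0 (fun r h => match notF h with end).
split; last first.
  rewrite /is_defect muln1 Ef Ee -(degree_ef hK algK hens bK gtau tinj tsurj std).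
  exact: (conj_family_deg hK algK bK gtau tinj tsurj).
rewrite Ee /residue_char_exp /char_exp; case: xgetP => [q _ qc|_]; last exact: coprimen1.
rewrite coprime_sym prime_coprime ?(pcharf_prime qc) //; apply/negP.
rewrite (dvdn_pcharf qc) => /eqP e0.
have [k0 ek0] := tsurj _ (gal_id K).
have [|y [Ey nzy ley]] :=
    @dedekind_fin _ _ _ _ hK algK hens E (tau k0) _ (predC1 k0) (fun=> 1) tau hE (gtau k0).
  move=> k; rewrite inE => nk; split=> //; first by rewrite val1.
  by apply: (tau_neq_lead hK algK hens bK gtau tinj); rewrite eq_sym.
pose T := \sum_k tau k y.
have {}ley : v T <= v y.
  by move: ley; rewrite /T [in X in _ -> X](bigD1 k0) //=; under eq_bigr do rewrite mul1r.
have vT : v T = v y.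
  by apply/le_anti; rewrite ley /=; apply: vsum_le => k _; rewrite vgal.
have nT : T != 0.
  by apply: contraTneq ley => ->; rewrite -ltNge v_lt0.
have gT s : is_gal K s -> s T = T.
  move=> gs; have [g gi hg] := conj_family_perm (@gal_comp L K) gtau tinj tsurj gs.
  rewrite rmorph_sum [RHS](reindex_inj gi) /=; apply: eq_bigr => k _.
  exact: (gal_adjoin1 (s := aut_comp s (tau k)) hK (ax b)
    (gal_comp gs (gtau k)) (gtau _) (hg k) Ey).
have KT : K T.
  apply: (fixed_sep_mem hK algK hK) => //.
  apply: (sf_sum (subfield_sep_over hK algK)) => k _; apply: sep_over_gal => //.
  exact: (sep_over_adjoin hK algK (Kr_sep_over hK algK bK)).
have v1 : v (y / T) = 0 by apply/(veq_div _ _ nT).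
have := char_trace hK algK hens bK gtau tinj tsurj std (y := y / T) _ _ e0.
rewrite v1 => /(_ (sf_div hE Ey (KE _ KT)) (lexx _)).
rewrite -res_sum; last by move=> k _; rewrite vgal // v1.
under eq_bigr => k _ do rewrite fmorph_div gT //.
by rewrite -mulr_suml divff // res1 => /eqP; rewrite oner_eq0.
Qed.

(** If [rx] were inseparable, the values of its minimal polynomial [q] would be the [pp]-th powers
    of those of a polynomial [h] of smaller degree, and the residues of all [tau k x] would be roots
    of [h]. As the powers of [rx] below the degree of [q] belong to a basis of the residue
    extension, this is a relation between columns of the character matrix and forces [h = 0]. *)
Lemma Kr_residues_sep b : Kr b ->
  separable_ext (residues K) (residues (adjoin K [set b])).
Proof.
move=> bK; set E := adjoin K [set b].
have hE : subfield E := @subfield_adjoin _ K [set b].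
have KE : K `<=` E := @adjoin_base _ K [set b].
have [d [tau [gtau tinj tsurj]]] := conj_family hK algK b (H := is_gal K) (fun s h => h).
move=> rx [x [Ex ix] ex].
have f0 : lfree (residues K) [::] by move=> c _ _ [].
have arx : algebraic_over (residues K) rx.
  have [e [f [u [w [std _ _ _ _]]]]] :=
    std_gens_ex hK hE KE (basis_adjoin1 hK (ax b)) f0 (fun r h => match notF h with end).
  apply: (finite_ext_algebraic hrK (subfield_residues v hE)); last by exists x.
  by exists f, (fun j => res (w j)); exact: (sw_basis std).
exists (min_poly (residues K) rx); first exact: min_polyP.
apply: contrapT => nsep; have d0 := min_poly_deriv0 hrK arx nsep.
have N0 := min_poly_deriv0_deg hrK arx d0.
set q := min_poly _ rx in nsep d0 N0; set N := (size q).-1 in N0.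
have sq : size q = N.+1 by rewrite prednK // (ltn_trans _ (min_poly_size hrK arx)).
have Ngt : (0 < N)%N by have := min_poly_size hrK arx; rewrite -/q sq.
have [pp pc] : exists pp, pp \in [pchar (resfield v)].
  by apply: (natf0_pchar Ngt); exact/eqP.
have ppP := pcharf_prime pc.
have pgt1 := prime_gt1 ppP; have pgt0 := prime_gt0 ppP.
have /(dvdnP) [M EM] : (pp %| N)%N by rewrite (dvdn_pcharf pc) N0.
have MN : (M < N)%N.
  by rewrite EM -[X in (X < _)%N]muln1 ltn_pmul2l //; move: Ngt; rewrite EM muln_gt0 => /andP[].
have [e [f [u [w [std _ _ _ [sf ew]]]]]] :=
  std_gens_ex hK hE KE (basis_adjoin1 hK (ax b)) (lfree_powers hrK arx) (fun r h =>
    powers_sub (subfield_residues v hE) (ex_intro2 _ _ x (conj Ex ix) ex) h).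
rewrite size_mkseq -/q -/N in sf ew.
have {}ew (j : 'I_f) : (j < N)%N -> res (w j) = res (x ^+ j).
  by move=> lt; rewrite ew // nth_mkseq // resX // ex.
have [i0 _] := su_all std (sf1 hE) (oner_neq0 _).
(* The roots are taken in the residue field of [L] and need not lie in that of [K]; the columns of
   the character matrix are independent over the larger field as well. *)
have /choice[r hr] : forall i, exists t : resfield v, t ^+ pp = q`_(pp * i).
  by move=> i; exact: res_root.
pose h : {poly resfield v} := \poly_(j < N) r j.
have Eq : q = map_poly (pFrobenius_aut pc) h \Po 'X^pp.
  apply/polyP => i; rewrite coef_comp_poly_Xn //; case: ifP => [/dvdnP[m Em]|nd].
    rewrite Em mulnK // coef_map coef_poly /=; case: ltnP => [_|ge].
      by rewrite pFrobenius_autE hr mulnC.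
    rewrite pFrobenius_aut0 nth_default // sq.
    by apply: leq_trans (_ : (N * pp <= _)%N); rewrite ?leq_mul2r ?ge ?orbT // ltn_Pmulr.
  have := congr1 (fun t : {poly resfield v} => t`_i.-1) d0.
  have i_gt : (0 < i)%N by case: i nd => //; rewrite dvdn0.
  rewrite coef_deriv coef0 prednK // -mulr_natr => /eqP.
  by rewrite mulf_eq0 -(dvdn_pcharf pc) nd orbF => /eqP.
have root_tau k : h.[res (tau k x)] = 0.
  set X := res _; have ga := gtau k.
  have /choice[a ha] : forall i, exists t, [/\ K t, Z0 <= v t & res t = q`_i].
    by move=> i; have [t [? ?] ?] := min_poly_pol hrK arx i; exists t.
  have ia i y : Z0 <= v y -> Z0 <= v (a i * y ^+ i).
    by move=> iy; apply: vM_ge0; [case: (ha i)|exact: vX_ge0].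
  have ev y : Z0 <= v y -> res (\sum_(i < size q) a i * y ^+ i) = q.[res y].
    move=> iy; rewrite horner_coef res_sum => [|i _]; last exact: ia.
    apply: eq_bigr => i _; have [_ iai <-] := ha i.
    by rewrite residueM ?vX_ge0 // resX.
  have q0 : q.[X] = 0.
    rewrite -ev; last exact: (v_gal_int hK algK hens ga ix).
    have -> : \sum_(i < size q) a i * tau k x ^+ i = tau k (\sum_(i < size q) a i * x ^+ i).
      rewrite rmorph_sum; apply: eq_bigr => i _; have [Ka _ _] := ha i.
      by rewrite rmorphM rmorphXn (proj2 ga _ Ka).
    rewrite (@res_gal _ _ _ _ hK algK hens _ _ 0 ga) ?rmorph0 ?res0 ?val0 //.
      by apply: vsum_ge0 => i _; exact: ia.
    by rewrite ev // ex (rootP (min_poly_root hrK arx)).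
  move: q0; rewrite Eq horner_comp hornerXn -(pFrobenius_autE pc) horner_map.
  by move=> /eqP; rewrite fmorph_eq0 => /eqP.
pose c (i : 'I_e) (j : 'I_f) := if (i == i0) && (j < N)%N then r j else 0.
have c0 : forall i j, c i j = 0.
  apply: (char_cols_free hK algK hens bK gtau tinj tsurj std) => k.
  rewrite (bigD1 i0) //= [X in _ + X]big1 ?addr0; last first.
    by move=> i ni; rewrite big1 // => j _; rewrite /c (negPf ni) mulr0.
  transitivity (res (tau k (u i0) / u i0) * h.[res (tau k x)]); last first.
    by rewrite root_tau mulr0.
  rewrite horner_poly mulr_sumr.
  rewrite (big_ord_widen f (fun j => _ * (r j * res (tau k x) ^+ j)) sf) [RHS]big_mkcond /=.
  apply: eq_bigr => j _; rewrite /c eqxx /=; case: ifP => lt; last by rewrite mulr0.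
  rewrite (char_entryE hK algK hens gtau std) -mulrA; congr (_ * _).
  rewrite (@res_gal _ _ _ _ hK algK hens _ _ _ (gtau k) (sw_int std j) (vX_ge0 j ix) (ew j lt)).
  by rewrite rmorphXn resX ?(v_gal_int hK algK hens) // mulrC.
(* [M] is [N] divided by [pp]; the [pp]-th power of the coefficient of [h] at [M] is the leading
   coefficient [1] of [q]. *)
have Mf : (M < f)%N by exact: leq_trans MN sf.
have := hr M; have := c0 i0 (Ordinal Mf); rewrite /c eqxx MN /= => ->.
rewrite expr0n (gtn_eqF pgt0) mulnC -EM => /esym /eqP.
have := min_poly_monic hrK arx; rewrite monicE lead_coefE -/q sq /= => /eqP ->.
by rewrite oner_eq0.
Qed.

Hypothesis v_nontriv : nontrivial_on v K.

(** The powers of an element of nonzero value are distinct. This serves the primitive element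
    theorem, which reduces tameness, a condition on all finite subextensions, to simple ones. *)
Lemma base_infinite (l : seq L) : exists t, K t /\ t \notin l.
Proof.
have [x [Kx nx vx]] := v_nontriv.
have inj i j : x ^+ i = x ^+ j -> (i <= j)%N -> i = j.
  move=> e le; apply/eqP; rewrite eqn_leq le /= leqNgt; apply/negP => lt.
  have e1 : x ^+ (j - i) = 1.
    by apply: (mulIf (expf_neq0 i nx)); rewrite -exprD subnK // mul1r -e.
  by case/eqP: vx; apply: (@vX_eq0 _ _ v x (j - i)); rewrite ?subn_gt0 // e1 val1.
have us : uniq (mkseq (fun i => x ^+ i) (size l).+1).
  apply/mkseq_uniqP => i j _ _ e.
  by case/orP: (leq_total i j) => le; [exact: inj|apply/esym; exact: inj].
apply: contrapT => /forallNP h.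
have := uniq_leq_size us (s2 := l); rewrite size_mkseq ltnn => /(_ _)/notF; apply.
move=> _ /mapP[i _ ->]; apply/negPn/negP => nl; apply: (h (x ^+ i)); split=> //.
exact: sfX.
Qed.

(** [z] is chosen of maximal degree. For [x] in [E], a suitable [z + t * x] generates a field
    containing [z] and [x]; by maximality it is [K(z)]. *)
Lemma primitive_element E n (b : 'I_n -> L) : subfield E -> K `<=` E ->
  E `<=` sep_over K -> is_basis K E b -> exists2 z, E z & E = adjoin K [set z].
Proof.
move=> hE KE Es hb.
have bnd x : E x -> (deg K x <= n)%N.
  move=> Ex; rewrite degE //.
  have := lfree_size hK hb _ (lfree_powers hK (ax x)); rewrite size_mkseq; apply.
  by move=> y; exact: powers_sub.
pose P d := `[< exists2 x, E x & deg K x = d >].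
have exP : exists d, P d by exists (deg K 1); apply/asboolP; exists 1 => //; exact: sf1.
have ubP d : P d -> (d <= n)%N by move=> /asboolP[x Ex <-]; exact: bnd.
case: (ex_maxnP exP ubP) => d /asboolP[z Ez dz] dmax.
exists z => //; apply/seteqP; split; last exact: adjoin1_min.
move=> x Ex.
have [rz [_ mz]] := orbit_list hK algK z (H := is_gal K) (fun s h => h).
have [rx [_ mx]] := orbit_list hK algK x (H := is_gal K) (fun s h => h).
(* The excluded [t] are those for which some automorphism could fix [z + t * x] while moving [x]. *)
have [t [Kt tn]] := base_infinite [seq (z - z') / (x' - x) | z' <- rz, x' <- rx].
pose y := z + t * x.
have Ey : E y by apply: (sfD hE) => //; apply: (sfM hE) => //; exact: KE.
have hKy := @subfield_adjoin _ K [set y].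
have fixx s : is_gal (adjoin K [set y]) s -> s x = x.
  move=> gs; have gsK := gal_sub (@adjoin_base _ K [set y]) gs.
  have sy : s y = y by case: gs => _; apply; exact: adjoin1_id.
  apply/eqP/negPn/negP => nsx; case/negP: tn; apply/allpairsP.
  exists (s z, s x); split=> /=; [by apply/mz; exists s|by apply/mx; exists s|].
  have nz : s x - x != 0 by rewrite subr_eq0.
  apply: (mulIf nz); rewrite divfK //.
  move: sy; rewrite /y rmorphD rmorphM (proj2 gsK _ Kt) => /eqP.
  rewrite -subr_eq0 => /eqP h; apply/eqP; rewrite -subr_eq0 -h; apply/eqP; ring.
have Kyx : adjoin K [set y] x.
  apply: (fixed_sep_mem hK algK hKy (@adjoin_base _ _ _)) => //.
  by apply: sep_over_sub (Es _ Ex); exact: adjoin_base.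
have Kyz : adjoin K [set y] z.
  have -> : z = y - t * x by rewrite /y; ring.
  by apply: (sfB hKy); [exact: adjoin1_id|apply: (sfM hKy) => //; exact: adjoin_base].
have dy : (deg K y <= deg K z)%N by rewrite dz; apply: dmax; apply/asboolP; exists y.
have zy := adjoin_deg_sub hK (ax y) (ax z) Kyz dy.
apply: (adjoin1_min _ _ zy Kyx); first exact: subfield_adjoin.
exact: adjoin_base.
Qed.

Lemma Kr_tame b : Kr b -> tame v K (adjoin K [set b]).
Proof.
move=> bK; split=> [x _ //|E hE KE Eb [n [c hc]]].
have EKr : E `<=` Kr.
  move=> x /Eb; apply: adjoin1_min => //; [exact: subfield_Kr|exact: sub_Kr].
have [z Ez ->] : exists2 z, E z & E = adjoin K [set z].
  by apply: (primitive_element hE KE _ hc) => x /EKr; exact: Kr_sep_over.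
have zK := EKr _ Ez.
by have [? ?] := Kr_defect_coprime zK; split=> //; exact: Kr_residues_sep.
Qed.

End KrTame.

(** * Tame simple extensions lie in [K^r] *)

Section TameKr.
Variables (L : closedFieldType) (G : orderedZmodType) (v : valuation L G).
Variables (K : set L) (hK : subfield K) (algK : algebraic_ext K setT).
Hypothesis hens : henselian v K.
Local Notation aut := {rmorphism L -> L}.
Local Notation Z0 := (0 : withoo G).
Local Notation res := (residue v).
Local Notation residues F := (@residues L G v F).
Local Notation vgal := (v_gal hK algK hens).
Local Notation Kr := (ramif_field v K).
Let ax x : algebraic_over K x := algx algK x.
Let hrK : subfield (residues K) := subfield_residues v hK.

(** The valuation ring is integrally closed: if [v y < 0], division by the top power of [y] writes
    [1] as a sum of elements of positive value. *)
Lemma monic_root_int (g : {poly L}) y : g \is monic -> pint v g -> root g y -> Z0 <= v y.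
Proof.
move=> mg ig /rootP; rewrite horner_coef.
have sg : (0 < size g)%N by rewrite size_poly_gt0 monic_neq0.
rewrite -(prednK sg) big_ord_recr /=; set n := (size g).-1.
have -> : g`_n = 1 by apply/eqP; rewrite -[_ == 1]monicE.
rewrite mul1r => e; rewrite leNgt; apply/negP => lt.
have nz : y != 0 by apply: contraTneq lt => ->; rewrite val0.
have ti : v 1 < v y^-1 by rewrite vlt_div ?oner_neq0 // divr1 -[y^-1]mul1r -vlt_div // val1.
have : v 1 < v (- \sum_(i < n) g`_i * y ^+ i * (y ^+ n)^-1).
  rewrite Defs.valN; apply: vsum_lt => [|i _]; first exact: oner_neq0.
  have -> : g`_i * y ^+ i * (y ^+ n)^-1 = g`_i * y^-1 ^+ (n - i).
    rewrite -mulrA; congr (_ * _); rewrite exprVn.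
    rewrite -{2}(subnK (ltnW (ltn_ord i))) exprD; field.
    by rewrite !expf_neq0.
  rewrite mulrC -[X in v X < _]mulr1; apply: vM_lt; first exact: oner_neq0.
    by rewrite val1; apply: vX_gt0; [rewrite subn_gt0|rewrite -(val1 v)].
  by rewrite val1.
rewrite -mulr_suml -mulNr (_ : - _ = y ^+ n) ?divff ?expf_neq0 ?ltxx //.
by apply/eqP; rewrite eq_sym -addr_eq0 addrC e.
Qed.

(** The roots of a monic lift of [q] to [K] have distinct residues, so the root above [rx] is fixed
    by every automorphism that preserves its residue. Those fixing [E] do so because [rx] is a
    residue of [E], those in [Gr] because they fix leading terms. *)
Lemma lift_res E rx : subfield E -> K `<=` E -> residues E rx ->
  separable_over (residues K) rx -> exists y, [/\ E y, Kr y, Z0 <= v y & res y = rx].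
Proof.
move=> hE KE [x0 [Ex0 ix0] ex0] [q [mq /(polP hrK) hq rq _] sq].
pose n := (size q).-1.
have sqE : size q = n.+1 by rewrite prednK // size_poly_gt0 monic_neq0.
have /choice[a ha] : forall i, exists t, [/\ K t, Z0 <= v t & res t = q`_i].
  by move=> i; have [t [? ?] ?] := hq i; exists t.
pose g := 'X^n + \poly_(i < n) a i.
have cg i : g`_i = if (i < n)%N then a i else (i == n)%:R.
  rewrite coefD coefXn coef_poly; case: ltnP => [lt|_]; last by rewrite addr0.
  by rewrite (ltn_eqF lt) add0r.
have mg : g \is monic.
  rewrite monicE lead_coefE /g size_polyDl ?size_polyXn ?ltnS ?size_poly //=.
  by rewrite -/g cg ltnn eqxx.
have Kg : pol K g.
  by move=> i; rewrite cg; case: ifP => _; [case: (ha i)|exact: sf_nat].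
have ig : pint v g.
  by move=> i; rewrite cg; case: ifP => _; [case: (ha i)|exact: v_nat_ge0].
have rg : rpol v g = q.
  apply/polyP => i; rewrite rpolE cg; case: ltnP => [_|le]; first by case: (ha i).
  rewrite res_nat; move: le; rewrite leq_eqVlt => /orP[/eqP <-|lt].
    by rewrite eqxx; move: mq; rewrite monicE lead_coefE sqE => /eqP ->.
  by rewrite (gtn_eqF lt) nth_default // sqE.
have [r] := closed_field_poly_normal g; rewrite (eqP mg) scale1r => Eg.
have ir y : y \in r -> Z0 <= v y.
  by move=> yr; apply: (monic_root_int mg ig); rewrite Eg root_prod_XsubC.
have [_] := pint_prod ir; rewrite -Eg rg => Eq.
have ur : uniq (map res r) by rewrite -separable_prod_XsubC -Eq.
have : rx \in map res r by rewrite -root_prod_XsubC -Eq.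
move=> /mapP[y yr ey].
have sy : sep_over K y.
  by apply: (sep_of_prod (map_uniq ur) yr); rewrite -Eg.
have fixy s : is_gal K s -> res (s y) = res y -> s y = y.
  move=> gs e; have sr : s y \in r.
    by rewrite -root_prod_XsubC -Eg /root -(gal_horner _ gs Kg) Eg
      (rootP (_ : root _ y)) ?root_prod_XsubC // rmorph0.
  have : index (s y) r = index y r.
    apply/eqP; rewrite -(nth_uniq 0 _ _ ur) ?size_map ?index_mem //.
    by rewrite !(nth_map 0) ?index_mem // !nth_index // e.
  by move=> /(congr1 (nth 0 r)); rewrite !nth_index.
exists y; split=> //; last exact: ir.
  apply: (fixed_sep_mem hK algK hE KE); first exact: sep_over_sub sy.
  move=> s gs; have gsK := gal_sub KE gs; apply: fixy => //.
  rewrite (res_gal hK algK hens gsK (ir _ yr) ix0) -?ey //.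
  by rewrite (proj2 gs _ Ex0) ex0.
apply: (KrP hK algK) => // s hs; have gs := gr_gal hs.
have [->|nz] := eqVneq y 0; first by rewrite rmorph0.
apply: fixy => //; apply/res_eq; rewrite ?vgal ?ir //.
apply: (le_lt_trans (ir _ yr)).
exact: (proj1 (gr_eq_lead v hK algK gs) hs y sy nz).
Qed.

(** Otherwise the powers of [z] below [n] would sum to [0], while the residue of this sum is [n]. *)
Lemma root_of_unity_lift n z : (n%:R : resfield v) != 0 -> v z = 0 -> z ^+ n = 1 ->
  res z = 1 -> z = 1.
Proof.
move=> nz vz zn rz; have iz : Z0 <= v z by rewrite vz.
have : (z - 1) * \sum_(i < n) z ^+ i = 0 by rewrite -subrX1 zn subrr.
move=> /eqP; rewrite mulf_eq0 subr_eq0 => /orP[/eqP //|/eqP s0].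
case/eqP: nz; rewrite -[RHS](res0 v) -s0 res_sum; last by move=> i _; exact: vX_ge0.
under eq_bigr => i _ do rewrite resX // rz expr1n.
by rewrite sumr_const card_ord.
Qed.

Lemma separable_XnsubC n (c : L) : (n%:R : L) != 0 -> c != 0 ->
  separable_poly ('X^n - c%:P).
Proof.
move=> nn nc; rewrite unlock; apply/Bezout_coprimepP.
exists ((n%:R)%:P, - 'X) => /=.
rewrite derivB derivXn derivC subr0.
have n0 : (0 < n)%N by case: n nn => //; rewrite eqxx.
have -> : (n%:R)%:P * ('X^n - c%:P) + - 'X * ('X^(n.-1) *+ n) = (- (n%:R * c))%:P.
  rewrite polyCN polyCM polyC_natr mulrnAr mulNr -exprS prednK // -mulr_natl.
  by ring.
by rewrite polyC_eqp1 oppr_eq0 mulf_neq0.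
Qed.

(** [u ^+ e = t * k] with [t] a unit of [E], whose residue lifts to some [t'] in [E] and [Kr].
    Multiplying [u] by an [e]-th root of [t' / t] of residue [1] gives [z] with [z ^+ e = t' * k].
    An automorphism that fixes [t'] and the leading term of [z] multiplies [z] by an [e]-th root of
    unity of residue [1], that is, by [1]. *)
Lemma lift_val E e u k : subfield E -> K `<=` E ->
  (forall rx, residues E rx -> separable_over (residues K) rx) ->
  (e%:R : resfield v) != 0 -> E u -> u != 0 -> K k -> k != 0 -> v (u ^+ e) = v k ->
  exists z, [/\ E z, Kr z & v z = v u].
Proof.
move=> hE KE sepE ne Eu nu Kk nk ek.
have e0 : (0 < e)%N by case: e ne {ek} => //; rewrite eqxx.
have neL : (e%:R : L) != 0.
  by apply: contraNneq ne => h; rewrite -(res_nat v) h res0.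
pose t := u ^+ e / k.
have vt : v t = 0 by apply/(veq_div _ _ nk).
have nt := v0_neq0 vt.
have Et : E t by apply: (sf_div hE); [exact: sfX|exact: KE].
have rt : residues E (res t) by exists t => //; split=> //; rewrite vt.
have [t' [Et' Kt' it' et']] := lift_res hE KE rt (sepE _ rt).
have vt' : v t' = 0.
  apply/eqP; rewrite eq_sym; move: it'; rewrite le_eqVlt => /orP[//|h].
  have := residue_eq0 (ltW h); rewrite h et' residue_eq0 ?vt ?ltxx //.
have nt' := v0_neq0 vt'.
pose s := t' / t.
have vs : v s = 0 by rewrite Defs.valM vt' vV0 // addr0.
have rs : res s = 1.
  rewrite residueM ?vt' ?vV0 // et' resV // divff //.
  by rewrite residue_eq0 ?vt // ltxx.
pose g := 'X^e - s%:P.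
have mg : g \is monic by rewrite monicE lead_coefDl ?lead_coefXn // size_polyN size_polyXn
  ltnS (leq_trans (size_polyC_leq1 _)).
have ig : pint v g.
  move=> i; rewrite coefB coefXn coefC; apply: valB_ge; first exact: v_nat_ge0.
  by case: ifP => _; rewrite ?vs ?val0.
have rg : rpol v g = 'X^e - 1%:P.
  apply/polyP => i; rewrite rpolE !coefB !coefXn !coefC resB ?v_nat_ge0 //; last first.
    by case: ifP => _; rewrite ?vs ?val0.
  by rewrite res_nat; case: ifP => _; rewrite ?rs ?res0.
have [r] := closed_field_poly_normal g; rewrite (eqP mg) scale1r => Eg.
have ir y : y \in r -> Z0 <= v y.
  by move=> yr; apply: (monic_root_int mg ig); rewrite Eg root_prod_XsubC.
have [_] := pint_prod ir; rewrite -Eg rg => Eq.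
have : 1 \in map res r.
  by rewrite -root_prod_XsubC -Eq /root !hornerE expr1n subrr.
move=> /mapP[rho rr er]; have irho := ir _ rr.
have rhoe : rho ^+ e = s.
  have : root g rho by rewrite Eg root_prod_XsubC.
  by rewrite /root !hornerE subr_eq0 => /eqP.
have vrho : v rho = 0 by apply: (vX_eq0 e0); rewrite rhoe.
pose z := rho * u.
have ze : z ^+ e = t' * k.
  rewrite exprMn rhoe /s; have -> : u ^+ e = t * k by rewrite divfK.
  by field.
have vz : v z = v u by rewrite Defs.valM vrho add0r.
have nz : z != 0 by rewrite mulf_neq0 // (v0_neq0 vrho).
have fixz (sg : aut) : is_gal K sg -> sg t' = t' -> v z < v (sg z - z) -> sg z = z.
  move=> gs st lt; apply: (mulIf (invr_neq0 nz)); rewrite divff //.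
  have v1 : v (sg z / z) = 0 by apply/(veq_div _ _ nz); exact: vgal.
  apply: (root_of_unity_lift ne v1).
    by rewrite expr_div_n -rmorphXn ze rmorphM st (proj2 gs _ Kk) divff // mulf_neq0.
  rewrite -(res1 v); apply/res_eq; rewrite ?v1 ?val1 //.
  by rewrite -[1](divff nz) -mulrBl -vlt_div.
have sz : sep_over K z.
  apply: (sep_over_trans hK algK (E := sep_over K)) => //.
  exists ('X^e - (t' * k)%:P); split.
  - have hS := subfield_sep_over hK algK.
    apply: (polB hS); first exact: polXn.
    apply: (polC hS); apply: (sfM hS); first exact: Kr_sep_over Kt'.
    exact: sep_over_mem.
  - by apply: separable_XnsubC => //; rewrite mulf_neq0.
  - by rewrite /root !hornerE ze subrr.
exists z; split=> //.
  apply: (fixed_sep_mem hK algK hE KE); first exact: sep_over_sub sz.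
  move=> sg gs; have gsK := gal_sub KE gs; apply: fixz => //; first exact: (proj2 gs).
  rewrite /z rmorphM (proj2 gs _ Eu) -mulrBl vz mulrC -[X in v X < _]mulr1 vlt_mul2l //.
  rewrite val1; apply/res_eq; rewrite ?vgal //.
  rewrite (res_gal hK algK hens gsK irho (_ : Z0 <= v 1)) ?val1 ?rmorph1 ?res1 //.
apply: (KrP hK algK) => // sg hs; have gs := gr_gal hs.
apply: fixz => //; first by case: Kt' => _; exact.
exact: (proj1 (gr_eq_lead v hK algK gs) hs z sz nz).
Qed.

(** The lifted products [u' i * w' j] are independent by [lindep], and the absence of defect says
    that their number is the degree. They form a basis of [K(b)] contained in [Kr]. *)
Lemma tame_Kr b : tame v K (adjoin K [set b]) -> Kr b.
Proof.
set E := adjoin K [set b].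
have hE : subfield E := @subfield_adjoin _ K [set b].
have KE : K `<=` E := @adjoin_base _ K [set b].
have hb := basis_adjoin1 hK (ax b).
move=> [_ /(_ E hE KE (fun x h => h))]; case.
  by exists (size (min_poly K b)).-1; eexists; exact: hb.
have f0 : lfree (residues K) [::] by move=> c _ _ [].
have [e [f [u [w [std Ee Ef _ _]]]]] :=
  std_gens_ex hK hE KE hb f0 (fun r h => match notF h with end).
rewrite /is_defect Ee Ef muln1 (degree_basis hK hb) => cop sepE nef.
have ngt : (0 < (size (min_poly K b)).-1)%N by rewrite -degE // deg_gt0.
have egt : (0 < e)%N by move: ngt; rewrite nef muln_gt0 => /andP[].
have ne : (e%:R : resfield v) != 0.
  apply/eqP => /(char_exp_dvd egt)[pp pe].
  move: cop; rewrite coprime_sym prime_coprime // => /negP; exact.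
have /choice[u' hu'] : forall i, exists z, [/\ E z, Kr z & v z = v (u i)].
  move=> i; have [k [Kk nk ek]] := std_gens_index hK hE std (su_mem std i) (su_nz std i).
  exact: (lift_val hE KE sepE ne (su_mem std i) (su_nz std i) Kk nk ek).
have /choice[w' hw'] : forall j, exists y, [/\ E y, Kr y, Z0 <= v y & res y = res (w j)].
  move=> j; have rj : residues E (res (w j)).
    by exists (w j) => //; split; [exact: (sw_mem std)|exact: (sw_int std)].
  exact: lift_res hE KE rj (sepE _ rj).
have nu' i : u' i != 0.
  have [_ _ e1] := hu' i; apply/eqP => e2; have := v_neq0 v (su_nz std i).
  by rewrite -e1 e2 eqxx.
have fw : rfree v K w'.
  have := std_gens_rfree std; rewrite /rfree => h c hc s0; apply: h => //.
  by rewrite -[RHS]s0; apply: eq_bigr => j _; have [_ _ _ ->] := hw' j.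
have [] := lindep_size hK hb (t := fun i j => u' i * w' j).
- by move=> i j; apply: (sfM hE); [case: (hu' i)|case: (hw' j)].
- move=> c Kc s0; apply: (lindep hK nu' _ _ fw Kc s0) => [i j k Kk nk|j]; last by case: (hw' j).
  have [_ _ ei] := hu' i; have [_ _ ej] := hu' j.
  by rewrite Defs.valM ei ej -Defs.valM; exact: (su_inj std).
move=> _ /(_ (esym nef) b (@adjoin1_id _ _ _))[c Kc ->].
have hKr := subfield_Kr v hK algK.
apply: (sf_sum hKr) => i _; apply: (sf_sum hKr) => j _; apply: (sfM hKr).
  exact: sub_Kr.
by apply: (sfM hKr); [case: (hu' i)|case: (hw' j)].
Qed.

End TameKr.

(** * Complete distinguished chains *)

Lemma card_le_seq (T : choiceType) (A : set T) (l : seq T) (N : nat) :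
  (forall x, A x -> x \in l) -> (size l <= N)%N -> (A #<= `I_N)%card.
Proof.
move=> Al lN; apply: (@card_le_trans _ _ _ `I_(size l)); last by rewrite card_le_II.
case: l Al {lN} => [|x0 l] Al.
  by rewrite (_ : A = set0) ?card_le0x // -subset0 => x /Al.
apply: card_le_trans (card_image_le (nth x0 (x0 :: l)) _).
apply: subset_card_le => x /Al /(nthP x0)[i lt <-]; by exists i.
Qed.

Section Chain.
Variables (L : closedFieldType) (G : orderedZmodType) (v : valuation L G).
Variables (K : set L) (hK : subfield K) (algK : algebraic_ext K setT).
Hypothesis hens : henselian v K.
Variables (n : nat) (s : nat -> L).
Hypotheses (hd : forall i, (i < n)%N -> distinguished_pair v K (s i) (s i.+1))
  (Ksn : K (s n)).
Local Notation aut := {rmorphism L -> L}.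
Local Notation Kr := (ramif_field v K).
Local Notation Gr := (ramif_group v K).
Local Notation vgal := (v_gal hK algK hens).
Local Notation d i := (v (s i - s i.+1)).

(** [s i.+2] has smaller degree than [s i.+1], so by minimality it does not realise the distance
    [d i], and [v (s i - s i.+2) < d i]. By the ultrametric inequality this value is [d i.+1]. *)
Lemma chain_dist_lt i : (i.+1 < n)%N -> d i.+1 < d i.
Proof.
move=> lt; have lt0 := ltnW lt; have [d1 m1 e1] := hd lt0; have [d2 m2 e2] := hd lt.
have h : v (s i - s i.+2) < d i.
  rewrite lt_neqAle m1 ?(ltn_trans d2) // andbT eq_sym.
  by apply/eqP => /e1; rewrite leqNgt d2.
have -> : s i.+1 - s i.+2 = (s i - s i.+2) + - (s i - s i.+1) by ring.
by rewrite vD_eq // Defs.valN.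
Qed.

Lemma chain_dist i j : (i <= j)%N -> (j < n)%N -> v (s i - s j.+1) = d j.
Proof.
elim: j => [|j IH]; first by rewrite leqn0 => /eqP ->.
rewrite leq_eqVlt => /orP[/eqP -> //|le] jn.
have -> : s i - s j.+2 = (s j.+1 - s j.+2) + (s i - s j.+1) by ring.
by rewrite vD_eq // IH // ?chain_dist_lt // ltnW.
Qed.

Lemma chain_Kr i j : Kr (s i) -> (i <= j <= n)%N -> Kr (s j) /\ adjoin K [set s i] (s j).
Proof.
move=> Ki; elim: j => [|j IH].
  by rewrite leqn0 => /andP[/eqP <- _]; split=> //; exact: adjoin1_id.
rewrite leq_eqVlt => /andP[/orP[/eqP <-|le] jn]; first by split=> //; exact: adjoin1_id.
have [|Kj ij] := IH; first by rewrite -ltnS le ltnW.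
split; first exact: (dist_Kr hK algK hens Kj (hd jn)).
apply: (adjoin1_min _ _ ij (dist_adjoin hK algK hens Kj (hd jn))).
  exact: subfield_adjoin.
exact: adjoin_base.
Qed.

(** For [j < n], [s i] is closer to [s j] than [s j.+1] is, so Krasner's lemma in the form
    [dist_mem] applies; for [j = n], [s j] lies in [K]. *)
Lemma chain_tame_sub i j : (i < j)%N -> (j <= n)%N -> Kr (s j) ->
  adjoin K [set s j] `<=` adjoin K [set s i] `&` Kr.
Proof.
move=> ij; rewrite leq_eqVlt => /orP[/eqP ->|jn] Kj.
  apply: adjoin1_min; [exact: subfield_tameL|exact: sub_tameL|exact: sub_tameL].
apply: adjoin1_min; [exact: subfield_tameL|exact: sub_tameL|split=> //].
apply: (dist_mem hK algK hens Kj (hd jn)).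
case: j ij jn Kj => // j ij jn _.
by rewrite (chain_dist (i := i) (j := j)) ?chain_dist_lt // ltnW.
Qed.

(* If [g = v (a - sg a)] is no [d i], let [i] be least with [d i < g]. Then
   [v (s i - sg (s i)) = g], so [sg] fixes the leading terms of [K(s i)] and agrees
   there with some [t] in [Gr], whence [v (a - t a) = g]. *)
Lemma chain_conj_dist (sg : aut) : is_gal K sg -> sg (s 0%N) != s 0%N ->
  (exists2 i, (i < n)%N & v (s 0%N - sg (s 0%N)) = d i) \/
  exists t, [/\ Gr t, t (s 0%N) != s 0%N & v (s 0%N - sg (s 0%N)) = v (s 0%N - t (s 0%N))].
Proof.
move=> gs na; set a := s 0%N in na *; set g := v (a - sg a).
have gN : g < v 0 by apply: v_lt0; rewrite subr_eq0 eq_sym.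
have [[i lt e]|none] := pselect (exists2 i, (i < n)%N & g = d i); first by left; exists i.
right; have nd i : (i < n)%N -> g != d i.
  by move=> lt; apply/eqP => e; apply: none; exists i.
have diff (t : aut) i : a - t a = (s i - t (s i)) + ((a - s i) - t (a - s i)).
  by rewrite rmorphB; ring.
have n0 : (0 < n)%N.
  rewrite lt0n; apply/eqP => e; case/eqP: na.
  by case: gs => _; apply; rewrite /a -e.
(* [n.-1] qualifies: [s n] is fixed by [sg], so [g] is at least [v (a - s n)], which equals
   [d n.-1]. *)
have ex : exists i, (i < n)%N && (d i < g).
  have lt : (n.-1 < n)%N by rewrite prednK.
  exists n.-1; rewrite lt /= lt_neqAle eq_sym (nd _ lt) /=.
  have e : v (a - s n) = d n.-1.
    by rewrite -(chain_dist (leq0n n.-1) lt) prednK.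
  have E : a - sg a = (a - s n) - sg (a - s n).
    by rewrite rmorphB (proj2 gs _ Ksn); ring.
  rewrite /g E; by apply: valB_ge; rewrite ?vgal // e.
case: (ex_minnP ex) => i /andP[lti gi] imin.
have gai : g < v (a - s i).
  case: i lti gi imin => [|i] lti gi imin; first by rewrite subrr.
  rewrite (@chain_dist 0 i) ?(ltnW lti) // lt_neqAle nd ?(ltnW lti) //=.
  rewrite leNgt; apply/negP => h.
  by have := imin i; rewrite (ltnW lti) h => /(_ isT); rewrite ltnn.
have far (t : aut) : is_gal K t -> g < v ((a - s i) - t (a - s i)).
  by move=> gt; rewrite /g; apply: vB_lt; rewrite ?vgal.
have gsi : v (s i - sg (s i)) = g.
  have -> : s i - sg (s i) = (a - sg a) + - ((a - s i) - sg (a - s i)).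
    by rewrite (diff sg i); ring.
  by rewrite vD_eq // Defs.valN; exact: far.
have rs : eq_lead v (adjoin K [set s i]) sg (aut_id L).
  by apply: (dist_eq_lead hK algK (hd lti) gs); rewrite gsi.
have [t Gt et] :=
  ramif_extend hK algK hens (@subfield_adjoin _ K [set s i]) (@adjoin_base _ _ _) gs rs.
have e : v (a - t a) = g.
  rewrite (diff t i) et; last exact: adjoin1_id.
  by rewrite vD_eq gsi //; apply: far; exact: gr_gal Gt.
exists t; split=> //; apply/eqP => e1.
by move: gN; rewrite -e e1 subrr ltxx.
Qed.

End Chain.

Theorem theorem7p1 (Kbar : closedFieldType) (G : orderedZmodType)
    (v : valuation Kbar G) (K : set Kbar)
    (K_subfield : subfield K)
    (Kbar_alg : algebraic_ext K setT)
    (K_hens : henselian v K)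
    (v_nontriv : nontrivial_on v K)
    (a : Kbar) (a_sep : sepclosure K a) (a_notin : ~ K a)
    (Ka_defectless : defectless v K (adjoin K [set a]))
    (Ka_not_tame : ~ tame v K (adjoin K [set a]))
    (n : nat) (s : nat -> Kbar)
    (s_chain : complete_distinguished_chain v K a n s) :
  let L i := adjoin K [set s i] `&` ramif_field v K in
  exists eps : nat,
    [/\ is_min [set i | (i <= n)%N /\ tame v K (adjoin K [set s i])] eps,
        (1 <= eps <= n)%N,
        adjoin K [set s i | i in [set i | (eps <= i <= n)%N]]
          = adjoin K [set s eps],
        forall i, (i < eps)%N -> adjoin K [set s eps] `<=` L i
      & (conj_dist v K a #<=
          `I_(\sum_(i < eps) logn (residue_char_exp v) (deg (L i) (s i))
              + (n - eps) + 1))%card].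
Proof.
have [s0 hd Ksn] := s_chain.
have hK := K_subfield; have algK := Kbar_alg.
pose Kr := ramif_field v K; set p := residue_char_exp v => L.
have tameP i : tame v K (adjoin K [set s i]) <-> Kr (s i).
  by split; [exact: tame_Kr|exact: Kr_tame].
pose P i := `[< (i <= n)%N /\ Kr (s i) >].
have exP : exists i, P i by exists n; apply/asboolP; split=> //; exact: sub_Kr.
case: (ex_minnP exP) => eps /asboolP[epsn Keps] epsmin.
have below i : (i < eps)%N -> ~ Kr (s i).
  move=> lt Ki; have := epsmin i; rewrite leqNgt lt => /(_ _)/notF; apply.
  by apply/asboolP; split=> //; apply: ltnW; exact: leq_trans epsn.
have eps0 : (0 < eps)%N.
  by rewrite lt0n; apply/eqP => e; apply: Ka_not_tame; rewrite -s0; apply/tameP; rewrite -e.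
have chKr := chain_Kr hK algK K_hens hd (i := eps) Keps.
exists eps; split.
- split; first by split=> //; exact/tameP.
  by move=> i [le /tameP Ki]; apply: epsmin; exact/asboolP.
- by rewrite eps0.
- apply/seteqP; split; apply: adjoin_min.
  + exact: subfield_adjoin.
  + exact: adjoin_base.
  + by move=> _ [j /chKr[_ ?] <-].
  + exact: subfield_adjoin.
  + exact: adjoin_base.
  + by move=> _ ->; apply: adjoin_mem; exists eps => //=; rewrite leqnn.
- by move=> i lt; exact: (chain_tame_sub hK algK K_hens hd Ksn lt epsn).
have sa : sep_over K a by apply/(sep_overE hK algK).
have [vals [hv sv]] := ramif_values hK algK K_hens sa.
apply: (@card_le_seq _ _ (vals ++ [seq v (s i - s i.+1) | i <- iota 0 n])).
  move=> _ [a' [na [sg gs ea]] <-]; rewrite mem_cat ea.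
  have na' : sg (s 0%N) != s 0%N by rewrite s0 -ea.
  have := chain_conj_dist hK algK K_hens hd Ksn gs na'; rewrite s0.
  move=> [[i lt ->]|[t [Gt nt ->]]]; apply/orP.
  - by right; apply/mapP; exists i; rewrite ?mem_iota.
  - by left; exact: hv.
rewrite size_cat size_map size_iota.
(* Only the term at [0] is used with its full value; each of the [eps - 1] others is counted as
   [1]. *)
have : (size vals + eps <= \sum_(i < eps) logn p (deg (L i) (s i)) + 1)%N.
  case: eps eps0 below {epsn Keps epsmin chKr} => // m _ below.
  have h0 : (size vals <= logn p (deg (L 0%N) (s 0%N)))%N by rewrite /L s0.
  rewrite big_ord_recl.
  apply: (@leq_trans (logn p (deg (L 0%N) (s 0%N)) + m + 1)%N); first by move: h0; lia.
  rewrite leq_add2r leq_add2l -[X in (X <= _)%N]card_ord -sum1_card.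
  by apply: leq_sum => i _; apply: (logn_deg_gt0 hK algK K_hens); exact: below.
move=> h; rewrite -{1}(subnKC epsn) addnA [X in (_ <= X)%N]addnAC leq_add2r.
exact: h.
Qed.
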